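(* Let $n\geq 2$ and let $S\subseteq\mathbf{P}^3$ be a general smooth surface of degree $n$ over $\mathbf{C}$. The number of points $q\in S$ such that the tangent section $\mathbf{T}_qS\cap S$ has a tacnode at $q$ equals $$\check\beta=2n(n-2)(11n-24).$$
   Context: $\mathbf{T}_qS\subseteq\mathbf{P}^3$ is the projective tangent plane of $S$ at $q$. A tacnode is an $A_3$ curve singularity (locally $y^2=x^4$). ''General'' means that $S$ corresponds to a point of a suitable non-empty Zariski open subset of the projective space of degree $n$ surfaces in $\mathbf{P}^3$. The paper's standing assumption is that for such $S$ the singularities of the dual surface $S^\vee\subseteq\check{\mathbf{P}}^3$ are, apart from its ordinary and cuspidal double curves, only those coming from planes $H$ such that $H\cap S$ has exactly one tacnode, or one node and one cusp, or three nodes (and no other singularities), and that locally at the corresponding point $S^\vee$ is isomorphic to the discriminant in the semi-universal deformation space of the multisingularity of $H\cap S$. *)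

(* Defs.v *)
From HB Require Import structures.
From mathcomp Require Import all_boot all_order all_algebra.
From mathcomp Require Import reals complex mpoly.

Set Implicit Arguments.
Unset Strict Implicit.
Unset Printing Implicit Defensive.

Import GRing.Theory.
Local Open Scope ring_scope.

(* The projective space P(V) of lines of V.  A nonzero vector of the line q,
   i.e., a vector of homogeneous coordinates of the point q, is [vpick q]. *)
Definition projective (K : fieldType) (V : vectType K) :=
  {L : {vspace V} | \dim L == 1%N}.

Section Zariski.
Variables (K : fieldType) (V : vectType K).

Definition hcoord (v : V) (i : 'I_(\dim {:V})) : K :=
  coord (vbasis {:V}) i v.

Definition zariski_closed (Z : projective V -> Prop) : Prop :=
  exists2 I : {mpoly K[\dim {:V}]} -> Prop,
    (forall G, I G -> exists d : nat, G \is d.-homog) &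
    (forall q, Z q <-> (forall G, I G -> G.@[hcoord (vpick (val q))] = 0)).

Definition zariski_open (U : projective V -> Prop) : Prop :=
  zariski_closed (fun q => ~ U q).

End Zariski.

(* A formal power series in k variables is its family of coefficients. *)
Section PowerSeries.
Variables (K : fieldType) (k : nat).

Definition series := 'X_{1..k} -> K.

Definition smul (a b : series) : series := fun m =>
  \sum_(h : 'X_{1..k < (mdeg m).+1, (mdeg m).+1} | m == (h.1 + h.2)%MM)
     a h.1 * b h.2.

Definition ssub (a b : series) : series := fun m => a m - b m.

End PowerSeries.

Section Tacnode.
Variable K : fieldType.

(* (X, Y) is a system of formal coordinates at the origin of the plane. *)
Definition local_coordinates (X Y : series K 2) : Prop :=
  [/\ X 0%MM = 0, Y 0%MM = 0 &
      X U_(0%R)%MM * Y U_(1%R)%MM - X U_(1%R)%MM * Y U_(0%R)%MM != 0].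

(* The plane curve f = 0 has an A_3 singularity at the origin: in suitable
   formal coordinates X, Y its ideal in the completed local ring K[[s, t]] of
   the plane at the origin is generated by Y^2 - X^4. *)
Definition tacnode_at0 (f : {mpoly K[2]}) : Prop :=
  exists X Y u : series K 2,
    [/\ local_coordinates X Y, u 0%MM != 0 &
        forall m : 'X_{1..2},
          f@_m = smul u (ssub (smul Y Y) (smul (smul X X) (smul X X))) m].

End Tacnode.

Section Surfaces.
Variable K : fieldType.

Notation P3 := (projective 'rV[K]_4).

(* Forms up to a scalar: reducible and non-reduced surfaces are included. *)
Definition surface (n : nat) := projective (dhomog 4 K n).

Definition equation (n : nat) (S : surface n) : {mpoly K[4]} :=
  vpick (val S) : dhomog 4 K n.

Definition gradient (F : {mpoly K[4]}) (v : 'rV[K]_4) : 'cV[K]_4 :=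
  \col_i (F^`M(i)).@[v 0].

Definition on_surface n (S : surface n) (q : P3) : Prop :=
  (equation S).@[vpick (val q) 0] = 0.

Definition smooth n (S : surface n) : Prop :=
  forall q : P3, on_surface S q ->
    gradient (equation S) (vpick (val q)) != 0.

(* T_q S, as the linear subspace of K^4 with equation
   \sum_i (dF/dx_i)(q) w_i = 0. *)
Definition tangent_plane n (S : surface n) (q : P3) : {vspace 'rV[K]_4} :=
  lker (linfun (mulmxr (gradient (equation S) (vpick (val q))))).

(* The equation F(v + s a + t b) of the restriction of F to the affine chart
   (s, t) |-> v + s a + t b of the plane spanned by v, a, b. *)
Definition plane_section (F : {mpoly K[4]}) (v a b : 'rV[K]_4) : {mpoly K[2]} :=
  F \mPo [tuple (v 0 i)%:MP + a 0 i *: 'X_0 + b 0 i *: 'X_1 | i < 4].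

Definition tacnodal n (S : surface n) (q : P3) : Prop :=
  on_surface S q /\
  exists a b : 'rV[K]_4,
    basis_of (tangent_plane S q) [:: vpick (val q); a; b] /\
    tacnode_at0 (plane_section (equation S) (vpick (val q)) a b).

End Surfaces.

(* Main.v *)
Require Import Defs.
From HB Require Import structures.
From mathcomp Require Import all_boot all_order fingroup perm all_algebra.
From mathcomp Require Import reals complex mpoly closed_field ring zify.
From mathcomp Require Import boolp classical_sets filter topology normedtype.

(* A point v of S = {F = 0} is tacnodal if and only if the Hessian matrix of F at v has a
   kernel vector w with D^3 F(v)(w, w, w) = 0; modulo v it is the tacnodal tangent direction.
   For general S these (v, w) are the zeros, all nondegenerate, on P^3 x P^3 of the six forms
   F(v), Hess F(v) w, D^3 F(v)(w, w, w), of bidegrees (n, 0), (n - 2, 1) (four times) and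
   (n - 3, 3), whose Bezout number is 18 n (n - 2)^2 + 4 n (n - 2)(n - 3).

   Bezout: two systems A, B of the same bidegrees with only nondegenerate zeros have equally
   many zeros.  In the pencil A + t (B - A) nondegenerate zeros persist (contraction
   principle) and zeros converge (compactness); moreover the set of t with at least m zeros is
   finite or cofinite by quantifier elimination.  The comparison system consists of products
   of linear forms in general position.

   Genericity: after moving an adapted frame to the coordinate frame by an LU decomposition,
   the forms with a bad point have so many prescribed coefficients that they depend
   polynomially on fewer parameters than there are coefficients, hence satisfy an algebraic
   equation. *)

Set Implicit Arguments.
Unset Strict Implicit.

Import Order.TTheory GRing.Theory Num.Theory.
Import numFieldNormedType.Exports.
Local Open Scope ring_scope.

(** The six equations live on the six-dimensional P^3 x P^3. Tangency of w and its independence from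
    v are not imposed: on a smooth surface both follow from Euler's relation Hess F(v) v = (n - 1)
    grad F(v). The Bezout number is the coefficient of h^3 k^3 in n h ((n - 2) h + k)^4 ((n - 3) h +
    3 k), which is 2 n (n - 2) (11 n - 24). The obstacle in the pencil is that intermediate members
    may have degenerate or infinitely many zeros, so zeros cannot be followed from t = 0 to t = 1.
    The finite-or-cofinite dichotomy jumps over them: at least m zeros near t = 0 gives at least m
    zeros for all but finitely many t, in particular close to t = 1, where compactness applies. The
    genericity count balances because contact along a flag v, <v, w>, <v, w, u> means six vanishing
    derivatives, and complete flags of K^4 have six parameters; any further condition makes the
    forms negligible. Quadrics are treated apart: their Hessian is constant and the count is 0. *)

(** * Polynomial functions of a family of coordinates *)

Section PolynomialFunctions.
Variables (K : comPzRingType).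

(** The coordinates are arbitrary so that one notion serves environments of formulas, points of a
    pencil and parameters of families of forms. *)
Inductive polyfun (J X : Type) (crd : J -> X -> K) : (X -> K) -> Prop :=
| PolyCst c : polyfun crd (fun=> c)
| PolyVar j : polyfun crd (crd j)
| PolyAdd f g : polyfun crd f -> polyfun crd g -> polyfun crd (fun x => f x + g x)
| PolyMul f g : polyfun crd f -> polyfun crd g -> polyfun crd (fun x => f x * g x).

Variables (J X : Type) (crd : J -> X -> K).

Lemma polyfun_ext f g : polyfun crd f -> f =1 g -> polyfun crd g.
Proof. by move=> pf /boolp.funext <-. Qed.

Lemma polyfun_comp (I Y : Type) (crd' : I -> Y -> K) (h : Y -> X) f :
  polyfun crd f -> (forall j, polyfun crd' (fun y => crd j (h y))) ->
  polyfun crd' (fun y => f (h y)).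
Proof.
move=> pf ph; elim: pf => [c|j|f1 f2 _ p1 _ p2|f1 f2 _ p1 _ p2].
- exact: PolyCst.
- exact: ph.
- exact: PolyAdd.
- exact: PolyMul.
Qed.

Lemma polyfun_sum (I : Type) (r : seq I) (P : pred I) (F : I -> X -> K) :
  (forall i, P i -> polyfun crd (F i)) ->
  polyfun crd (fun x => \sum_(i <- r | P i) F i x).
Proof.
move=> pF; elim: r => [|i r IH].
  by apply: polyfun_ext (PolyCst _ 0) _ => x; rewrite big_nil.
have [Pi|nPi] := boolP (P i).
  apply: polyfun_ext (PolyAdd (pF i Pi) IH) _ => x; by rewrite big_cons Pi.
by apply: polyfun_ext IH _ => x; rewrite big_cons (negPf nPi).
Qed.

Lemma polyfun_exp f n : polyfun crd f -> polyfun crd (fun x => f x ^+ n).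
Proof.
move=> pf; elim: n => [|n IH]; first exact: PolyCst.
by apply: polyfun_ext (PolyMul pf IH) _ => x; rewrite exprS.
Qed.

Lemma polyfun_scale c f : polyfun crd f -> polyfun crd (fun x => c * f x).
Proof. exact: PolyMul (PolyCst _ _). Qed.

Lemma polyfun_sub f g : polyfun crd f -> polyfun crd g ->
  polyfun crd (fun x => f x - g x).
Proof.
move=> pf pg; apply: polyfun_ext (PolyAdd pf (polyfun_scale (-1) pg)) _ => x.
by rewrite mulN1r.
Qed.

End PolynomialFunctions.

(** * Definable sets over an algebraically closed field *)

Section Definability.
Variable K : closedFieldType.
Implicit Types (P Q : (nat -> K) -> Prop) (r : nat -> K).

Definition env_crd (i : nat) (r : nat -> K) : K := r i.

(** Formulas are evaluated on finite lists padded by 0; stating properties on total environments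
    makes substitution of blocks of variables simple. *)
Definition definable P := exists f : GRing.formula K,
  forall e, GRing.holds e f <-> P (nth 0 e).

Lemma definable_iff P Q : definable P -> (forall r, P r <-> Q r) -> definable Q.
Proof. by case=> f fP PQ; exists f => e; rewrite fP. Qed.

Lemma polyfun_term g : polyfun env_crd g ->
  exists t : GRing.term K, forall e, GRing.eval e t = g (nth 0 e).
Proof.
elim=> [c|j|f1 f2 _ [t1 e1] _ [t2 e2]|f1 f2 _ [t1 e1] _ [t2 e2]].
- by exists (GRing.Const c).
- by exists (GRing.Var _ j).
- by exists (GRing.Add t1 t2) => e /=; rewrite e1 e2.
- by exists (GRing.Mul t1 t2) => e /=; rewrite e1 e2.
Qed.

Lemma definable_eq0 g : polyfun env_crd g -> definable (fun r => g r = 0).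
Proof.
case/polyfun_term=> t et; exists (GRing.Equal t (GRing.Const 0)) => e /=.
by rewrite et.
Qed.

Lemma definable_and P Q : definable P -> definable Q ->
  definable (fun r => P r /\ Q r).
Proof. by move=> [f fP] [g gQ]; exists (GRing.And f g) => e /=; rewrite fP gQ. Qed.

Lemma definable_not P : definable P -> definable (fun r => ~ P r).
Proof. by move=> [f fP]; exists (GRing.Not f) => e /=; rewrite fP. Qed.

Lemma definable_true : definable (fun=> True).
Proof. by exists (GRing.Bool true). Qed.

Lemma definable_all (I : eqType) (s : seq I) (F : I -> (nat -> K) -> Prop) :
  (forall i, definable (F i)) ->
  definable (fun r => forall i, i \in s -> F i r).
Proof.
move=> dF; elim: s => [|i s IH]; first exact: definable_iff definable_true _.
apply: definable_iff (definable_and (dF i) IH) _ => r; split.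
  by move=> [Fi Fs] j; rewrite inE => /predU1P[->//|/Fs].
by move=> Fs; split=> [|j js]; apply: Fs; rewrite inE ?eqxx ?js ?orbT.
Qed.

Lemma definable_forall (I : finType) (F : I -> (nat -> K) -> Prop) :
  (forall i, definable (F i)) -> definable (fun r => forall i, F i r).
Proof.
move=> dF; apply: definable_iff (definable_all (enum I) dF) _ => r.
by split=> Fr i; [apply: Fr; rewrite mem_enum|move=> _].
Qed.

Lemma definable_exists (I : finType) (F : I -> (nat -> K) -> Prop) :
  (forall i, definable (F i)) -> definable (fun r => exists i, F i r).
Proof.
move=> dF; have := definable_not (definable_forall (fun i => definable_not (dF i))).
move/definable_iff; apply=> r.
by split=> [/boolp.existsNP[i /boolp.contrapT]|[i Fi] /(_ i)]; first exists i.
Qed.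

Definition update r i x : nat -> K := fun j => if j == i then x else r j.

Lemma definable_ex1 i P : definable P -> definable (fun r => exists x, P (update r i x)).
Proof.
move=> [f fP]; exists (GRing.Exists i f) => e /=; split=> -[x]; exists x.
  suff -> : update (nth 0 e) i x = nth 0 (set_nth 0 e i x) by apply/fP.
  by apply: boolp.funext => j; rewrite nth_set_nth /= /update.
apply/fP; suff <- : update (nth 0 e) i x = nth 0 (set_nth 0 e i x) by [].
by apply: boolp.funext => j; rewrite nth_set_nth /= /update.
Qed.

Lemma definable_block a P l : definable P ->
  definable (fun r => exists y : nat -> K,
                P (fun j => if (a <= j < a + l)%N then y j else r j)).
Proof.
move=> dP; elim: l => [|l IH].
  apply: definable_iff dP _ => r; have E (y : nat -> K) :
    (fun j => if (a <= j < a + 0)%N then y j else r j) = r.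
    by apply: boolp.funext => j; rewrite addn0 -ltnS; case: ltngtP.
  by split=> [Pr|[y]]; [exists r|]; rewrite E.
apply: definable_iff (definable_ex1 (a + l) IH) _ => r.
split=> [[x [y]] Py|[y Py]].
  exists (update y (a + l) x); congr P: Py; apply: boolp.funext => j.
  by rewrite /update addnS ltnS; case: ltngtP => // ->; rewrite leq_addr.
exists (y (a + l)%N), y; congr P: Py; apply: boolp.funext => j.
by rewrite /update addnS ltnS; case: ltngtP => // ->; rewrite leq_addr.
Qed.

Lemma rterm_poly (t : GRing.term K) : GRing.rterm t ->
  exists p : {poly K}, forall x, GRing.eval [:: x] t = p.[x].
Proof.
elim: t => //= [i _|c _|n _|t1 IH1 t2 IH2|t1 IH1|t1 IH1 n|t1 IH1 t2 IH2|t1 IH1 n].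
- case: i => [|i]; first by exists 'X => x; rewrite hornerX.
  (* Variables of positive index take the default value 0 of the one-element environment. *)
  by exists 0 => x; rewrite horner0 /= nth_nil.
- by exists c%:P => x; rewrite hornerC.
- by exists n%:R => x; rewrite -polyC_natr hornerC.
- case/andP=> /IH1[p ep] /IH2[q eq]; exists (p + q) => x.
  by rewrite hornerD ep eq.
- by move=> /IH1[p ep]; exists (- p) => x; rewrite hornerN ep.
- by move=> /IH1[p ep]; exists (p *+ n) => x; rewrite hornerMn ep.
- case/andP=> /IH1[p ep] /IH2[q eq]; exists (p * q) => x.
  by rewrite hornerM ep eq.
- by move=> /IH1[p ep]; exists (p ^+ n) => x; rewrite horner_exp ep.
Qed.

(** The exceptional set is recorded by a polynomial vanishing on it, so that Boolean combinations
    just multiply polynomials. *)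
Definition finite_or_cofinite (P : K -> Prop) := exists p : {poly K}, p != 0 /\
  ((forall x, ~~ root p x -> P x) \/ (forall x, ~~ root p x -> ~ P x)).

Lemma finite_or_cofinite_op (g : bool -> bool -> bool) (a b : K -> bool) :
  finite_or_cofinite a -> finite_or_cofinite b ->
  finite_or_cofinite (fun x => g (a x) (b x)).
Proof.
have val (c : K -> bool) : finite_or_cofinite c ->
    exists p v, p != 0 /\ forall x, ~~ root p x -> c x = v.
  move=> [p [p0 [Hp|Hp]]]; [exists p, true|exists p, false]; split=> // x /Hp //.
  by move/negP/negPf.
move=> /val[p [u [p0 Hp]]] /val[q [v [q0 Hq]]].
exists (p * q); rewrite mulf_neq0 //; split=> //.
by have [G|/negP G] := boolP (g u v); [left|right] => x;
  rewrite rootM negb_or => /andP[/Hp -> /Hq ->].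
Qed.

Lemma qf_finite_or_cofinite (f : GRing.formula K) :
  GRing.qf_form f && GRing.rformula f ->
  finite_or_cofinite (fun x => GRing.qf_eval [:: x] f).
Proof.
elim: f => //=.
- by case=> _; exists 1; rewrite oner_neq0; split=> //; [left|right].
- move=> t1 t2 /andP[/rterm_poly[p ep] /rterm_poly[q eq]].
  (* An atom p = q fails outside the roots of p - q, unless the two polynomials coincide. *)
  have [Epq|npq] := eqVneq p q; last first.
    exists (p - q); rewrite subr_eq0; split=> //; right=> x.
    by rewrite ep eq rootE !hornerE subr_eq0 => /negP.
  exists 1; rewrite oner_neq0; split=> //; left=> x _.
  by rewrite ep eq Epq eqxx.
- move=> f1 IH1 f2 IH2 /andP[/andP[q1 q2] /andP[r1 r2]].
  by apply: (finite_or_cofinite_op andb); [apply: IH1; rewrite q1|apply: IH2; rewrite q2].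
- move=> f1 IH1 f2 IH2 /andP[/andP[q1 q2] /andP[r1 r2]].
  by apply: (finite_or_cofinite_op orb); [apply: IH1; rewrite q1|apply: IH2; rewrite q2].
- move=> f1 IH1 f2 IH2 /andP[/andP[q1 q2] /andP[r1 r2]].
  by apply: (finite_or_cofinite_op implb); [apply: IH1; rewrite q1|apply: IH2; rewrite q2].
- by move=> f1 IH1 /IH1 H; apply: (finite_or_cofinite_op (fun b _ => ~~ b) H H).
Qed.

(** Quantifier elimination leaves a Boolean combination of polynomial equations in one variable. *)
Lemma definable_finite_or_cofinite P : definable P ->
  finite_or_cofinite (fun x => P (nth 0 [:: x])).
Proof.
move=> [f fP]; pose g := GRing.to_rform f.
have K_closed : GRing.closed_field_axiom K by exact: solve_monicpoly.
have wf := @ClosedFieldQE.wf_ex_elim K.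
have ok := ClosedFieldQE.holds_ex_elim K_closed.
have rg : GRing.rformula g by exact: GRing.to_rform_rformula.
have [p [p0 Hp]] := qf_finite_or_cofinite (GRing.quantifier_elim_wf wf rg).
have gP x : reflect (P (nth 0 [:: x]))
    (GRing.qf_eval [:: x] (GRing.quantifier_elim (@ClosedFieldQE.ex_elim K) g)).
  apply: (iffP (GRing.quantifier_elim_rformP wf ok _ rg)).
    by move/GRing.to_rformP/fP.
  by move/fP/GRing.to_rformP.
exists p; split=> //; case: Hp => Hp; [left|right] => x /Hp; first by move/gP.
by move=> nP /gP.
Qed.

End Definability.

Lemma cvg_ext (K : numFieldType) (T : Type) (F : set_system T) (f g : T -> K) (l l' : K) :
  (f @ F --> l)%classic -> f =1 g -> l = l' -> (g @ F --> l')%classic.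
Proof. by move=> fl /funext <- <-. Qed.

(** Characteristic 0 gives infinitely many roots. Only positive integers are tested, because
    [homogeneous_part] can rescale by nonzero scalars only. *)
Lemma poly_vanishing_eq0 (K : numFieldType) (p : {poly K}) : (forall n : nat, p.[n.+1%:R] = 0) -> p = 0.
Proof.
move=> H; apply/eqP/negPn/negP => nz.
have := @max_poly_roots _ p [seq n.+1%:R | n <- iota 0 (size p)] nz.
rewrite size_map size_iota ltnn => /(_ _ _)/negP; apply=> //; last first.
  by rewrite map_inj_uniq ?iota_uniq // => a b /eqP; rewrite eqr_nat eqSS => /eqP.
by apply/allP => _ /mapP[n _ ->]; rewrite rootE H.
Qed.

(** * Polynomial maps with their derivatives *)

Section DifferentiablePolynomialMaps.
Local Open Scope classical_set_scope.
Variables (K : numFieldType) (k : nat).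
Implicit Types (x y h : 'rV[K]_k) (f : 'rV[K]_k -> K) (df : 'rV[K]_k -> 'rV[K]_k -> K).

(* df x h is the derivative at x of the polynomial function f in the direction h. *)
Inductive pmap : ('rV[K]_k -> K) -> ('rV[K]_k -> 'rV[K]_k -> K) -> Prop :=
| PmapCst c : pmap (fun=> c) (fun _ _ => 0)
| PmapVar j : pmap (fun x => x 0 j) (fun _ h => h 0 j)
| PmapAdd f df g dg : pmap f df -> pmap g dg ->
    pmap (fun x => f x + g x) (fun x h => df x h + dg x h)
| PmapMul f df g dg : pmap f df -> pmap g dg ->
    pmap (fun x => f x * g x) (fun x h => f x * dg x h + df x h * g x).

Lemma pmap_ext f df g dg :
  pmap f df -> f =1 g -> (forall x h, df x h = dg x h) -> pmap g dg.
Proof.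
by move=> pf /funext <- E; have -> : dg = df by apply/funext=> x; apply/funext=> h.
Qed.

Lemma pmap_sum (I : Type) (r : seq I) (P : pred I) (f : I -> 'rV[K]_k -> K)
    (df : I -> 'rV[K]_k -> 'rV[K]_k -> K) :
  (forall i, P i -> pmap (f i) (df i)) ->
  pmap (fun x => \sum_(i <- r | P i) f i x) (fun x h => \sum_(i <- r | P i) df i x h).
Proof.
move=> pF; elim: r => [|i r IH].
  by apply: pmap_ext (PmapCst 0) _ _ => x *; rewrite big_nil.
have [Pi|nPi] := boolP (P i).
  by apply: pmap_ext (PmapAdd (pF i Pi) IH) _ _ => x *; rewrite big_cons Pi.
by apply: pmap_ext IH _ _ => x *; rewrite big_cons (negPf nPi).
Qed.

Lemma pmap_scale c f df : pmap f df ->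
  pmap (fun x => c * f x) (fun x h => c * df x h).
Proof.
move=> pf; apply: pmap_ext (PmapMul (PmapCst c) pf) _ _ => // x h.
by rewrite mul0r addr0.
Qed.

Lemma pmap_sub f df g dg : pmap f df -> pmap g dg ->
  pmap (fun x => f x - g x) (fun x h => df x h - dg x h).
Proof.
move=> pf pg; apply: pmap_ext (PmapAdd pf (pmap_scale (-1) pg)) _ _ => x *;
by rewrite mulN1r.
Qed.

Lemma pmap_polyfun f df : pmap f df -> polyfun (fun j (x : 'rV[K]_k) => x 0 j) f.
Proof.
elim=> [c|j|f1 d1 g1 e1 _ p1 _ p2|f1 d1 g1 e1 _ p1 _ p2].
- exact: PolyCst.
- exact: PolyVar.
- exact: PolyAdd.
- exact: PolyMul.
Qed.

Lemma pmap_line f df x h : pmap f df ->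
  exists p : {poly K}, [/\ forall e, f (x + e *: h) = p.[e],
     p`_0 = f x & p`_1 = df x h].
Proof.
elim=> [c|j|f1 d1 g1 e1 _ [p [ep p0 p1]] _ [q [eq q0 q1]]|
        f1 d1 g1 e1 _ [p [ep p0 p1]] _ [q [eq q0 q1]]].
- by exists c%:P; split=> [e||]; rewrite ?hornerC ?coefC.
- exists ((x 0 j)%:P + (h 0 j) *: 'X); split=> [e||].
  + by rewrite !hornerE !mxE mulrC.
  + by rewrite coefD coefC coefZ coefX mulr0 addr0.
  + by rewrite coefD coefC coefZ coefX mulr1 add0r.
- by exists (p + q); split=> [e||]; rewrite ?hornerD ?ep ?eq ?coefD ?p0 ?q0 ?p1 ?q1.
- exists (p * q); split=> [e||].
  + by rewrite hornerM ep eq.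
  + by rewrite coef0M p0 q0.
  + by rewrite coefM !big_ord_recl big_ord0 /= addr0 p0 q1 p1 q0.
Qed.

(** A function may have many derivations in [pmap]; on each line, however, the derivative is the
    linear coefficient of the restricted polynomial. *)
Lemma pmap_deriv_unique f df dg : pmap f df -> pmap f dg ->
  forall x h, df x h = dg x h.
Proof.
move=> pf pg x h; have [p [ep _ <-]] := pmap_line x h pf.
have [q [eq _ <-]] := pmap_line x h pg; suff -> : p = q by [].
apply/eqP; rewrite -subr_eq0; apply/eqP.
by apply: poly_vanishing_eq0 => n; rewrite !hornerE -ep -eq subrr.
Qed.

(** Convergence along any filter, because both neighbourhood filters and ultrafilters occur. *)
Definition vcvg (T : Type) (F : set_system T) (x : T -> 'rV[K]_k) (x0 : 'rV[K]_k) :=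
  forall j, (fun t => x t 0 j) @ F --> x0 0 j.

Lemma pmap_cvg f df (T : Type) (F : set_system T) {FF : Filter F} (x : T -> 'rV[K]_k) x0 :
  pmap f df -> vcvg F x x0 -> (fun t => f (x t)) @ F --> f x0.
Proof.
move=> pf xx; elim: pf => [c|j|f1 d1 g1 e1 _ p1 _ p2|f1 d1 g1 e1 _ p1 _ p2].
- exact: cvg_cst.
- exact: xx.
- exact: cvgD.
- exact: cvgM.
Qed.

(** Hadamard's lemma. The difference quotients, continuous in both points and equal to the partial
    derivatives on the diagonal, take the place of a mean value inequality. *)
Lemma hadamard f df : pmap f df ->
  exists g : 'I_k -> 'rV[K]_k -> 'rV[K]_k -> K,
  [/\ forall x y, f x - f y = \sum_j (x 0 j - y 0 j) * g j x y,
      forall x h, df x h = \sum_j h 0 j * g j x x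
    & forall j (T : Type) (F : set_system T) (FF : Filter F) (x y : T -> 'rV[K]_k) x0 y0,
        vcvg F x x0 -> vcvg F y y0 ->
        (fun t => g j (x t) (y t)) @ F --> g j x0 y0].
Proof.
elim=> [c|i|f1 d1 f2 d2 _ [g1 [E1 D1 C1]] _ [g2 [E2 D2 C2]]|
        f1 d1 f2 d2 P1 [g1 [E1 D1 C1]] P2 [g2 [E2 D2 C2]]].
- exists (fun _ _ _ => 0); split=> [x y|x h|*]; last exact: cvg_cst.
    by rewrite subrr big1 // => j _; rewrite mulr0.
  by rewrite big1 // => j _; rewrite mulr0.
- have E (h : 'rV[K]_k) : \sum_j h 0 j * (j == i)%:R = h 0 i.
    by rewrite (bigD1 i) //= eqxx mulr1 big1 ?addr0 // => j /negPf ->; rewrite mulr0.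
  exists (fun j _ _ => (j == i)%:R); split=> [x y|x h|*]; [|by rewrite E|exact: cvg_cst].
  by rewrite -!E -sumrB; apply: eq_bigr => j _; rewrite mulrBl.
- exists (fun j x y => g1 j x y + g2 j x y); split=> [x y|x h|*].
  + rewrite opprD addrACA E1 E2 -big_split /=.
    by apply: eq_bigr => j _; rewrite mulrDr.
  + by rewrite D1 D2 -big_split /=; apply: eq_bigr => j _; rewrite mulrDr.
  + by apply: cvgD; [apply: C1|apply: C2].
- exists (fun j x y => f1 x * g2 j x y + g1 j x y * f2 y); split=> [x y|x h|].
  + have -> : f1 x * f2 x - f1 y * f2 y =
      f1 x * (f2 x - f2 y) + (f1 x - f1 y) * f2 y.
      by rewrite mulrBr mulrBl addrA subrK.
    rewrite E1 E2 mulr_sumr mulr_suml -big_split /=.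
    by apply: eq_bigr => j _; rewrite mulrDr mulrCA -!mulrA.
  + rewrite D1 D2 mulr_sumr mulr_suml -big_split /=.
    by apply: eq_bigr => j _; rewrite mulrDr mulrCA -!mulrA.
  + move=> j T F FF x y x0 y0 xx yy; apply: cvgD.
      by apply: cvgM; [exact: pmap_cvg P1 xx|exact: C2 xx yy].
    by apply: cvgM; [exact: C1 xx yy|exact: pmap_cvg P2 yy].
Qed.

Definition norm1 (h : 'rV[K]_k) : K := \sum_j `|h 0 j|.

Lemma norm1_ge0 h : 0 <= norm1 h.
Proof. exact: sumr_ge0. Qed.

Lemma norm1_eq0 h : (norm1 h == 0) = (h == 0).
Proof.
apply/eqP/eqP => [/eqP|->]; last by apply: big1 => j _; rewrite mxE normr0.
rewrite psumr_eq0 // => /allP H; apply/rowP => j; rewrite mxE.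
by apply/eqP; rewrite -normr_eq0; apply: H; rewrite mem_index_enum.
Qed.

Lemma norm1_0 : norm1 0 = 0.
Proof. by apply/eqP; rewrite norm1_eq0. Qed.

Lemma ler_norm1D h1 h2 : norm1 (h1 + h2) <= norm1 h1 + norm1 h2.
Proof.
by rewrite -big_split /=; apply: ler_sum => j _; rewrite mxE ler_normD.
Qed.

Lemma norm1N h : norm1 (- h) = norm1 h.
Proof. by apply: eq_bigr => j _; rewrite mxE normrN. Qed.

Lemma norm1Z a h : norm1 (a *: h) = `|a| * norm1 h.
Proof. by rewrite mulr_sumr; apply: eq_bigr => j _; rewrite mxE normrM. Qed.

Lemma ler_coord_norm1 h j : `|h 0 j| <= norm1 h.
Proof. by rewrite /norm1 (bigD1 j) //= lerDl sumr_ge0. Qed.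

Lemma norm1_mulmx_le h (N : 'M[K]_k) eta : (forall i j, `|N i j| <= eta) ->
  norm1 (h *m N) <= k%:R * eta * norm1 h.
Proof.
move=> HN; rewrite /norm1.
have -> : k%:R * eta * (\sum_j `|h 0 j|) = \sum_(l < k) \sum_j `|h 0 j| * eta.
  rewrite sumr_const card_ord -mulr_suml -[RHS]mulr_natl.
  by rewrite -mulrA [eta * _]mulrC.
apply: ler_sum => l _; rewrite mxE; apply: le_trans (ler_norm_sum _ _ _) _.
by apply: ler_sum => j _; rewrite normrM ler_wpM2l.
Qed.

End DifferentiablePolynomialMaps.

(** * The contraction attached to a nondegenerate zero *)

Section LocalSolutions.
Local Open Scope classical_set_scope.
Variables (K : numFieldType) (k : nat).
Variables (A C : 'I_k -> 'rV[K]_k -> K) (dA dC : 'I_k -> 'rV[K]_k -> 'rV[K]_k -> K).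
Hypotheses (pA : forall i, pmap (A i) (dA i)) (pC : forall i, pmap (C i) (dC i)).
Variable x0 : 'rV[K]_k.
Hypothesis injA : forall h, (forall i, dA i x0 h = 0) -> h = 0.

Definition pencil t x : 'rV[K]_k := \row_i (A i x + t * C i x).

(** Basic neighbourhoods of (x0, x0, 0) in the space of triples (x, y, t). *)
Definition tiny_ball (r : K) : set ('rV[K]_k * 'rV[K]_k * K) :=
  [set p | [/\ norm1 (p.1.1 - x0) <= r, norm1 (p.1.2 - x0) <= r & `|p.2| <= r]].

Lemma exists_min (r s : K) : 0 < r -> 0 < s -> exists2 q, 0 < q & q <= r /\ q <= s.
Proof.
move=> r0 s0; have [rs|sr] := real_leP (gtr0_real r0) (gtr0_real s0).
  by exists r.
by exists s => //; rewrite ltW.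
Qed.

Definition tiny_filter := filter_from [set r : K | 0 < r] tiny_ball.

Lemma tiny_filterP : Filter tiny_filter.
Proof.
apply: filter_from_filter; first by exists 1; rewrite /= ltr01.
move=> r s r0 s0; have [q q0 [qr qs]] := exists_min r0 s0.
exists q => // p [h1 h2 h3]; split; split;
  exact: (le_trans h1) || exact: (le_trans h2) || exact: (le_trans h3).
Qed.

Lemma tiny_cvg_small (f : 'rV[K]_k * 'rV[K]_k * K -> 'rV[K]_k) :
  (forall p r, tiny_ball r p -> norm1 (f p - x0) <= r) -> vcvg tiny_filter f x0.
Proof.
have FF := tiny_filterP => Hf j; apply/cvgrPdist_le => e e0.
exists e => // p /Hf; apply: le_trans; rewrite distrC.
by apply: le_trans (ler_coord_norm1 _ j); rewrite !mxE.
Qed.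

(** M is the inverse of the Jacobian at x0. By [hadamard] the difference of pencil values is (x - y)
    G(x, y, t) with G continuous and G M = 1 at (x0, x0, 0), so 1 - G M is small nearby. *)
Lemma contraction : exists2 M : 'M[K]_k, M \in unitmx & exists2 r : K, 0 < r &
  forall t x y, `|t| <= r -> norm1 (x - x0) <= r -> norm1 (y - x0) <= r ->
  norm1 ((x - y) - (pencil t x - pencil t y) *m M) <= norm1 (x - y) / 2.
Proof.
have FF := tiny_filterP.
have /choice[gA gAP] := fun i => hadamard (pA i).
have /choice[gC gCP] := fun i => hadamard (pC i).
pose J : 'M[K]_k := \matrix_(j, i) gA i j x0 x0.
have hJ h : h *m J = \row_i dA i x0 h.
  apply/rowP => i; rewrite !mxE; have [_ -> _] := gAP i.
  by apply: eq_bigr => j _; rewrite mxE.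
have uJ : J \in unitmx.
  rewrite -row_free_unit -kermx_eq0; apply/eqP/row_matrixP => i.
  rewrite row0; apply: injA => l.
  have := hJ (row i (kermx J)); rewrite -row_mul mulmx_ker row0.
  by move=> /rowP /(_ l); rewrite !mxE.
exists (invmx J); first by rewrite unitmx_inv.
pose G (p : 'rV[K]_k * 'rV[K]_k * K) : 'M[K]_k :=
  \matrix_(j, i) (gA i j p.1.1 p.1.2 + p.2 * gC i j p.1.1 p.1.2).
have hG t x y : pencil t x - pencil t y = (x - y) *m G (x, y, t).
  apply/rowP => i; rewrite !mxE.
  rewrite opprD addrACA -mulrBr.
  have [-> _ _] := gAP i; have [-> _ _] := gCP i.
  rewrite mulr_sumr -big_split /=; apply: eq_bigr => j _.
  by rewrite !mxE /= mulrDr mulrCA.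
have cG j i : (fun p => G p j i) @ tiny_filter --> J j i.
  have -> : J j i = gA i j x0 x0 + 0 * gC i j x0 x0 by rewrite mul0r addr0 mxE.
  have cx : vcvg tiny_filter (fun p => p.1.1) x0.
    by apply: tiny_cvg_small => p r [].
  have cy : vcvg tiny_filter (fun p => p.1.2) x0.
    by apply: tiny_cvg_small => p r [].
  have ct : (fun p => p.2 : K) @ tiny_filter --> (0 : K).
    apply/cvgrPdist_le => e e0; exists e => // p [_ _].
    by rewrite sub0r normrN.
  have [_ _ /(_ j _ _ FF _ _ _ _ cx cy) cA] := gAP i.
  have [_ _ /(_ j _ _ FF _ _ _ _ cx cy) cC] := gCP i.
  by apply: cvg_ext (cvgD cA (cvgM ct cC)) _ _ => // p; rewrite /G mxE.
pose N p := 1%:M - G p *m invmx J.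
have cN j l : (fun p => N p j l) @ tiny_filter --> (0 : K).
  have -> : (0 : K) = (1%:M - J *m invmx J) j l by rewrite mulmxV // subrr mxE.
  have cS : (fun p => \sum_i G p j i * invmx J i l) @ tiny_filter -->
     \sum_i J j i * invmx J i l.
    apply: cvg_big; first exact: add_continuous.
    by move=> i _; apply: cvgM; [exact: cG|exact: cvg_cst].
  by apply: cvg_ext (cvgB (cvg_cst ((1%:M : 'M[K]_k) j l)) cS) _ _ => [p|];
    rewrite /N !mxE.
(* Entries bounded by eta give a factor k eta <= 1/2; the successor keeps eta positive for k = 0. *)
pose eta : K := (2 * k.+1)%:R^-1.
have eta0 : 0 < eta by rewrite invr_gt0 ltr0n.
have : \forall p \near tiny_filter, forall j l, `|N p j l| <= eta.
  apply: filter_forall => j; apply: filter_forall => l.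
  have /cvgrPdist_le/(_ _ eta0) := cN j l.
  by apply: filterS => p; rewrite sub0r normrN.
case=> r r0 Hr; exists r => // t x y tr xr yr.
rewrite hG -mulmxA -{1}[x - y]mulmx1 -mulmxBr.
apply: le_trans (norm1_mulmx_le (x - y) (eta := eta) _) _.
  by apply: (Hr (x, y, t)).
rewrite mulrC ler_wpM2l ?norm1_ge0 // /eta natrM invfM mulrCA.
rewrite ler_piMr ?invr_ge0 ?ler0n // ler_pdivrMr ?ltr0n //.
by rewrite mul1r ler_nat.
Qed.

End LocalSolutions.

(** * Compactness expressed by ultrafilters *)

Section Ultralimits.
Local Open Scope classical_set_scope.
Variable K : numFieldType.

(** Compactness of the closed unit disc, kept as a hypothesis on K so that the analysis stays over
    an abstract field; [complex_ultralimits] provides it. *)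
Definition bounded_ultralimits := forall (T : Type) (U : set_system T),
  UltraFilter U -> forall f : T -> K, (forall t, `|f t| <= 1) ->
  exists l : K, f @ U --> l.

Hypothesis hK : bounded_ultralimits.

Lemma vector_ultralimit k (T : Type) (U : set_system T) (x : T -> 'rV[K]_k) x0 (c : K) :
  UltraFilter U -> (forall t, norm1 (x t - x0) <= c) -> exists l, vcvg U x l.
Proof.
move=> UU Hx.
have FF : ProperFilter U by exact: ultra_proper.
have c0 (t : T) : 0 <= c by exact: le_trans (norm1_ge0 _) (Hx t).
have /choice[l Hl] j : exists l : K, (fun t => x t 0 j) @ U --> l.
  (* Dividing by c + 1 avoids a separate case c = 0. *)
  pose f t := (x t 0 j - x0 0 j) / (c + 1).
  have [t|l Hl] := @hK T U UU f.
    have c1 : 0 < c + 1 by rewrite ltr_wpDl // (c0 t).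
    rewrite normrM normfV (gtr0_norm c1) ler_pdivrMr // mul1r.
    apply: (@le_trans _ _ c); last by rewrite lerDl.
    apply: le_trans (Hx t); apply: le_trans (ler_coord_norm1 _ j).
    by rewrite !mxE.
  exists (x0 0 j + (c + 1) * l).
  apply: cvg_ext (cvgD (cvg_cst (x0 0 j)) (cvgM (cvg_cst (c + 1)) Hl)) _ _ => // t /=.
  have c1 : c + 1 != 0 by rewrite gt_eqF // ltr_wpDl // (c0 t).
  transitivity (x0 0 j + (c + 1) * f t) => //.
  by rewrite /f [_ * (_ / _)]mulrC divfK // addrC subrK.
by exists (\row_j l j) => j; rewrite mxE.
Qed.

Lemma norm1_cvg k (T : Type) (F : set_system T) {FF : Filter F}
    (x : T -> 'rV[K]_k) l :
  vcvg F x l -> (fun t => norm1 (x t)) @ F --> norm1 l.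
Proof.
move=> xl; apply: cvg_big; first exact: add_continuous.
by move=> j _; apply: cvg_norm.
Qed.

Lemma vcvg_norm1 k (T : Type) (F : set_system T) {FF : Filter F}
    (x : T -> 'rV[K]_k) l :
  (fun t => norm1 (x t - l)) @ F --> (0 : K) -> vcvg F x l.
Proof.
move=> xl j; apply/cvgrPdist_le => e e0; move/cvgrPdist_le: xl => /(_ e e0).
apply: filterS => t; rewrite sub0r normrN distrC ger0_norm ?norm1_ge0 //.
by apply: le_trans; apply: le_trans (ler_coord_norm1 _ j); rewrite !mxE.
Qed.

Lemma norm1_limit_le k (T : Type) (F : set_system T) {FF : ProperFilter F}
    (x : T -> 'rV[K]_k) l x0 (c : K) :
  vcvg F x l -> (\forall t \near F, norm1 (x t - x0) <= c) -> norm1 (l - x0) <= c.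
Proof.
move=> xl Hx; apply/ler_addgt0Pr => e e0.
have cl : (fun t => norm1 (l - x t)) @ F --> (0 : K).
  rewrite -(norm1_0 K k) -(subrr l); apply: norm1_cvg => j.
  by apply: cvg_ext (cvgB (cvg_cst (l 0 j)) (xl j)) _ _ => [t|]; rewrite !mxE.
move/cvgrPdist_le: cl => /(_ e e0) le_cl.
have [t [xc]] := filter_ex (filterI Hx le_cl).
rewrite sub0r normrN ger0_norm ?norm1_ge0 // => le_e.
have -> : l - x0 = (x t - x0) + (l - x t) by rewrite [RHS]addrC addrA subrK.
by apply: le_trans (ler_norm1D _ _) _; apply: lerD.
Qed.

End Ultralimits.

(** * Zeros of a pencil near a nondegenerate zero *)

Section ZerosOfPencils.
Local Open Scope classical_set_scope.
Variables (K : numFieldType) (k : nat).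
Hypothesis hK : bounded_ultralimits K.
Variables (A C : 'I_k -> 'rV[K]_k -> K) (dA dC : 'I_k -> 'rV[K]_k -> 'rV[K]_k -> K).
Hypotheses (pA : forall i, pmap (A i) (dA i)) (pC : forall i, pmap (C i) (dC i)).
Variable x0 : 'rV[K]_k.
Hypothesis injA : forall h, (forall i, dA i x0 h = 0) -> h = 0.

(** At two zeros the contraction estimate bounds the distance by half of itself. *)
Lemma pencil_zero_unique : exists2 r : K, 0 < r &
  forall t x y, `|t| <= r -> norm1 (x - x0) <= r -> norm1 (y - x0) <= r ->
  pencil A C t x = 0 -> pencil A C t y = 0 -> x = y.
Proof.
have [M uM [r r0 Hr]] := contraction pA pC injA.
exists r => // t x y tr xr yr Ex Ey; apply/eqP; rewrite -subr_eq0 -norm1_eq0.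
have := Hr t x y tr xr yr; rewrite Ex Ey subrr mul0mx subr0.
rewrite ler_pdivlMr ?ltr0n // mulr_natr mulr2n gerDr => le0.
by rewrite eq_le le0 norm1_ge0.
Qed.

Lemma vcvg_mulmx (T : Type) (F : set_system T) {FF : Filter F}
    (y : T -> 'rV[K]_k) l (M : 'M[K]_k) :
  vcvg F y l -> vcvg F (fun t => y t *m M) (l *m M).
Proof.
move=> yl j; apply: (@cvg_ext _ _ _ (fun t => \sum_i y t 0 i * M i j)
    _ (\sum_i l 0 i * M i j)) => [|t|]; rewrite ?mxE //.
apply: cvg_big; first exact: add_continuous.
by move=> i _; apply: cvgM; [exact: yl|exact: cvg_cst].
Qed.

Lemma pencil_cvg (T : Type) (F : set_system T) {FF : Filter F}
    (t : T -> K) (y : T -> 'rV[K]_k) t0 l :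
  t @ F --> t0 -> vcvg F y l ->
  vcvg F (fun s => pencil A C (t s) (y s)) (pencil A C t0 l).
Proof.
move=> tt yl i; apply: (@cvg_ext _ _ _ (fun s => A i (y s) + t s * C i (y s))
    _ (A i l + t0 * C i l)) => [|s|]; rewrite ?mxE //.
apply: cvgD; first exact: pmap_cvg (pA i) yl.
by apply: cvgM => //; exact: pmap_cvg (pC i) yl.
Qed.

(* Iterating the contraction x |-> x - Q_t(x) M from x0; an ultralimit of the
   iterates is a fixed point. *)
Lemma pencil_zero_exists : (forall i, A i x0 = 0) ->
  exists x : K -> 'rV[K]_k,
    (\forall t \near (0 : K), pencil A C t (x t) = 0) /\ vcvg (nbhs (0 : K)) x x0.
Proof.
move=> Ax0; have [M uM [r r0 Hr]] := contraction pA pC injA.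
(* At x0 the pencil takes the value t C(x0), so the first step has length at most |t| c; the summand
   1 makes c positive. *)
pose c := 1 + norm1 ((\row_i C i x0) *m M).
have c0 : 0 < c by rewrite ltr_pwDl ?norm1_ge0 ?ltr01.
pose T t x := x - pencil A C t x *m M.
have HT t x y : `|t| <= r -> norm1 (x - x0) <= r -> norm1 (y - x0) <= r ->
    norm1 (T t x - T t y) <= norm1 (x - y) / 2.
  move=> tr xr yr; have := Hr t x y tr xr yr; rewrite mulmxBl.
  by congr (_ <= _); congr norm1; rewrite /T !opprD !opprK addrACA.
have T0 t : norm1 (T t x0 - x0) <= `|t| * c.
  rewrite /T addrAC subrr add0r norm1N.
  have -> : pencil A C t x0 = t *: \row_i C i x0.
    by apply/rowP => i; rewrite !mxE Ax0 add0r.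
  rewrite -scalemxAl norm1Z ler_wpM2l // /c lerDr ler01 //.
have sol t : exists x, `|t| <= r -> `|t| * c *+ 2 <= r ->
    pencil A C t x = 0 /\ norm1 (x - x0) <= `|t| * c *+ 2.
  have [tr|ntr] := boolP (`|t| <= r); last by exists 0.
  have [sr|nsr] := boolP (`|t| * c *+ 2 <= r); last by exists 0.
  (* The ball of radius s is mapped into itself, because s / 2 + |t| c = s. *)
  pose s := `|t| * c *+ 2.
  have s0 : 0 <= s by rewrite mulrn_wge0 // mulr_ge0 // ltW.
  pose X n := iter n (T t) x0.
  have Xs n : norm1 (X n - x0) <= s.
    elim: n => [|n IH]; first by rewrite subrr norm1_0.
    rewrite /= -(subrK (T t x0) (T t (X n))) -addrA.
    apply: le_trans (ler_norm1D _ _) _; rewrite /s mulr2n; apply: lerD (T0 t).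
    apply: le_trans (HT t _ x0 tr (le_trans IH sr) _) _.
      by rewrite subrr norm1_0 ltW.
    by rewrite ler_pdivrMr ?ltr0n // mulr_natr.
  pose v n := X n.+1 - X n.
  have vE n : v n = - (pencil A C t (X n) *m M).
    by rewrite /v /= /T addrAC subrr add0r.
  have v2 n : norm1 (v n.+1) <= norm1 (v n) / 2.
    exact: (HT t (X n.+1) (X n) tr (le_trans (Xs n.+1) sr) (le_trans (Xs n) sr)).
  have vle m n : (m <= n)%N -> norm1 (v n) <= norm1 (v m).
    elim: n => [|n IH]; first by rewrite leqn0 => /eqP ->.
    rewrite leq_eqVlt ltnS => /orP[/eqP -> //|/IH]; apply: le_trans.
    apply: le_trans (v2 n) _; rewrite ler_pdivrMr ?ltr0n //.
    by rewrite mulr_natr mulr2n lerDl norm1_ge0.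
  have [V [UV oV]] := @ultraFilterLemma nat \oo _.
  have PV : ProperFilter V by exact: ultra_proper.
  have [l Xl] := vector_ultralimit hK UV Xs.
  exists l => _ _; split; last first.
    by apply: norm1_limit_le Xl _; apply: nearW.
  pose w := - (pencil A C t l *m M).
  have vw : vcvg V v w.
    move=> j; apply: (@cvg_ext _ _ _ (fun n => - (pencil A C t (X n) *m M) 0 j)
        _ (- (pencil A C t l *m M) 0 j)) => [|n|].
    - by apply: cvgN; apply: vcvg_mulmx; apply: pencil_cvg Xl; exact: cvg_cst.
    - by rewrite vE [RHS]mxE.
    - by rewrite [RHS]mxE.
  (* The increments v m halve at each step, so their ultralimit w has twice its norm below every |v
     m|. As |v m| tends to |w|, this forces w = 0, and the limit l is a zero. *)
  have wle m : norm1 w *+ 2 <= norm1 (v m).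
    rewrite -mulr_natr -ler_pdivlMr ?ltr0n //; apply: le_trans (v2 m).
    rewrite -[w]subr0; apply: norm1_limit_le vw _; apply: oV.
    by exists m.+1 => // n /= mn; rewrite subr0; apply: vle.
  have w0 : norm1 w <= 0.
    apply/ler_addgt0Pr => e e0; rewrite add0r.
    have nc : (fun n => norm1 (v n)) @ V --> norm1 w :=
      @norm1_cvg K k nat V (@filter_filter _ V PV) v w vw.
    have /filter_ex[m Hm] := (@cvgrPdist_le K K nat V (@filter_filter _ V PV) _ _).1 nc e e0.
    have /real_ler_norm : norm1 (v m) - norm1 w \is Num.real.
      by rewrite realB // ger0_real ?norm1_ge0.
    rewrite distrC => /le_trans /(_ Hm); rewrite lerBlDr => /(le_trans (wle m)).
    by rewrite mulr2n lerD2r.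
  have /eqP : norm1 w = 0 by apply/eqP; rewrite eq_le w0 norm1_ge0.
  rewrite norm1_eq0 oppr_eq0 => /eqP /(congr1 (mulmx^~ (invmx M))).
  by rewrite mulmxK // mul0mx.
have [x Hx] := choice sol; exists x.
have [q q0 [q1 q2]] : exists2 q : K, 0 < q & q <= r /\ q * c *+ 2 <= r.
  have d0 : 0 < r / (c *+ 2) by rewrite divr_gt0 // mulrn_wgt0.
  have [q q0 [q1 q2]] := exists_min r0 d0; exists q => //; split=> //.
  by rewrite -mulrnAr -ler_pdivlMr // mulrn_wgt0.
have near_q : \forall t \near (0 : K), `|t| <= q by exact: nbhs0_le.
have Hq : \forall t \near (0 : K),
    pencil A C t (x t) = 0 /\ norm1 (x t - x0) <= `|t| * c *+ 2.
  apply: filterS near_q => t tq; apply: Hx; first exact: le_trans tq q1.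
  by apply: le_trans q2; rewrite lerMn2r /= ler_pM2r.
split; first by apply: filterS Hq => t [].
apply: vcvg_norm1; apply/cvgrPdist_le => e e0.
have d0 : 0 < e / (c *+ 2) by rewrite divr_gt0 // mulrn_wgt0.
have near_e : \forall t \near (0 : K), `|t| <= e / (c *+ 2) by exact: nbhs0_le.
apply: filterS2 Hq near_e => t [_ xt] te; rewrite sub0r normrN ger0_norm ?norm1_ge0 //.
by apply: le_trans xt _; rewrite -mulrnAr -ler_pdivlMr // mulrn_wgt0.
Qed.

End ZerosOfPencils.

(** * Zeros of bihomogeneous systems on P^3 x P^3 *)

Section BiprojectiveZeros.
Variable K : fieldType.
Local Notation V8 := 'rV[K]_(4 + 4).

(** The 2 x 2 minors make proportionality first-order definable and its negation an open
    condition. *)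
Definition parallel n (u v : 'rV[K]_n) := forall i j, u 0 i * v 0 j = u 0 j * v 0 i.

Definition same_point (x y : V8) :=
  parallel (lsubmx x) (lsubmx y) /\ parallel (rsubmx x) (rsubmx y).

Definition bizero (A : 'I_6 -> V8 -> K) x :=
  [/\ lsubmx x != 0, rsubmx x != 0 & forall i, A i x = 0].

(** Only lower bounds are expressed: they are first-order, and an upper bound follows by
    transferring them to a system whose zeros are known. *)
Definition has_zeros A m := exists s : 'I_m -> V8,
  (forall a, bizero A (s a)) /\ (forall a b, a != b -> ~ same_point (s a) (s b)).

Definition bihomog (d e : 'I_6 -> nat) (A : 'I_6 -> V8 -> K) :=
  forall i a b x, A i (row_mx (a *: lsubmx x) (b *: rsubmx x)) =
    a ^+ d i * b ^+ e i * A i x.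

(** The differential always kills the two scaling directions at a zero; nondegeneracy says that its
    kernel is no larger. *)
Definition nondegenerate (dA : 'I_6 -> V8 -> V8 -> K) x := forall h,
  (forall i, dA i x h = 0) ->
  (exists a, lsubmx h = a *: lsubmx x) /\ (exists b, rsubmx h = b *: rsubmx x).

Lemma parallelZl n a (u v : 'rV[K]_n) : a != 0 -> parallel (a *: u) v -> parallel u v.
Proof.
move=> a0 uv i j; apply: (mulfI a0).
by have := uv i j; rewrite !mxE !mulrA.
Qed.

Lemma parallelC n (u v : 'rV[K]_n) : parallel u v -> parallel v u.
Proof. by move=> uv i j; rewrite mulrC uv mulrC. Qed.

Lemma parallelZ n a b (u v : 'rV[K]_n) : a != 0 -> b != 0 ->
  parallel (a *: u) (b *: v) -> parallel u v.
Proof.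
by move=> a0 b0 /(parallelZl a0)/parallelC/(parallelZl b0)/parallelC.
Qed.

Lemma parallel_chart n (u v : 'rV[K]_n) i : parallel u v ->
  u 0 i != 0 -> v 0 i != 0 -> (u 0 i)^-1 *: u = (v 0 i)^-1 *: v.
Proof.
move=> uv ui vi; apply/rowP => j; rewrite !mxE.
apply: (mulfI ui); rewrite mulVKf // mulrCA uv mulrCA mulVf //.
by rewrite mulr1.
Qed.

Lemma parallel_coord n (u v : 'rV[K]_n) i : parallel u v -> v != 0 ->
  u 0 i != 0 -> v 0 i != 0.
Proof.
move=> uv v0 ui; apply: contraNneq v0 => vi; apply/eqP/rowP => j; rewrite mxE.
by apply: (mulfI ui); rewrite uv vi !mulr0.
Qed.

Lemma parallelP n (u v : 'rV[K]_n) : u != 0 -> parallel u v ->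
  exists a, v = a *: u.
Proof.
case/rV0Pn=> i ui uv; exists (v 0 i / u 0 i); apply/rowP => j; rewrite mxE.
by apply: (mulfI ui); rewrite uv [RHS]mulrA [u 0 i * (_ / _)]mulrC divfK // mulrC.
Qed.

Lemma scale_parallel n (u : 'rV[K]_n) a : parallel u (a *: u).
Proof. by move=> i j; rewrite !mxE mulrCA [RHS]mulrCA [u 0 i * _]mulrC. Qed.

Lemma parallel_trans n (u v w : 'rV[K]_n) : v != 0 ->
  parallel u v -> parallel v w -> parallel u w.
Proof.
move=> v0 /parallelC/(parallelP v0)[a ->] /(parallelP v0)[b ->] i j.
by rewrite !mxE mulrACA [RHS]mulrACA [v 0 i * _]mulrC.
Qed.

Lemma same_point_sym x y : same_point x y -> same_point y x.
Proof. by case=> h1 h2; split; apply: parallelC. Qed.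

Lemma same_point_trans A x y z : bizero A y ->
  same_point x y -> same_point y z -> same_point x z.
Proof.
by case=> l0 r0 _ [l1 r1] [l2 r2]; split;
  [apply: parallel_trans l1 l2|apply: parallel_trans r1 r2].
Qed.

Definition chart i j (x : V8) : V8 :=
  row_mx ((lsubmx x 0 i)^-1 *: lsubmx x) ((rsubmx x 0 j)^-1 *: rsubmx x).

Lemma bizero_scale d e A a b x : bihomog d e A -> a != 0 -> b != 0 ->
  bizero A x -> bizero A (row_mx (a *: lsubmx x) (b *: rsubmx x)).
Proof.
move=> hA a0 b0 [l0 r0 Ax]; split; rewrite ?row_mxKl ?row_mxKr ?scaler_eq0 ?negb_or ?a0 ?b0 //.
by move=> i; rewrite hA Ax mulr0.
Qed.

Lemma chart_same x y i j : lsubmx x 0 i != 0 -> lsubmx y 0 i != 0 ->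
  rsubmx x 0 j != 0 -> rsubmx y 0 j != 0 ->
  chart i j x = chart i j y -> same_point x y.
Proof.
move=> xi yi xj yj /eq_row_mx[El Er]; split.
  apply: (@parallelZ _ (lsubmx x 0 i)^-1 (lsubmx y 0 i)^-1); rewrite ?invr_eq0 // El.
  by move=> a b; rewrite mulrC.
apply: (@parallelZ _ (rsubmx x 0 j)^-1 (rsubmx y 0 j)^-1); rewrite ?invr_eq0 // Er.
by move=> a b; rewrite mulrC.
Qed.

Lemma same_chart x y i j : lsubmx x 0 i != 0 -> lsubmx y != 0 ->
  rsubmx x 0 j != 0 -> rsubmx y != 0 ->
  same_point x y -> chart i j x = chart i j y.
Proof.
move=> xi y0 xj y0' [pl pr]; rewrite /chart (parallel_chart pl xi) ?(parallel_chart pr xj) //.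
  exact: parallel_coord pr y0' xj.
exact: parallel_coord pl y0 xi.
Qed.

End BiprojectiveZeros.

(** * Square systems in affine charts *)

Section ChartSystem.
Variables (K : numFieldType).
Local Notation V8 := 'rV[K]_(4 + 4).
Variables (A : 'I_6 -> V8 -> K) (dA : 'I_6 -> V8 -> V8 -> K) (i j : 'I_4) (c : K).

(** Two normalisations complete the six forms to eight equations on K^8, the square shape that the
    contraction requires. *)
Definition chart_equation (f : 'I_6 -> K) (a b : K) (l : 'I_8) : K :=
  match split (l : 'I_(6 + 2)) with inl i' => f i' | inr r => c * (if r == ord0 then a else b) end.

Lemma chart_equation_eq0 f a b : c != 0 -> (forall l, chart_equation f a b l = 0) <->
  [/\ forall i', f i' = 0, a = 0 & b = 0].
Proof.
move=> c0; rewrite /chart_equation; split=> [H|[f0 -> ->] l]; last first.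
  by case: split => // r; rewrite if_same mulr0.
split=> [i'||]; first by have := H (lshift 2 i'); rewrite (unsplitK (inl i')).
  by have := H (rshift 6 (0 : 'I_2)); rewrite (unsplitK (inr _)) => /eqP; rewrite mulf_eq0
    (negPf c0) => /eqP.
by have := H (rshift 6 (1 : 'I_2)); rewrite (unsplitK (inr _)) => /eqP; rewrite mulf_eq0
  (negPf c0) => /eqP.
Qed.

Definition chart_zero (x : V8) :=
  [/\ forall l, A l x = 0, x 0 (lshift 4 i) = 1 & x 0 (rshift 4 j) = 1].

(* In a pencil of two chart systems the normalisation x_i = y_j = 1 is imposed by the first
   one, with c = 1; the second one has c = 0. *)
Definition chart_system l (x : V8) : K :=
  chart_equation (A^~ x) (x 0 (lshift 4 i) - 1) (x 0 (rshift 4 j) - 1) l.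

Definition chart_deriv l (x h : V8) : K :=
  chart_equation (fun i' => dA i' x h) (h 0 (lshift 4 i)) (h 0 (rshift 4 j)) l.

Lemma chart_pmap : (forall l, pmap (A l) (dA l)) ->
  forall l, pmap (chart_system l) (chart_deriv l).
Proof.
move=> pA l; rewrite /chart_system /chart_deriv /chart_equation; case: split => [i'|r] //.
have pl (l' : 'I_(4 + 4)) : pmap (fun x : V8 => c * (x 0 l' - 1)) (fun _ h => c * h 0 l').
  apply: pmap_ext (pmap_scale c (pmap_sub (@PmapVar K 8 l') (@PmapCst K 8 1))) _ _ => // x h.
  by rewrite subr0.
by case: (r == ord0).
Qed.

Lemma chart_system_eq0 x : c != 0 -> (forall l, chart_system l x = 0) <->
  chart_zero x.
Proof.
move=> c0; rewrite (chart_equation_eq0 _ _ _ c0).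
split=> -[H0 H1 H2]; split=> //; rewrite ?H1 ?H2 ?subrr //;
  by apply/eqP; rewrite -subr_eq0 ?H1 ?H2.
Qed.

(** The kernel of the differential consists of the two scaling directions, which the linearised
    normalisations exclude. *)
Lemma chart_deriv_inj x : c != 0 -> nondegenerate dA x ->
  x 0 (lshift 4 i) = 1 -> x 0 (rshift 4 j) = 1 ->
  forall h, (forall l, chart_deriv l x h = 0) -> h = 0.
Proof.
move=> c0 nd xi xj h /(chart_equation_eq0 _ _ _ c0)[/nd[[a Ea] [b Eb]] hi hj].
rewrite -[h]hsubmxK Ea Eb.
have -> : a = 0.
  by move/rowP/(_ i): Ea; rewrite !mxE hi xi mulr1.
have -> : b = 0.
  by move/rowP/(_ j): Eb; rewrite !mxE hj xj mulr1.
by rewrite !scale0r row_mx0.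
Qed.

End ChartSystem.

(** * Persistence of zeros under small deformations *)

Section LocalBehaviour.
Local Open Scope classical_set_scope.
Variable K : numFieldType.
Hypothesis hK : bounded_ultralimits K.
Local Notation V8 := 'rV[K]_(4 + 4).
Variables (A C : 'I_6 -> V8 -> K) (dA dC : 'I_6 -> V8 -> V8 -> K).
Hypotheses (pA : forall i, pmap (A i) (dA i)) (pC : forall i, pmap (C i) (dC i)).

Definition deform t i (x : V8) := A i x + t * C i x.

Lemma pencil_chart i j t x :
  pencil (chart_system A i j 1) (chart_system C i j 0) t x = 0 <-> chart_zero (deform t) i j x.
Proof.
have E l : pencil (chart_system A i j 1) (chart_system C i j 0) t x 0 l =
    chart_system (deform t) i j 1 l x.
  rewrite mxE /chart_system /chart_equation.
  by case: split => // r; rewrite mul0r mulr0 addr0.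
rewrite -(chart_system_eq0 _ _ _ _ (oner_neq0 K)).
by split=> [H l|H]; [rewrite -E H mxE|apply/rowP => l; rewrite E H mxE].
Qed.

Lemma local_uniqueness i j z : nondegenerate dA z ->
  z 0 (lshift 4 i) = 1 -> z 0 (rshift 4 j) = 1 ->
  exists2 r : K, 0 < r & forall t x y,
    [/\ `|t| <= r, norm1 (x - z) <= r & norm1 (y - z) <= r] ->
    chart_zero (deform t) i j x -> chart_zero (deform t) i j y -> x = y.
Proof.
move=> nd zi zj.
have inj := chart_deriv_inj (oner_neq0 K) nd zi zj.
have [r r0 Hr] := pencil_zero_unique (chart_pmap i j 1 pA) (chart_pmap i j 0 pC) inj.
exists r => // t x y [tr xr yr] Hx Hy.
by apply: (Hr t x y) => //; apply/pencil_chart.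
Qed.

Lemma local_existence i j z : nondegenerate dA z -> (forall l, A l z = 0) ->
  z 0 (lshift 4 i) = 1 -> z 0 (rshift 4 j) = 1 ->
  exists x : K -> V8, (\forall t \near (0 : K), bizero (deform t) (x t)) /\
    vcvg (nbhs (0 : K)) x z.
Proof.
move=> nd Az zi zj.
have inj := chart_deriv_inj (oner_neq0 K) nd zi zj.
have Az' l : chart_system A i j 1 l z = 0.
  by move: l; apply/chart_system_eq0; rewrite ?oner_neq0.
have [x [Hx xz]] :=
  pencil_zero_exists hK (chart_pmap i j 1 pA) (chart_pmap i j 0 pC) inj Az'.
exists x; split=> //; apply: filterS Hx => t /pencil_chart[Hx xi xj].
by split=> //; apply/rV0Pn; [exists i|exists j]; rewrite mxE ?xi ?xj oner_neq0.
Qed.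

Lemma not_parallel n (u v : 'rV[K]_n) : ~ parallel u v ->
  exists i j, u 0 i * v 0 j - u 0 j * v 0 i != 0.
Proof.
move=> np; apply: contrapT => /forallNP H; apply: np => i j; apply/eqP.
by rewrite -subr_eq0; apply: contrapT => /negP ne; apply: (H i); exists j.
Qed.

Lemma near_not_parallel n (T : Type) (F : set_system T) {FF : Filter F}
    (x y : T -> 'rV[K]_n) u v :
  vcvg F x u -> vcvg F y v -> ~ parallel u v -> \forall t \near F, ~ parallel (x t) (y t).
Proof.
move=> xu yv /not_parallel[i [j ne]].
have : (fun t => x t 0 i * y t 0 j - x t 0 j * y t 0 i) @ F -->
    u 0 i * v 0 j - u 0 j * v 0 i.
  exact: cvgB (cvgM (xu i) (yv j)) (cvgM (xu j) (yv i)).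
move=> /cvgr_neq0/(_ ne); apply: filterS => t /negP H pxy; apply: H.
by rewrite pxy subrr.
Qed.

Lemma vcvg_lsubmx (T : Type) (F : set_system T) (x : T -> V8) z :
  vcvg F x z -> vcvg F (fun t => lsubmx (x t)) (lsubmx z).
Proof.
by move=> xz i; apply: cvg_ext (xz (lshift 4 i)) _ _ => [t|]; rewrite mxE.
Qed.

Lemma vcvg_rsubmx (T : Type) (F : set_system T) (x : T -> V8) z :
  vcvg F x z -> vcvg F (fun t => rsubmx (x t)) (rsubmx z).
Proof.
by move=> xz i; apply: cvg_ext (xz (rshift 4 i)) _ _ => [t|]; rewrite mxE.
Qed.

Variables d e : 'I_6 -> nat.
Hypotheses (hA : bihomog d e A) (hC : bihomog d e C).

Lemma deform_bihomog t : bihomog d e (deform t).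
Proof. by move=> i a b x; rewrite /deform hA hC mulrDr mulrCA. Qed.

Lemma bizero_chart t x i j : bizero (deform t) x ->
  lsubmx x 0 i != 0 -> rsubmx x 0 j != 0 ->
  chart_zero (deform t) i j (chart i j x).
Proof.
move=> Zx xi xj; split.
- by have [] := bizero_scale (@deform_bihomog t) (invr_neq0 xi) (invr_neq0 xj) Zx.
- by rewrite row_mxEl mxE mulVf.
- by rewrite row_mxEr mxE mulVf.
Qed.

Lemma deform0 x i : deform 0 i x = A i x.
Proof. by rewrite /deform mul0r addr0. Qed.

Lemma bizero_deform0 x : bizero A x -> bizero (deform 0) x.
Proof. by case=> l0 r0 Ax; split=> // i; rewrite deform0. Qed.

Hypothesis ndA : forall x, bizero A x -> nondegenerate dA x.

(** Each zero is continued in a chart containing it. Being non-proportional is an open condition, so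
    the continued zeros stay distinct. *)
Lemma has_zeros_near0 m : has_zeros A m ->
  \forall t \near (0 : K), has_zeros (deform t) m.
Proof.
case=> s [Zs Ds].
have loc a : exists z, [/\ bizero A z, same_point (s a) z &
   exists x : K -> V8, (\forall t \near (0 : K), bizero (deform t) (x t)) /\
    vcvg (nbhs (0 : K)) x z].
  have [/rV0Pn[i si] /rV0Pn[j sj] _] := Zs a.
  pose z := chart i j (s a); exists z.
  have [Az zi zj] := bizero_chart (bizero_deform0 (Zs a)) si sj.
  have Zz : bizero A z by exact: bizero_scale hA (invr_neq0 si) (invr_neq0 sj) (Zs a).
  have sz : same_point (s a) z.
    by split; rewrite ?row_mxKl ?row_mxKr; apply: scale_parallel.
  split=> //.
  apply: (local_existence (i := i) (j := j)) => //; first exact: ndA.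
  by move=> l; rewrite -deform0.
have [z Hz] := choice loc.
have /choice[x Hx] : forall a, exists x : K -> V8,
    (\forall t \near (0 : K), bizero (deform t) (x t)) /\ vcvg (nbhs (0 : K)) x (z a).
  by move=> a; have [] := Hz a.
have Dz a b : a != b -> ~ same_point (z a) (z b).
  move=> ab; have [Za sza _] := Hz a; have [Zb szb _] := Hz b.
  move=> zab; apply: (Ds a b ab); apply: (same_point_trans Za sza).
  by apply: (same_point_trans Zb zab); apply: same_point_sym.
have FN : Filter (nbhs (0 : K)) by exact: nbhs_filter.
have N1 : \forall t \near (0 : K), forall a, bizero (deform t) (x a t).
  by apply: (filter_forall (f := fun a t => bizero (deform t) (x a t)) FN) => a; have [] := Hx a.
have N2 : \forall t \near (0 : K), forall a b, a != b -> ~ same_point (x a t) (x b t).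
  apply: (filter_forall (f := fun a t => forall b, a != b -> ~ same_point (x a t) (x b t)) FN) => a.
  apply: (filter_forall (f := fun b t => a != b -> ~ same_point (x a t) (x b t)) FN) => b.
  have [->|ab] := eqVneq a b; first by apply: filterE => t /negP[].
  have [_ xa] := Hx a; have [_ xb] := Hx b.
  have [nl|nr] : ~ parallel (lsubmx (z a)) (lsubmx (z b)) \/
      ~ parallel (rsubmx (z a)) (rsubmx (z b)).
    by apply/not_andP; apply: Dz.
    apply: (@filterS _ _ FN) (near_not_parallel (vcvg_lsubmx xa) (vcvg_lsubmx xb) nl).
    by move=> t npl _ [].
  apply: (@filterS _ _ FN) (near_not_parallel (vcvg_rsubmx xa) (vcvg_rsubmx xb) nr).
  by move=> t npl _ [].
by apply: filterS2 N1 N2 => t h1 h2; exists (fun a => x a t).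
Qed.

End LocalBehaviour.

(** * Limits of zeros *)

Section LimitZeros.
Local Open Scope classical_set_scope.
Variable K : numFieldType.
Hypothesis hK : bounded_ultralimits K.
Local Notation V8 := 'rV[K]_(4 + 4).
Variables (A C : 'I_6 -> V8 -> K) (dA dC : 'I_6 -> V8 -> V8 -> K).
Hypotheses (pA : forall i, pmap (A i) (dA i)) (pC : forall i, pmap (C i) (dC i)).
Variables d e : 'I_6 -> nat.
Hypotheses (hA : bihomog d e A) (hC : bihomog d e C).
Hypothesis ndA : forall x, bizero A x -> nondegenerate dA x.

Local Notation H := (deform A C).

(** Representatives of norm 1 in both factors are bounded, and their limits cannot have a zero
    component. *)
Lemma bizero_normalize t x : bizero (H t) x -> exists y,
  [/\ bizero (H t) y, same_point x y, same_point y x,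
      norm1 (lsubmx y) = 1 & norm1 (rsubmx y) = 1].
Proof.
move=> Zx; have [l0 r0 _] := Zx.
have l0' : norm1 (lsubmx x) != 0 by rewrite norm1_eq0.
have r0' : norm1 (rsubmx x) != 0 by rewrite norm1_eq0.
pose y := row_mx ((norm1 (lsubmx x))^-1 *: lsubmx x) ((norm1 (rsubmx x))^-1 *: rsubmx x).
have xy : same_point x y.
  by split; rewrite ?row_mxKl ?row_mxKr; apply: scale_parallel.
exists y; split=> //; last 2 first.
- by rewrite row_mxKl norm1Z ger0_norm ?invr_ge0 ?norm1_ge0 // mulVf.
- by rewrite row_mxKr norm1Z ger0_norm ?invr_ge0 ?norm1_ge0 // mulVf.
- exact: (bizero_scale (deform_bihomog hA hC t) (invr_neq0 l0') (invr_neq0 r0') Zx).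
- exact: same_point_sym.
Qed.

Lemma norm1_row (x : V8) : norm1 x = norm1 (lsubmx x) + norm1 (rsubmx x).
Proof.
by rewrite /norm1 big_split_ord /=; congr (_ + _); apply: eq_bigr => i _; rewrite mxE.
Qed.

Lemma chart_cvg (T : Type) (F : set_system T) {FF : Filter F} (x : T -> V8) z i j :
  vcvg F x z -> lsubmx z 0 i != 0 -> rsubmx z 0 j != 0 ->
  vcvg F (fun t => chart i j (x t)) (chart i j z).
Proof.
move=> xz zi zj l; have xl := vcvg_lsubmx xz; have xr := vcvg_rsubmx xz.
rewrite -[l](@splitK 4 4); case: split => l' /=.
  apply: cvg_ext (cvgM (cvgV zi (xl i)) (xl l')) _ _ => [t|];
    by rewrite row_mxEl [RHS]mxE.
apply: cvg_ext (cvgM (cvgV zj (xr j)) (xr l')) _ _ => [t|];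
  by rewrite row_mxEr [RHS]mxE.
Qed.

(** Normalised zeros have ultralimits. If two of these were the same point, then for some t both
    zeros would lie in the uniqueness ball around it in a common chart and coincide. *)
Lemma has_zeros_limit m : (\forall t \near (0 : K)^', has_zeros (H t) m) ->
  has_zeros A m.
Proof.
move=> near_m.
have /choice[s Hs] t : exists s : 'I_m -> V8, (forall a, norm1 (s a - 0) <= 1 + 1) /\
    (has_zeros (H t) m -> [/\ forall a, bizero (H t) (s a),
      forall a b, a != b -> ~ same_point (s a) (s b)
    & forall a, norm1 (lsubmx (s a)) = 1 /\ norm1 (rsubmx (s a)) = 1]).
  have [[s [Zs Ds]]|nz] := pselect (has_zeros (H t) m); last first.
    by exists (fun=> 0); split=> // a; rewrite subrr norm1_0 addr_ge0 ?ler01.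
  have /choice[s' Hs'] a := bizero_normalize (Zs a).
  exists s'; split=> [a|_].
    by have [_ _ _ nl nr] := Hs' a; rewrite subr0 norm1_row nl nr.
  split=> [a|a b ab sab|a]; [by have [] := Hs' a| |by have [] := Hs' a].
  have [Za saa' _ _ _] := Hs' a; have [Zb _ sbb' _ _] := Hs' b.
  apply: (Ds a b ab); apply: (same_point_trans Za saa').
  exact: (same_point_trans Zb sab).
(* U refines the punctured neighbourhoods of 0, so along U the parameter tends to 0 and the m zeros
   exist. *)
have [U [UU sU]] := ultraFilterLemma (Proper_dnbhs_numFieldType (0 : K)).
have PU : ProperFilter U by exact: ultra_proper.
have FU : Filter U by exact: filter_filter.
have Um : U [set t | has_zeros (H t) m] by exact: sU.
have Ut : (fun t : K => t) @ U --> (0 : K).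
  by move=> S nS; apply: sU; apply: nbhs_dnbhs.
have /choice[z Hz] a : exists z, vcvg U (fun t => s t a) z.
  by apply: (vector_ultralimit hK UU (x0 := 0) (c := 1 + 1)) => t; have [] := Hs t.
have Un a : U [set t | norm1 (lsubmx (s t a)) = 1 /\ norm1 (rsubmx (s t a)) = 1].
  by apply: (@filterS _ _ FU) Um => t Zt; have [_ /(_ Zt)[_ _ h]] := Hs t; exact: h.
have lim (c : K) (f : K -> K) (l : K) : f @ U --> l -> U [set t | f t = c] -> l = c.
  move=> fl fc; apply: (cvg_unique (@norm_hausdorff K K) fl).
  have : (fun=> c) @ U --> c by exact: cvg_cst.
  by apply: cvg_trans; apply: near_eq_cvg; apply: (@filterS _ _ FU) fc => t ->.
have Zz a : bizero A (z a).
  split.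
  - rewrite -norm1_eq0 (lim 1 _ _ (norm1_cvg (FF := FU) (vcvg_lsubmx (Hz a)))) ?oner_neq0 //.
    by apply: (@filterS _ _ FU) (Un a) => t [].
  - rewrite -norm1_eq0 (lim 1 _ _ (norm1_cvg (FF := FU) (vcvg_rsubmx (Hz a)))) ?oner_neq0 //.
    by apply: (@filterS _ _ FU) (Un a) => t [].
  - move=> i; have c1 := pmap_cvg (FF := FU) (pA i) (Hz a).
    have c2 := pmap_cvg (FF := FU) (pC i) (Hz a).
    have c3 := cvgD (FF := FU) c1 (cvgM (FF := FU) Ut c2); rewrite mul0r addr0 in c3.
    have := lim 0 (fun t => H t i (s t a)) (A i (z a)) c3; apply.
    apply: (@filterS _ _ FU) Um => t Zt; have [_ /(_ Zt)[h _ _]] := Hs t.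
    by have [_ _ hi] := h a; exact: hi.
exists z; split=> // a b ab zab.
have [/rV0Pn[i zi] /rV0Pn[j zj] _] := Zz a; have [zb0 zb0' _] := Zz b.
have zbi := parallel_coord zab.1 zb0 zi; have zbj := parallel_coord zab.2 zb0' zj.
have Ezab := same_chart zi zb0 zj zb0' zab.
have Zc := bizero_scale hA (invr_neq0 zi) (invr_neq0 zj) (Zz a).
have ci : chart i j (z a) 0 (lshift 4 i) = 1 by rewrite row_mxEl mxE mulVf.
have cj : chart i j (z a) 0 (rshift 4 j) = 1 by rewrite row_mxEr mxE mulVf.
have [r r0 Hr] := local_uniqueness pA pC (ndA Zc) ci cj.
have near_ball c : vcvg U (fun t => chart i j (s t c)) (chart i j (z a)) ->
    U [set t | norm1 (chart i j (s t c) - chart i j (z a)) <= r].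
  move=> cz; have cv : vcvg U (fun t => chart i j (s t c) - chart i j (z a)) 0.
    move=> l; have cc := cvg_cst (FF := FU) (chart i j (z a) 0 l).
    apply: cvg_ext (cvgB (FF := FU) (cz l) cc) _ _ => [t|].
      by rewrite [RHS]mxE [X in _ = _ + X]mxE.
    by rewrite [RHS]mxE subrr.
  have nc := norm1_cvg (FF := FU) cv; rewrite norm1_0 in nc.
  apply: (@filterS _ _ FU) ((cvgrPdist_le (FF := FU) _ _).1 nc r r0) => t /=.
  by rewrite sub0r normrN ger0_norm ?norm1_ge0.
have Ua := near_ball a (chart_cvg (FF := FU) (Hz a) zi zj).
have Ub : U [set t | norm1 (chart i j (s t b) - chart i j (z a)) <= r].
  by apply: near_ball; rewrite Ezab; apply: (chart_cvg (FF := FU) (Hz b)).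
have Ur : U [set t : K | `|t| <= r].
  apply: (@filterS _ _ FU) ((cvgrPdist_le (FF := FU) _ _).1 Ut r r0) => t /=.
  by rewrite sub0r normrN.
have nz (f : K -> V8) w : vcvg U f w -> forall l, w 0 l != 0 -> U [set t | f t 0 l != 0].
  by move=> fw l wl; exact: (cvgr_neq0 (FF := FU) _ (fw l) wl).
have nzl c : lsubmx (z c) 0 i != 0 -> U [set t | lsubmx (s t c) 0 i != 0].
  rewrite mxE => /(nz _ _ (Hz c)).
  by apply: (@filterS _ _ FU) => t /=; rewrite mxE.
have nzr c : rsubmx (z c) 0 j != 0 -> U [set t | rsubmx (s t c) 0 j != 0].
  rewrite mxE => /(nz _ _ (Hz c)).
  by apply: (@filterS _ _ FU) => t /=; rewrite mxE.
have UI P Q : U P -> U Q -> U (P `&` Q) by exact: (@filterI _ _ FU).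
have Uall := UI _ _ (UI _ _ (UI _ _ Ua Ub) (UI _ _ Ur Um))
   (UI _ _ (UI _ _ (nzl a zi) (nzl b zbi)) (UI _ _ (nzr a zj) (nzr b zbj))).
have [t [[[ta tb] [tr tm]] [[tai tbi] [taj tbj]]]] := @filter_ex _ _ PU _ Uall.
have [_ /(_ tm)[Zt Dt _]] := Hs t.
apply: (Dt a b ab); apply: (chart_same tai tbi taj tbj).
by apply: (Hr t) => //; apply: bizero_chart.
Qed.

End LimitZeros.

(** * Definability of the parameters with at least m zeros *)

Section DefinableZeros.
Variable K : closedFieldType.
Local Notation V8 := 'rV[K]_(4 + 4).
Variables (H : K -> 'I_6 -> V8 -> K).

Definition tx_crd (o : option 'I_8) (tx : K * V8) : K :=
  if o is Some j then tx.2 0 j else tx.1.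

Hypothesis pH : forall i, polyfun tx_crd (fun tx => H tx.1 i tx.2).

(* The environment r stores t in position 0 and the j-th coordinate of the a-th
   point in position 1 + 8 a + j. *)
Definition env_point (r : nat -> K) (a : nat) : V8 := \row_j r (1 + (8 * a + j))%N.

Lemma polyfun_env_point a j : polyfun (@env_crd K) (fun r => env_point r a 0 j).
Proof.
by apply: polyfun_ext (PolyVar _ (1 + (8 * a + j))%N) _ => r; rewrite mxE.
Qed.

Lemma definable_parallel n (u v : (nat -> K) -> 'rV[K]_n) :
  (forall j, polyfun (@env_crd K) (fun r => u r 0 j)) ->
  (forall j, polyfun (@env_crd K) (fun r => v r 0 j)) ->
  definable (fun r => parallel (u r) (v r)).
Proof.
move=> pu pv; apply: definable_forall => i; apply: definable_forall => j.
have := definable_eq0 (polyfun_sub (PolyMul (pu i) (pv j)) (PolyMul (pu j) (pv i))).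
move/definable_iff; apply=> r.
by split=> [/eqP|->]; rewrite ?subrr // subr_eq0 => /eqP.
Qed.

Lemma definable_neq0 n (u : (nat -> K) -> 'rV[K]_n) :
  (forall j, polyfun (@env_crd K) (fun r => u r 0 j)) ->
  definable (fun r => u r != 0).
Proof.
move=> pu; have := definable_exists (fun j => definable_not (definable_eq0 (pu j))).
move/definable_iff; apply=> r; split=> [[j /eqP uj]|/rV0Pn[j /eqP uj]].
  by apply/rV0Pn; exists j.
by exists j.
Qed.

Lemma definable_has_zeros m : definable (fun r => has_zeros (H (r 0%N)) m).
Proof.
have pl a j : polyfun (@env_crd K) (fun r => lsubmx (env_point r a) 0 j).
  by apply: polyfun_ext (polyfun_env_point a (lshift 4 j)) _ => r; rewrite [RHS]mxE.
have pr a j : polyfun (@env_crd K) (fun r => rsubmx (env_point r a) 0 j).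
  by apply: polyfun_ext (polyfun_env_point a (rshift 4 j)) _ => r; rewrite [RHS]mxE.
pose P (r : nat -> K) := (forall a : 'I_m, bizero (H (r 0%N)) (env_point r a)) /\
  (forall a b : 'I_m, a != b -> ~ same_point (env_point r a) (env_point r b)).
have dP : definable P.
  apply: definable_and.
    apply: definable_forall => a.
    have dH i : definable (fun r => H (r 0%N) i (env_point r a) = 0).
      have := @polyfun_comp K _ _ tx_crd _ _ (@env_crd K)
        (fun r : nat -> K => (r 0%N, env_point r a)) _ (pH i).
      move=> /= pHe; apply: definable_eq0; apply: pHe => -[j|] /=.
        exact: polyfun_env_point.
      exact: PolyVar (0%N).
    have := definable_and (definable_and (definable_neq0 (pl a)) (definable_neq0 (pr a)))
      (definable_forall dH).
    by move/definable_iff; apply=> r; split=> [[[]]|[]].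
  apply: definable_forall => a; apply: definable_forall => b.
  have [->|_] := eqVneq a b.
    by apply: definable_iff (definable_true K) _ => r.
  have := definable_not (definable_and (definable_parallel (pl a) (pl b))
    (definable_parallel (pr a) (pr b))).
  by move/definable_iff; apply=> r; split=> [h _|]; exact.
apply: definable_iff (definable_block 1 (8 * m) dP) _ => r; split.
  move=> [y []] /=; set r' := (fun j => _) => hz hs.
  by exists (fun a => env_point r' a).
move=> [s [hz hs]].
(* Inverse of the layout of [env_point]: position n holds the coordinate (n - 1) mod 8 of the point
   number (n - 1) / 8. *)
pose y (n : nat) : K := if insub (n.-1 %/ 8)%N is Some a then s a 0 (inord (n.-1 %% 8)) else 0.
exists y; rewrite /P /=; set r' := (fun j => _).
have E (a : 'I_m) : env_point r' a = s a.
  apply/rowP => j; rewrite mxE /r' /= ltnS.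
  have -> : (8 * a + j < 8 * m)%N.
    apply: (@leq_trans (8 * a + 8)); first by rewrite ltn_add2l.
    by rewrite -mulnSr leq_mul2l /=.
  rewrite /y /= mulnC divnMDl // divn_small // addn0 modnMDl modn_small //.
  rewrite insubT /=; first by [].
  by move=> lt_am; congr (s _ 0 _); apply: val_inj; rewrite //= inordK.
split=> [a|a b ab]; rewrite !E; first exact: hz.
exact: hs.
Qed.

End DefinableZeros.

(** * Invariance of the number of zeros *)

Section Invariance.
Local Open Scope classical_set_scope.
Variable K : numClosedFieldType.
Hypothesis hK : bounded_ultralimits K.
Local Notation V8 := 'rV[K]_(4 + 4).

Lemma near_nonroot (p : {poly K}) (x : K) : p != 0 -> \forall t \near x^', ~~ root p t.
Proof.
move=> p0; have [rs Ers] := closed_field_poly_normal p.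
have FN : Filter x^' by exact: dnbhs_filter.
suff : \forall t \near x^', t \notin rs.
  apply: (@filterS _ _ FN) => t; rewrite Ers rootZ ?lead_coef_eq0 //.
  by rewrite root_prod_XsubC.
elim: rs {Ers} => [|r rs IH]; first by apply: filterE.
have nr : \forall t \near x^', t != r.
  have [<-|xr] := eqVneq x r; first exact: nbhs_dnbhs_neq.
  have FX : Filter (nbhs x) by exact: nbhs_filter.
  apply: nbhs_dnbhs; have : (fun t : K => t - r) @ x --> x - r.
    exact: (@cvgB K K K (nbhs x) FX id (fun=> r) x r cvg_id (cvg_cst r)).
  move/(@cvgr_neq0 K K K _ FX); rewrite subr_eq0 => /(_ xr).
  by apply: (@filterS _ _ FX) => t; rewrite subr_eq0.
apply: (@filterS _ _ FN) (@filterI _ _ FN _ _ nr IH) => t [tr ts].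
by rewrite inE negb_or tr.
Qed.

Variables (A B : 'I_6 -> V8 -> K) (dA dB : 'I_6 -> V8 -> V8 -> K).
Hypotheses (pA : forall i, pmap (A i) (dA i)) (pB : forall i, pmap (B i) (dB i)).
Variables d e : 'I_6 -> nat.
Hypotheses (hA : bihomog d e A) (hB : bihomog d e B).
Hypotheses (ndA : forall x, bizero A x -> nondegenerate dA x)
           (ndB : forall x, bizero B x -> nondegenerate dB x).

Lemma bezout_invariance m : has_zeros A m -> has_zeros B m.
Proof.
move=> zA; pose C i x := B i x - A i x.
have pC i : pmap (C i) (fun x h => dB i x h - dA i x h) by exact: pmap_sub.
have hC : bihomog d e C by move=> i a b x; rewrite /C hA hB mulrBr.
pose D i x := A i x - B i x.
have pD i : pmap (D i) (fun x h => dA i x h - dB i x h) by exact: pmap_sub.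
have hD : bihomog d e D by move=> i a b x; rewrite /D hA hB mulrBr.
have pH i : polyfun (@tx_crd K) (fun tx => deform A C tx.1 i tx.2).
  have snd f df : pmap f df -> polyfun (@tx_crd K) (fun tx => f tx.2).
    move=> /pmap_polyfun pf; apply: (polyfun_comp (h := snd)) pf _ => j.
    exact: (PolyVar (@tx_crd K) (Some j)).
  apply: PolyAdd; first exact: snd (pA i).
  by apply: PolyMul; [exact: (PolyVar (@tx_crd K) None)|exact: snd (pC i)].
have [p [p0 [Hp|Hp]]] := definable_finite_or_cofinite (definable_has_zeros pH m);
  last first.
  (* The finite alternative contradicts the persistence of the m zeros near t = 0. *)
  have n1 := near_nonroot 0 p0.
  have n2 : \forall t \near (0 : K)^', has_zeros (deform A C t) m.
    by apply: nbhs_dnbhs; apply: (has_zeros_near0 hK pA pC hA hC ndA zA).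
  have FN : ProperFilter (0 : K)^' by exact: Proper_dnbhs_numFieldType.
  have [t [/Hp nz zt]] := @filter_ex _ _ FN _ (@filterI _ _ FN _ _ n1 n2).
  by case: nz.
apply: (has_zeros_limit hK pB pD hB hD ndB).
(* The pencil is traversed backwards, t -> 1 - t, so that B becomes the undeformed member; q carries
   the exceptional parameters along. *)
pose q := p \Po (1 - 'X).
have q0 : q != 0.
  rewrite -size_poly_eq0 size_comp_poly2 ?size_poly_eq0 //.
  by rewrite -size_polyN opprB size_XsubC.
have FN : Filter (0 : K)^' by exact: dnbhs_filter.
apply: (@filterS _ _ FN) (near_nonroot 0 q0) => t qt.
have /Hp /= : ~~ root p (1 - t).
  by move: qt; rewrite !rootE horner_comp !hornerE.
congr has_zeros; apply/funext => i; apply/funext => x.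
by rewrite /deform /C /D; ring.
Qed.

End Invariance.

(** * Ultralimits of bounded complex functions *)

Section ComplexUltralimits.
Local Open Scope classical_set_scope.
Variable R : realType.
Local Open Scope complex_scope.

Lemma real_ultralimit (T : Type) (U : set_system T) (f : T -> R) : UltraFilter U ->
  (forall t, `|f t| <= 1) -> exists l : R, f @ U --> l.
Proof.
move=> UU f1; have PU : ProperFilter U by exact: ultra_proper.
have Pf : ProperFilter (f @ U) by exact: fmap_proper_filter.
have [|l [_ cl]] := @segment_compact R (-1) 1 (f @ U) Pf.
  apply: (@filterE _ U) => t /=; rewrite in_itv /= -ler_norml; exact: f1.
exists l => N nN; have [//|UN] := in_ultra_setVsetC (f @^-1` N) UU.
by have [y [yN]] := cl (~` N) N UN nN.
Qed.

Lemma normc_real (r : R) : `|r%:C| = `|r|%:C.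
Proof. by rewrite normc_def /= expr0n /= addr0 sqrtr_sqr. Qed.

Lemma normc_i : `|'i%C : R[i]| = 1.
Proof. by rewrite normc_def /= expr0n /= expr1n add0r sqrtr1. Qed.

Lemma normc_ge_Im (z : R[i]) : `|complex.Im z|%:C <= `|z|.
Proof.
have := normc_ge_Re (- ('i * z)); rewrite normrN normrM normc_i mul1r.
by case: z => a b /=; rewrite !mul0r mul1r sub0r opprK.
Qed.

Lemma complex_ultralimits : bounded_ultralimits R[i].
Proof.
move=> T U UU f f1.
have PU : ProperFilter U by exact: ultra_proper.
have FU : Filter U by exact: filter_filter.
have [t|a fa] := @real_ultralimit T U (fun t => complex.Re (f t)) UU.
  by rewrite -lecR; exact: le_trans (normc_ge_Re (f t)) (f1 t).
have [t|b fb] := @real_ultralimit T U (fun t => complex.Im (f t)) UU.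
  by rewrite -lecR; exact: le_trans (normc_ge_Im (f t)) (f1 t).
exists (a +i* b); apply/(@cvgrPdist_lt _ _ _ _ FU) => -[er ei].
rewrite ltcE /= => /andP[/eqP -> e0].
have e2 : 0 < er / 2 by rewrite divr_gt0.
have Ua := (@cvgrPdist_lt _ _ _ _ FU _ _).1 fa _ e2.
have Ub := (@cvgrPdist_lt _ _ _ _ FU _ _).1 fb _ e2.
apply: (@filterS _ _ FU) (@filterI _ _ FU _ _ Ua Ub) => t /= [ta tb].
rewrite [X in `|X|]complexE; apply: le_lt_trans (ler_normD _ _) _.
rewrite normrM normc_i mul1r !normc_real -rmorphD /= ltcR [ltRHS]splitr.
by case: (f t) ta tb => x y /= ta tb; apply: ltrD.
Qed.

End ComplexUltralimits.

(** * The comparison system of products of linear forms *)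

Section StartSystem.
Variable K : numFieldType.
Local Notation V8 := 'rV[K]_(4 + 4).
Variables d e : 'I_6 -> nat.

(** The index (true, l) stands for the d_l left forms of equation l, and (false, l) for its e_l
    right forms. *)
Definition form_count (t : bool * 'I_6) : nat := if t.1 then d t.2 else e t.2.
Definition start_form : Type := {t : bool * 'I_6 & 'I_(form_count t)}.
HB.instance Definition _ := Finite.on start_form.
Implicit Types (t : start_form) (x y h : V8).

Definition on_left t : bool := (tag t).1.
Definition eqn t : 'I_6 := (tag t).2.
(** A vector of K^4 is read as a polynomial of degree at most 3, and the form t evaluates it at
    [node t]. General position thus becomes a bound on the number of roots. *)
Definition node t : K := (enum_rank t)%:R.

Definition side (b : bool) x : 'rV[K]_4 := if b then lsubmx x else rsubmx x.
Definition lform t x : K := (rVpoly (side (on_left t) x)).[node t].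
(* The equation l is a product of d_l linear forms in the left factor and e_l in the right
   one; by Vandermonde any four forms on the same side are independent. *)
Definition start_system (l : 'I_6) x : K := \prod_(t | eqn t == l) lform t x.

Lemma node_inj : injective node.
Proof.
by move=> s t /eqP; rewrite eqr_nat => /eqP /val_inj /enum_rank_inj.
Qed.

Lemma lformE t x : lform t x = \sum_(i < 4) side (on_left t) x 0 i * node t ^+ i.
Proof.
rewrite /lform (horner_coef_wide _ (size_poly _ _)).
by apply: eq_bigr => i _; rewrite coef_rVpoly_ord.
Qed.

Lemma pmap_side b i : pmap (fun x : V8 => side b x 0 i) (fun _ h => side b h 0 i).
Proof.
by case: b; [apply: pmap_ext (@PmapVar K 8 (lshift 4 i)) _ _|
  apply: pmap_ext (@PmapVar K 8 (rshift 4 i)) _ _] => x *; rewrite mxE.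
Qed.

Lemma pmap_lform t : pmap (lform t) (fun _ h => lform t h).
Proof.
apply: pmap_ext (@pmap_sum K 8 'I_4 (index_enum 'I_4) xpredT
  (fun i x => node t ^+ i * side (on_left t) x 0 i)
  (fun i _ h => node t ^+ i * side (on_left t) h 0 i) _) _ _.
- by move=> i _; have E := pmap_scale (node t ^+ i) (pmap_side (on_left t) i); exact: E.
- by move=> x; rewrite lformE; apply: eq_bigr => i _; rewrite mulrC.
- by move=> x h; rewrite lformE; apply: eq_bigr => i _; rewrite mulrC.
Qed.

Lemma pmap_prod (I : Type) (r : seq I) (P : pred I) (f : I -> V8 -> K) df :
  (forall i, pmap (f i) (df i)) ->
  exists dg, pmap (fun x => \prod_(i <- r | P i) f i x) dg.
Proof.
move=> pf; elim: r => [|i r [dg IH]].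
  by eexists; apply: pmap_ext (@PmapCst K 8 1) _ _ => x; [rewrite big_nil|move=> h].
have [Pi|nPi] := boolP (P i).
  by eexists; apply: pmap_ext (PmapMul (pf i) IH) _ _ => x; [rewrite big_cons Pi|move=> h].
by exists dg; apply: pmap_ext IH _ _ => x; rewrite // big_cons (negPf nPi).
Qed.

Lemma side_row b (a c : K) x :
  side b (row_mx (a *: lsubmx x) (c *: rsubmx x)) = (if b then a else c) *: side b x.
Proof. by case: b; rewrite /side ?row_mxKl ?row_mxKr. Qed.

Lemma lform_scale t (a c : K) x :
  lform t (row_mx (a *: lsubmx x) (c *: rsubmx x)) =
  (if on_left t then a else c) * lform t x.
Proof. by rewrite /lform side_row linearZ hornerZ. Qed.

Lemma card_tag (I : finType) (g : I -> nat) i :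
  #|[pred s : {i : I & 'I_(g i)} | tag s == i]| = g i.
Proof.
rewrite -[RHS]card_ord -(card_codom (f := fun k : 'I_(g i) => Tagged (fun i => 'I_(g i)) k)).
  apply: eq_card => -[i' k]; rewrite !inE /=; apply/eqP/codomP => [Ei|[j [Ei _]] //].
  by case: _ / Ei k => k; exists k.
by move=> k j /eqP; rewrite -tag_eqE /tag_eq /= tagged_asE eqxx => /eqP.
Qed.

Lemma card_forms b l :
  #|[pred t : start_form | (on_left t == b) && (eqn t == l)]| = if b then d l else e l.
Proof.
rewrite -[RHS](card_tag form_count (b, l)); apply: eq_card => t.
by rewrite !inE /on_left /eqn; case: (tag t).
Qed.

Lemma start_bihomog : bihomog d e start_system.
Proof.
move=> l a c x; rewrite /start_system.
under eq_bigr do rewrite lform_scale; rewrite big_split /=; congr (_ * _).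
rewrite (bigID on_left) /= -[in RHS](card_forms true l) -[in RHS](card_forms false l).
congr (_ * _).
  rewrite -prodr_const; apply: eq_big => [t|t /andP[_ ->] //].
  by rewrite !inE eqb_id andbC.
rewrite -prodr_const; apply: eq_big => [t|t /andP[_ /negPf ->] //].
by rewrite !inE eqbF_neg andbC.
Qed.

Definition zeroset x := [set t | lform t x == 0].

(** The nodes in question are distinct roots of a nonzero polynomial of degree at most 3. *)
Lemma card_zeroset_side b x : side b x != 0 ->
  (#|[set t in zeroset x | on_left t == b]| <= 3)%N.
Proof.
move=> nz; set Z := [set t in _ | _].
have p0 : rVpoly (side b x) != 0.
  by apply: contra_neq nz => E; rewrite -[LHS]rVpolyK E linear0.
have := @max_poly_roots _ _ [seq node t | t <- enum Z] p0.
rewrite size_map -cardE map_inj_uniq ?enum_uniq; last exact: node_inj.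
move=> H; rewrite -ltnS; apply: leq_trans (size_poly _ _); apply: H => //.
apply/allP => r /mapP[t]; rewrite mem_enum !inE => /andP[zt /eqP tb] ->.
by rewrite rootE; move: zt; rewrite /lform tb.
Qed.

Lemma card_zeroset x : lsubmx x != 0 -> rsubmx x != 0 -> (#|zeroset x| <= 6)%N.
Proof.
move=> l0 r0; rewrite -(cardsID [set t | on_left t]).
apply: (@leq_add _ _ 3 3).
  apply: leq_trans (card_zeroset_side (b := true) l0); apply: subset_leq_card.
  by apply/fintype.subsetP => t; rewrite !inE => /andP[-> ->].
apply: leq_trans (card_zeroset_side (b := false) r0); apply: subset_leq_card.
by apply/fintype.subsetP => t; rewrite !inE => /andP[/negPf -> ->].
Qed.

(** One factor is chosen in every equation. Three left and three right forms cut out exactly one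
    point of P^3 x P^3. *)
Definition selections : {set {ffun 'I_6 -> start_form}} :=
  [set s : {ffun 'I_6 -> start_form} | [forall l, eqn (s l) == l] &&
    (#|[set l | on_left (s l) == true]| == 3%N)].

Lemma card_sides (s : {ffun 'I_6 -> start_form}) :
  (#|[set l | on_left (s l) == true]| + #|[set l | on_left (s l) == false]|)%N = 6%N.
Proof.
rewrite -[RHS](card_ord 6) -(cardsC [set l | on_left (s l) == true]); congr (_ + _)%N.
by apply: eq_card => l; rewrite !inE; case: on_left.
Qed.

Lemma selection_inj (s : {ffun 'I_6 -> start_form}) :
  (forall l, eqn (s l) = l) -> injective s.
Proof. by move=> es l l' E; rewrite -[l]es E es. Qed.

(* A zero kills at least one form of every equation, at most three forms of each
   kind, hence exactly one form of every equation. *)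
Lemma start_zero_selection x : bizero start_system x ->
  exists2 s, s \in selections & forall t, (lform t x == 0) = (t \in codom s).
Proof.
case=> l0 r0 Sx.
have /choice[s0 Hs0] l : exists t, eqn t = l /\ lform t x = 0.
  have /eqP := Sx l; rewrite prodf_seq_eq0 => /hasP[t _ /andP[/eqP et /eqP zt]].
  by exists t.
pose s : {ffun 'I_6 -> start_form} := [ffun l => s0 l].
have es l : eqn (s l) = l by rewrite ffunE; have [] := Hs0 l.
have zs l : lform (s l) x = 0 by rewrite ffunE; have [] := Hs0 l.
have s_inj := selection_inj es.
have sub : [set s l | l : 'I_6] \subset zeroset x.
  by apply/fintype.subsetP => _ /imsetP[l _ ->]; rewrite inE zs.
have Ez : [set s l | l : 'I_6] = zeroset x.
  by apply/eqP; rewrite finset.eqEcard sub card_imset // card_ord card_zeroset.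
exists s; last first.
  move=> t; have := finset.in_set (fun t => lform t x == 0) t; rewrite -/(zeroset x) -Ez => <-.
  by apply/imsetP/codomP => -[l]; [move=> _ ->; exists l|move=> ->; exists l].
rewrite inE; apply/andP; split; first by apply/forallP => l; rewrite es.
have cs b : (#|[set l | on_left (s l) == b]| <= 3)%N.
  have nz : side b x != 0 by case: b.
  apply: leq_trans (card_zeroset_side nz).
  rewrite -(card_imset _ s_inj); apply: subset_leq_card.
  by apply/fintype.subsetP => t /imsetP[l]; rewrite !inE => /eqP bl ->; rewrite zs bl !eqxx.
by have := card_sides s; have := cs true; have := cs false; lia.
Qed.

(** Both polynomials have degree at most 3, hence are scalar multiples of the cubic with these three
    roots. *)
Lemma parallel_common_roots (u v : 'rV[K]_4) (rs : seq K) : uniq rs -> size rs = 3%N ->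
  (forall r, r \in rs -> (rVpoly u).[r] = 0 /\ (rVpoly v).[r] = 0) -> parallel u v.
Proof.
move=> urs srs zrs; pose g := \prod_(r <- rs) ('X - r%:P).
have sg : size g = 4%N by rewrite size_prod_XsubC srs.
have g0 : g != 0 by rewrite -size_poly_eq0 sg.
have mult (w : 'rV[K]_4) : (forall r, r \in rs -> (rVpoly w).[r] = 0) ->
    exists c, rVpoly w = c *: g.
  move=> zw; have /dvdpP[q Eq] : g %| rVpoly w.
    apply: uniq_roots_dvdp; last by rewrite uniq_rootsE.
    by apply/allP => r /zw; rewrite rootE => ->.
  have [q0|q0] := eqVneq q 0; first by exists 0; rewrite Eq q0 mul0r scale0r.
  have := size_poly 4 (fun k => if insub k is Some i then w 0 i else 0).
  rewrite -/(rVpoly w) Eq size_mul // sg addnC /= => sq.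
  have /size1_polyC -> : (size q <= 1)%N by rewrite -(leq_add2l 3).
  by exists q`_0; rewrite mul_polyC.
have [a Ea] := mult u (fun r rr => (zrs r rr).1).
have [b Eb] := mult v (fun r rr => (zrs r rr).2).
move=> i j; rewrite -[u]rVpolyK -[v]rVpolyK Ea Eb !mxE !coefZ.
by rewrite mulrACA [RHS]mulrACA [g`_i * _]mulrC.
Qed.

Lemma card_selection_side (s : {ffun 'I_6 -> start_form}) b : s \in selections ->
  #|[set l | on_left (s l) == b]| = 3%N.
Proof.
rewrite inE => /andP[_ /eqP c3].
by case: b => //; have := card_sides s; lia.
Qed.

Lemma selection_nodes (s : {ffun 'I_6 -> start_form}) b : s \in selections ->
  exists rs : seq K, [/\ uniq rs, size rs = 3%N & forall r, r \in rs ->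
    exists2 l, on_left (s l) = b & r = node (s l)].
Proof.
move=> sS; have s_inj : injective s.
  by apply: selection_inj => l; move: sS; rewrite inE => /andP[/forallP/(_ l)/eqP].
exists [seq node (s l) | l <- enum [set l | on_left (s l) == b]]; split.
- by rewrite map_inj_uniq ?enum_uniq // => l l' /node_inj /s_inj.
- by rewrite size_map -cardE card_selection_side.
- by move=> r /mapP[l]; rewrite mem_enum inE => /eqP bl ->; exists l.
Qed.

Lemma same_selection_same_point (s : {ffun 'I_6 -> start_form}) x y :
  s \in selections -> (forall l, lform (s l) x = 0) -> (forall l, lform (s l) y = 0) ->
  same_point x y.
Proof.
move=> sS zx zy; have P b : parallel (side b x) (side b y).
  have [rs [urs srs Hrs]] := selection_nodes b sS.
  apply: (parallel_common_roots urs srs) => r /Hrs[l bl ->].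
  by split; [have := zx l|have := zy l]; rewrite /lform bl.
by split; [exact: (P true)|exact: (P false)].
Qed.

Lemma start_nondegenerate : exists dS, (forall l, pmap (start_system l) (dS l)) /\
  forall x, bizero start_system x -> nondegenerate dS x.
Proof.
have /choice[dS pS] l : exists dg, pmap (start_system l) dg.
  exact: pmap_prod pmap_lform.
exists dS; split=> // x Zx h dSh.
have [s sS zs] := start_zero_selection Zx.
have es l : eqn (s l) = l by move: sS; rewrite inE => /andP[/forallP/(_ l)/eqP].
have zx l : lform (s l) x = 0 by apply/eqP; rewrite zs codom_f.
suff zh l : lform (s l) h = 0.
  have [pl pr] := same_selection_same_point sS zx zh; case: Zx => l0 r0 _.
  by split; apply: parallelP.
have [dG pG] := @pmap_prod _ (index_enum start_form)
  (fun t => (eqn t == l) && (t != s l)) _ _ pmap_lform.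
(* By the Leibniz rule, only the term that differentiates the unique vanishing factor survives at a
   zero, and its cofactor is nonzero. *)
have pS' : pmap (start_system l) (fun x h => lform (s l) x * dG x h +
    lform (s l) h * \prod_(t | (eqn t == l) && (t != s l)) lform t x).
  apply: pmap_ext (PmapMul (pmap_lform (s l)) pG) _ _ => // y.
  by rewrite /start_system [RHS](bigD1 (s l)) //= es.
have := dSh l; rewrite (pmap_deriv_unique (pS l) pS') zx mul0r add0r => /eqP.
rewrite mulf_eq0 => /orP[/eqP //|]; rewrite prodf_seq_eq0.
case/hasP=> t _ /andP[/andP[/eqP et ne]]; rewrite zs => /codomP[l' Et].
by move: ne; rewrite Et -et Et es eqxx.
Qed.

Lemma start_zeros_le m : has_zeros start_system m -> (m <= #|selections|)%N.
Proof.
case=> z [Zz Dz]; have /choice[s Hs] a : exists s, s \in selections /\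
    forall t, (lform t (z a) == 0) = (t \in codom s).
  by have [s sS zs] := start_zero_selection (Zz a); exists s.
have zx a l : lform (s a l) (z a) = 0.
  by apply/eqP; have [_ ->] := Hs a; rewrite codom_f.
rewrite -[m]card_ord -(card_imset _ (f := s)); last first.
  move=> a b E; apply/eqP/negPn/negP => /Dz; apply.
  have [sS _] := Hs a; apply: (same_selection_same_point sS (zx a)).
  by rewrite E; apply: zx.
by apply: subset_leq_card; apply/fintype.subsetP => _ /imsetP[a _ ->]; have [] := Hs a.
Qed.

(** Its roots are the selected nodes on side b, so its coefficient vector is killed by precisely the
    selected forms of that side. *)
Definition selection_poly (s : {ffun 'I_6 -> start_form}) b : {poly K} :=
  \prod_(l | on_left (s l) == b) ('X - (node (s l))%:P).

Definition selection_zero s : V8 :=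
  row_mx (poly_rV (selection_poly s true)) (poly_rV (selection_poly s false)).

Lemma size_selection_poly s b : s \in selections -> size (selection_poly s b) = 4%N.
Proof.
move=> sS.
rewrite /selection_poly -big_filter -(big_map (fun l => node (s l)) xpredT (fun r => 'X - r%:P)).
rewrite size_prod_XsubC size_map; congr _.+1; apply: etrans (card_selection_side b sS).
by rewrite size_filter -sum1_count -sum1_card; apply: eq_bigl => l; rewrite !inE.
Qed.

Lemma lform_selection s t : s \in selections ->
  (lform t (selection_zero s) == 0) = (t \in codom s).
Proof.
move=> sS; have -> : lform t (selection_zero s) = (selection_poly s (on_left t)).[node t].
  rewrite /lform /side /selection_zero; case: (on_left t);
  by rewrite ?row_mxKl ?row_mxKr poly_rV_K // size_selection_poly.
rewrite horner_prod prodf_seq_eq0; apply/hasP/codomP => [[l _ /andP[bl]]|[l ->]].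
  by rewrite !hornerE subr_eq0 => /eqP /node_inj ->; exists l.
by exists l; rewrite ?mem_index_enum // eqxx !hornerE subrr eqxx.
Qed.

Lemma start_has_zeros : has_zeros start_system #|selections|.
Proof.
exists (fun a => selection_zero (enum_val a)).
have nz s b : s \in selections -> poly_rV (selection_poly s b) != 0 :> 'rV[K]_4.
  move=> sS; apply: contraTneq isT => /(congr1 rVpoly).
  rewrite poly_rV_K ?size_selection_poly // linear0 => E.
  by have := size_selection_poly b sS; rewrite E size_poly0.
have es s l : s \in selections -> eqn (s l) = l.
  by rewrite inE => /andP[/forallP/(_ l)/eqP].
split=> [a|a b ab [pl pr]].
  have sS := enum_valP a; split; rewrite ?row_mxKl ?row_mxKr ?nz // => l.
  apply/eqP; rewrite prodf_seq_eq0; apply/hasP; exists (enum_val a l).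
    by rewrite mem_index_enum.
  by rewrite es // eqxx lform_selection ?codom_f.
have sa := enum_valP a; have sb := enum_valP b.
suff : enum_val a = enum_val b by move/enum_val_inj/eqP; rewrite (negPf ab).
apply/ffunP => l; pose t := enum_val a l.
have : lform t (selection_zero (enum_val b)) == 0.
  have /eqP : lform t (selection_zero (enum_val a)) == 0 by rewrite lform_selection ?codom_f.
  rewrite /lform; case: (on_left t) => zt.
    have [|c Ec] := parallelP _ pl; first by rewrite row_mxKl nz.
    by rewrite /side Ec linearZ hornerZ zt mulr0.
  have [|c Ec] := parallelP _ pr; first by rewrite row_mxKr nz.
  by rewrite /side Ec linearZ hornerZ zt mulr0.
rewrite lform_selection // => /codomP[l' Et].
by rewrite -/t Et; congr (enum_val b _); rewrite -(es _ l' sb) -Et es.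
Qed.

(* The right-hand side is the coefficient of h^3 k^3 in the product of the classes
   d_l h + e_l k. *)
Lemma card_selections :
  (#|selections|%:Z = (\prod_l ((d l)%:R *: 'X + (e l)%:R%:P : {poly int}))`_3)%R.
Proof.
have -> : (\prod_l ((d l)%:R *: 'X + (e l)%:R%:P : {poly int}))%R =
    \prod_l \sum_(t | eqn t == l) 'X^(on_left t) :> {poly int}.
  apply: eq_bigr => l _; rewrite (bigID on_left) /=.
  rewrite -(card_forms true l) -(card_forms false l).
  congr (_ + _).
    rewrite (eq_big (fun t => t \in [pred t : start_form | (on_left t == true) && (eqn t == l)])
      (fun=> 'X)) => [|t|t /andP[_ ->]]; rewrite ?expr1 //.
      by rewrite sumr_const scaler_nat.
    by rewrite !inE eqb_id andbC.
  rewrite (eq_big (fun t => t \in [pred t : start_form | (on_left t == false) && (eqn t == l)])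
    (fun=> 1)) => [|t|t /andP[_ /negPf ->]]; rewrite ?expr0 //.
    by rewrite sumr_const polyCMn.
  by rewrite !inE eqbF_neg andbC.
(* Expanding the product gives one power of X per choice of a factor in each equation, its exponent
   being the number of left factors. *)
rewrite bigA_distr_big_dep /= coef_sum.
rewrite (eq_bigr (fun s : {ffun 'I_6 -> start_form} =>
    (#|[set l | on_left (s l) == true]| == 3%N)%:R)); last first.
  move=> s _; rewrite -(expr_sum 'X) coefXn.
  congr (_%:R); rewrite eq_sym; congr (nat_of_bool (_ == _)).
  by rewrite -sum1_card [RHS]big_mkcond; apply: eq_bigr => l _; rewrite !inE; case: on_left.
rewrite -natr_sum -big_mkcondr /= sum1_card natz; congr (Posz _).
apply: eq_card => s; rewrite !inE; congr (_ && _).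
Qed.

End StartSystem.

(* Locked: unfolding iterated derivatives makes conversion diverge. *)
HB.lock Definition dder (K : comNzRingType) n (a : 'rV[K]_n) (F : {mpoly K[n]}) :
  {mpoly K[n]} := \sum_i a 0 i *: F^`M(i).

(** * Directional derivatives and Euler's relation *)

Section DirectionalDerivatives.
Variables (K : comNzRingType) (n : nat).
Implicit Types (F G : {mpoly K[n]}) (a b v : 'rV[K]_n).

Lemma mpoly_ring_ind (P : {mpoly K[n]} -> Prop) :
  (forall c, P c%:MP) -> (forall i, P 'X_i) ->
  (forall p q, P p -> P q -> P (p + q)) -> (forall p q, P p -> P q -> P (p * q)) ->
  forall p, P p.
Proof.
move=> PC PX PD PM p; rewrite [p]mpolyE; apply: (big_ind P); [by rewrite -mpolyC0|exact: PD|].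
move=> m _; rewrite -mul_mpolyC; apply: (PM) => //.
rewrite mpolyXE_id; apply: (big_ind P); [by rewrite -mpolyC1|exact: PM|].
by move=> i _; elim: (m i) => [|k IH]; rewrite ?expr0 -?mpolyC1 // exprS; apply: (PM).
Qed.

Lemma mderivXU i j : ('X_i : {mpoly K[n]})^`M(j) = (i == j)%:R.
Proof.
rewrite mderivX mnm1E; case: eqP => [->|_]; last by rewrite scale0r.
by rewrite -{1}[U_(j)%MM]add0m addmK mpolyX0 scale1r.
Qed.

Lemma dderD a F G : dder a (F + G) = dder a F + dder a G.
Proof.
by rewrite dder.unlock -big_split /=; apply: eq_bigr => i _; rewrite mderivD scalerDr.
Qed.

Lemma dderZ a c F : dder a (c *: F) = c *: dder a F.
Proof.
rewrite dder.unlock scaler_sumr; apply: eq_bigr => i _.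
by rewrite mderivZ !scalerA mulrC.
Qed.

Lemma dderDl a b F : dder (a + b) F = dder a F + dder b F.
Proof.
by rewrite dder.unlock -big_split /=; apply: eq_bigr => i _; rewrite mxE scalerDl.
Qed.

Lemma dderZl c a F : dder (c *: a) F = c *: dder a F.
Proof.
by rewrite dder.unlock scaler_sumr; apply: eq_bigr => i _; rewrite mxE scalerA.
Qed.

Lemma dderM a F G : dder a (F * G) = F * dder a G + dder a F * G.
Proof.
rewrite dder.unlock mulr_sumr mulr_suml -big_split /=; apply: eq_bigr => i _.
by rewrite mderivM scalerDr addrC -scalerAr -scalerAl.
Qed.

Lemma dderC a c : dder a c%:MP = 0.
Proof. by rewrite dder.unlock big1 // => i _; rewrite mderivC scaler0. Qed.

Lemma dderX a i : dder a 'X_i = (a 0 i)%:MP.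
Proof.
rewrite dder.unlock (bigD1 i) //= big1 => [|j ji].
  by rewrite mderivXU eqxx addr0 -alg_mpolyC.
by rewrite mderivXU eq_sym (negPf ji) scaler0.
Qed.

Lemma dder_sum (I : Type) (r : seq I) (P : pred I) a (F : I -> {mpoly K[n]}) :
  dder a (\sum_(i <- r | P i) F i) = \sum_(i <- r | P i) dder a (F i).
Proof.
elim/big_rec2: _ => [|i y1 y2 _ <-]; last by rewrite dderD.
by rewrite -mpolyC0 dderC.
Qed.

Lemma dder_mderiv a F j : dder a F^`M(j) = (dder a F)^`M(j).
Proof.
rewrite dder.unlock (raddf_sum (mderiv j)) /=; apply: eq_bigr => i _.
by rewrite mderivZ mderiv_comm.
Qed.

Lemma dder_comm a b F : dder a (dder b F) = dder b (dder a F).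
Proof.
have E c G : dder c G = \sum_i c 0 i *: G^`M(i) by rewrite dder.unlock.
rewrite (E b F) dder_sum (E b); apply: eq_bigr => i _.
by rewrite dderZ dder_mderiv.
Qed.

Lemma iter_dder_comm a b k F : iter k (dder a) (dder b F) = dder b (iter k (dder a) F).
Proof. by elim: k => //= k ->; rewrite dder_comm. Qed.

Lemma dder_meval a F x : (dder a F).@[x] = \sum_i a 0 i * F^`M(i).@[x].
Proof. by rewrite dder.unlock raddf_sum /=; apply: eq_bigr => i _; exact: mevalZ. Qed.

Lemma dder_delta i F : dder (delta_mx 0 i) F = F^`M(i).
Proof.
rewrite dder.unlock (bigD1 i) //= big1 => [|j ji]; first by rewrite mxE !eqxx scale1r addr0.
by rewrite mxE eqxx (negPf ji) scale0r.
Qed.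

Lemma mderiv_homog d F i : F \is d.-homog -> F^`M(i) \is d.-1.-homog.
Proof.
move=> /dhomogP hF; apply/dhomogP => m; rewrite mcoeff_msupp mcoeff_mderiv => nz.
have : (m + U_(i))%MM \in msupp F.
  by rewrite mcoeff_msupp; apply: contra_neq nz => ->; rewrite mul0rn.
by move=> /hF /=; rewrite mdegD mdeg1 addn1 => <-.
Qed.

Lemma dder_homog d a F : F \is d.-homog -> dder a F \is d.-1.-homog.
Proof. by move=> hF; rewrite dder.unlock; apply: rpred_sum => i _; rewrite rpredZ ?mderiv_homog. Qed.

Lemma euler d v F : F \is d.-homog -> (dder v F).@[v 0] = d%:R * F.@[v 0].
Proof.
move=> hF; have E m : (dder v 'X_[m]).@[v 0] = (mdeg m)%:R * ('X_[m] : {mpoly K[n]}).@[v 0].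
  rewrite dder_meval mdegE natr_sum mulr_suml; apply: eq_bigr => i _.
  rewrite mderivX mevalZ !mevalX mulrCA.
  case: (posnP (m i)) => [->|mi]; first by rewrite !mul0r.
  congr (_ * _); rewrite (bigD1 i) //= [RHS](bigD1 i) //= mulrA; congr (_ * _).
    by rewrite mnmBE mnm1E eqxx subn1 -exprS prednK.
  by apply: eq_bigr => j ji; rewrite mnmBE mnm1E eq_sym (negPf ji) subn0.
rewrite {1 2}[F]mpolyE dder_sum !raddf_sum mulr_sumr; apply: eq_big_seq => m mF /=.
by rewrite dderZ !mevalZ E mulrCA (dhomog_mf hF mF).
Qed.

Lemma homog_eval_scale d c v F : F \is d.-homog -> F.@[(c *: v) 0] = c ^+ d * F.@[v 0].
Proof.
move=> hF; rewrite !mevalE mulr_sumr; apply: eq_big_seq => m mF.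
rewrite mulrCA; congr (_ * _); rewrite -(dhomog_mf hF mF) /= mdegE.
rewrite expr_sum -big_split /=; apply: eq_bigr => i _.
by rewrite mxE exprMn.
Qed.

End DirectionalDerivatives.

Section ChainRule.
Variables (K : comNzRingType) (n k : nat) (phi : n.-tuple {mpoly K[k]}).

Lemma mderiv_comp (F : {mpoly K[n]}) j :
  (F \mPo phi)^`M(j) = \sum_i (F^`M(i) \mPo phi) * (tnth phi i)^`M(j).
Proof.
elim/mpoly_ring_ind: F => [c|i|p q IHp IHq|p q IHp IHq].
- rewrite comp_mpolyC mderivC big1 // => i _.
  by rewrite mderivC raddf0 mul0r.
- rewrite comp_mpolyXU -tnth_nth (bigD1 i) //= big1 => [|i' ne].
    by rewrite mderivXU eqxx rmorph1 mul1r addr0.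
  by rewrite mderivXU eq_sym (negPf ne) raddf0 mul0r.
- rewrite comp_mpolyD mderivD IHp IHq -big_split /=; apply: eq_bigr => i _.
  by rewrite mderivD comp_mpolyD mulrDl.
- rewrite rmorphM mderivM IHp IHq mulr_suml mulr_sumr -big_split /=.
  apply: eq_bigr => i _; rewrite mderivM rmorphD !rmorphM /= mulrDl.
  by rewrite mulrAC mulrA.
Qed.

End ChainRule.

(** * Iterated derivatives as functions of the point and the direction *)

Section DerivativeMaps.
Variable K : numFieldType.
Local Notation V8 := 'rV[K]_(4 + 4).

Definition iterated_derivative k (G : {mpoly K[4]}) (x : V8) : K :=
  (iter k (dder (rsubmx x)) G).@[lsubmx x 0].

(** The first term varies the point and the second the direction; the k slots contribute equally
    because derivatives commute. *)
Definition iterated_derivative_deriv k (G : {mpoly K[4]}) (x h : V8) : K :=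
  (iter k (dder (rsubmx x)) (dder (lsubmx h) G)).@[lsubmx x 0] +
  k%:R * (iter k.-1 (dder (rsubmx x)) (dder (rsubmx h) G)).@[lsubmx x 0].

Lemma pmap_meval n (G : {mpoly K[n]}) :
  pmap (fun x : 'rV[K]_n => G.@[x 0]) (fun x h => (dder h G).@[x 0]).
Proof.
elim/mpoly_ring_ind: G => [c|i|p q IHp IHq|p q IHp IHq].
- by apply: pmap_ext (@PmapCst K n c) _ _ => x *; rewrite ?dderC ?meval0 ?mevalC.
- by apply: pmap_ext (@PmapVar K n i) _ _ => x *; rewrite ?dderX ?mevalC ?mevalXU.
- by apply: pmap_ext (PmapAdd IHp IHq) _ _ => x *; rewrite ?dderD mevalD.
- by apply: pmap_ext (PmapMul IHp IHq) _ _ => x *; rewrite ?dderM ?mevalD !mevalM.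
Qed.

Lemma pmap_lsubmx (f : 'rV[K]_4 -> K) df : pmap f df ->
  pmap (fun x : V8 => f (lsubmx x)) (fun x h => df (lsubmx x) (lsubmx h)).
Proof.
elim=> [c|j|f1 d1 f2 d2 _ p1 _ p2|f1 d1 f2 d2 _ p1 _ p2]; [exact: PmapCst| |
  exact: PmapAdd|exact: PmapMul].
by apply: pmap_ext (@PmapVar K 8 (lshift 4 j)) _ _ => x *; rewrite mxE.
Qed.

Lemma dder_iter_meval k a (G : {mpoly K[4]}) (x : V8) :
  (iter k (dder (rsubmx x)) (dder a G)).@[lsubmx x 0] =
  \sum_i a 0 i * iterated_derivative k G^`M(i) x.
Proof.
rewrite iter_dder_comm dder_meval; apply: eq_bigr => i _; congr (_ * _).
rewrite /iterated_derivative; congr (_.@[_]).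
by elim: k => //= k <-; rewrite dder_mderiv.
Qed.

Lemma pmap_iterated_derivative k (G : {mpoly K[4]}) :
  pmap (iterated_derivative k G) (iterated_derivative_deriv k G).
Proof.
elim: k G => [|k IH] G.
  by apply: pmap_ext (pmap_lsubmx (pmap_meval G)) _ _ => // x h;
    rewrite /iterated_derivative_deriv /= mul0r addr0.
pose f i (x : V8) := rsubmx x 0 i * iterated_derivative k G^`M(i) x.
pose df i (x h : V8) := rsubmx x 0 i * iterated_derivative_deriv k G^`M(i) x h +
   rsubmx h 0 i * iterated_derivative k G^`M(i) x.
have pf i : pmap (f i) (df i).
  apply: PmapMul (IH _).
  by apply: pmap_ext (@PmapVar K 8 (rshift 4 i)) _ _ => x *; rewrite mxE.
have pfs := @pmap_sum K 8 'I_4 (index_enum _) xpredT f df (fun i _ => pf i).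
apply: pmap_ext pfs _ _ => [x|].
  by rewrite /iterated_derivative iterSr dder_iter_meval.
suff key (x h : V8) : \sum_i df i x h = iterated_derivative_deriv k.+1 G x h.
  by move=> x h; apply: key.
rewrite /df big_split /= /iterated_derivative_deriv iterSr !dder_iter_meval /=.
under eq_bigr do rewrite mulrDr.
rewrite big_split /= -addrA; congr (_ + _).
  by apply: eq_bigr => i _; rewrite dder_mderiv.
rewrite -natr1 mulrDl mul1r; congr (_ + _).
case: k {IH f df pf} => [|k] /=.
  by rewrite mul0r big1 // => i _; rewrite mul0r mulr0.
under eq_bigr do rewrite mulrCA dder_mderiv.
by rewrite -mulr_sumr -!dder_iter_meval iterSr.
Qed.

End DerivativeMaps.

(** * The system of six forms, and frames of the tangent plane *)

Section TacnodeSystem.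
Variable K : numFieldType.
Local Notation V4 := 'rV[K]_4.
Local Notation V8 := 'rV[K]_(4 + 4).
Implicit Types (F G : {mpoly K[4]}) (a b c u v w : V4).

(** The equations come in groups of one, four and one; the index l of the middle group belongs to
    the partial derivative l - 1. *)
Definition by_equation (X : Type) (a : X) (m : 'I_4 -> X) (b : X) (l : 'I_6) : X :=
  if l == 0 then a else if l == ord_max then b else m (inord l.-1).

Lemma by_equationP (X : Type) (P : X -> Prop) (a : X) (m : 'I_4 -> X) (b : X) :
  (forall l, P (by_equation a m b l)) <-> [/\ P a, forall j, P (m j) & P b].
Proof.
split=> [H|[H0 H1 H5] l]; last first.
  by rewrite /by_equation; case: ifP => _ //; case: ifP.
split; [exact: (H 0)|move=> j|exact: (H ord_max)].
have E : nat_of_ord (inord j.+1 : 'I_6) = j.+1.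
  by rewrite inordK // ltnS; apply: leq_trans (ltn_ord j) _.
have := H (inord j.+1); rewrite /by_equation -!val_eqE /= E eqSS (ltn_eqF (ltn_ord j)) /=.
by rewrite (_ : inord j = j) //; apply: val_inj; rewrite /= inordK.
Qed.

Definition tacnode_system F : 'I_6 -> V8 -> K := by_equation (iterated_derivative 0 F)
  (fun j => iterated_derivative 1 F^`M(j)) (iterated_derivative 3 F).

Definition tacnode_deriv F : 'I_6 -> V8 -> V8 -> K :=
  by_equation (iterated_derivative_deriv 0 F)
  (fun j => iterated_derivative_deriv 1 F^`M(j)) (iterated_derivative_deriv 3 F).

Definition vdegree n : 'I_6 -> nat := by_equation n (fun=> n - 2)%N (n - 3)%N.

Definition wdegree : 'I_6 -> nat := by_equation 0%N (fun=> 1%N) 3%N.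

Lemma tacnode_pmap F l : pmap (tacnode_system F l) (tacnode_deriv F l).
Proof.
rewrite /tacnode_system /tacnode_deriv /by_equation.
by case: ifP => _; [|case: ifP => _]; exact: pmap_iterated_derivative.
Qed.

Lemma iter_dderZ k a (b : K) G : iter k (dder (b *: a)) G = b ^+ k *: iter k (dder a) G.
Proof.
elim: k => [|k IH]; first by rewrite scale1r.
by rewrite !iterS IH dderZ dderZl scalerA exprS mulrC.
Qed.

Lemma iter_dder_homog k d a G : G \is d.-homog -> iter k (dder a) G \is (d - k).-homog.
Proof.
move=> hG; elim: k => [|k IH]; first by rewrite subn0.
by rewrite iterS subnS; apply: dder_homog.
Qed.

Lemma iterated_derivative_bihomog k d G (a b : K) (x : V8) : G \is d.-homog ->
  iterated_derivative k G (row_mx (a *: lsubmx x) (b *: rsubmx x)) =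
  a ^+ (d - k) * b ^+ k * iterated_derivative k G x.
Proof.
move=> hG; rewrite /iterated_derivative row_mxKl row_mxKr iter_dderZ mevalZ.
have hi := iter_dder_homog k (rsubmx x) hG.
by rewrite (homog_eval_scale a (lsubmx x) hi) mulrCA mulrA.
Qed.

Lemma tacnode_bihomog n F : F \is n.-homog -> bihomog (vdegree n) wdegree (tacnode_system F).
Proof.
move=> hF l a b x; rewrite /tacnode_system /vdegree /wdegree /by_equation.
case: ifP => _; first by rewrite (iterated_derivative_bihomog _ a b x hF) subn0.
case: ifP => _; first by rewrite (iterated_derivative_bihomog _ a b x hF).
rewrite (iterated_derivative_bihomog _ a b x (mderiv_homog _ hF)).
by rewrite -subn1 -subnDA.
Qed.

Lemma tacnode_system_eq0 F x : (forall l, tacnode_system F l x = 0) <->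
  [/\ F.@[lsubmx x 0] = 0,
      forall j, (dder (rsubmx x) F^`M(j)).@[lsubmx x 0] = 0 &
      (dder (rsubmx x) (dder (rsubmx x) (dder (rsubmx x) F))).@[lsubmx x 0] = 0].
Proof. exact: (by_equationP (fun f : V8 -> K => f x = 0)). Qed.

Lemma tacnode_deriv_eq0 F x h : (forall l, tacnode_deriv F l x h = 0) <->
  [/\ iterated_derivative_deriv 0 F x h = 0,
      forall j, iterated_derivative_deriv 1 F^`M(j) x h = 0 &
      iterated_derivative_deriv 3 F x h = 0].
Proof. exact: (by_equationP (fun f : V8 -> V8 -> K => f x h = 0)). Qed.

Definition smooth_form F := forall v, v != 0 -> F.@[v 0] = 0 ->
  exists i, F^`M(i).@[v 0] != 0.

(* The last three conditions concern the coefficients of u^2, w^2 u and w^4 in the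
   section of F = 0 by the plane v + <w, u>. *)
Definition generic_contact F := forall v w u, free [:: v; w; u] -> F.@[v 0] = 0 ->
  (dder w F).@[v 0] = 0 -> (dder u F).@[v 0] = 0 ->
  (dder w (dder w F)).@[v 0] = 0 -> (dder u (dder w F)).@[v 0] = 0 ->
  (dder w (dder w (dder w F))).@[v 0] = 0 ->
  [/\ (dder u (dder u F)).@[v 0] != 0,
      (dder u (dder w (dder w F))).@[v 0] != 0 &
      3 * (dder u (dder w (dder w F))).@[v 0] ^+ 2 !=
      (dder u (dder u F)).@[v 0] * (dder w (dder w (dder w (dder w F)))).@[v 0]].

Section Frames.
Variables (g : 'cV[K]_4).
Local Notation T := (lker (linfun (mulmxr g : V4 -> 'rV[K]_1))).

Lemma mem_tangent x : (x \in T) = (x *m g == 0).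
Proof. by rewrite memv_ker lfunE. Qed.

Lemma dim_tangent : g != 0 -> \dim T = 3%N.
Proof.
move=> g0; have := limg_ker_dim (linfun (mulmxr g : V4 -> 'rV[K]_1)) fullv.
have d4 : \dim {:V4} = 4%N by rewrite dimvf /dim /= mul1n.
rewrite capfv d4.
suff -> : \dim (limg (linfun (mulmxr g : V4 -> 'rV[K]_1))) = 1%N by rewrite addn1 => -[].
apply/eqP; rewrite eqn_leq; apply/andP; split.
  by apply: leq_trans (dimvS (subvf _)) _; rewrite dimvf.
rewrite lt0n dimv_eq0; apply: contra_neq g0 => E.
apply/colP => i; rewrite mxE.
have : linfun (mulmxr g : V4 -> 'rV[K]_1) (delta_mx 0 i) \in
    limg (linfun (mulmxr g : V4 -> 'rV[K]_1)) by rewrite memv_img ?memvf.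
by rewrite E memv0 lfunE /= -rowE => /eqP/rowP/(_ 0); rewrite !mxE.
Qed.

Lemma complete_tangent v w : g != 0 -> v \in T -> w \in T -> free [:: v; w] ->
  exists u, [/\ u \in T, free [:: v; w; u] & basis_of T [:: v; w; u]].
Proof.
move=> g0 vT wT fvw; pose W := <<[:: v; w]>>%VS.
have dW : \dim W = 2%N by apply/eqP; rewrite -/(free [:: v; w]).
have WT : (W <= T)%VS by apply/span_subvP => x; rewrite !inE => /orP[]/eqP->.
have : ~~ (T <= W)%VS.
  by apply: contraTN isT => /dimvS; rewrite dim_tangent // dW.
case/subvPn=> u uT uW; exists u.
have fu : free [:: v; w; u].
  have puv : perm_eq [:: v; w; u] [:: u; v; w].
    by rewrite -[[:: v; w; u]]/([:: v; w] ++ [:: u]) perm_catC.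
  by rewrite (perm_free puv) free_cons uW.
split=> //; rewrite basisEfree fu /= dim_tangent // leqnn andbT.
by apply/span_subvP => x; rewrite !inE => /or3P[]/eqP->.
Qed.

Lemma basis3P v w u x (U : {vspace V4}) : basis_of U [:: v; w; u] -> x \in U ->
  exists a b c : K, x = a *: v + b *: w + c *: u.
Proof.
move=> /span_basis <-; rewrite !span_cons span_nil addv0.
case/memv_addP=> _ /vlineP[a ->] [_ /memv_addP[_ /vlineP[b ->] [_ /vlineP[c ->] ->]] ->].
by exists a, b, c; rewrite addrA.
Qed.

End Frames.

Lemma gradientE F v x : (x *m gradient F v) 0 0 = (dder x F).@[v 0].
Proof. by rewrite dder_meval mxE; apply: eq_bigr => i _; rewrite mxE. Qed.

Lemma tangentE F v x :
  (x \in lker (linfun (mulmxr (gradient F v) : V4 -> 'rV[K]_1))) = ((dder x F).@[v 0] == 0).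
Proof.
rewrite mem_tangent -gradientE; apply/eqP/eqP => [-> //|E]; first by rewrite mxE.
by apply/matrixP => i j; rewrite !ord1 E mxE.
Qed.

Lemma gradient_neq0 F v : (gradient F v != 0) <-> exists i, F^`M(i).@[v 0] != 0.
Proof.
split=> [|[i ne]]; last by apply: contra_neq ne => /colP/(_ i); rewrite !mxE.
move=> g0; apply/existsP; apply: contraNT g0 => /existsPn E.
by apply/eqP/colP => i; rewrite !mxE; apply/eqP/negPn/E.
Qed.

End TacnodeSystem.

(** * Linear algebra of nondegeneracy, with the derivatives at v as abstract data *)

Section ContactAlgebra.
Variables (K : numFieldType) (V : lmodType K).
Variables (T1 : V -> K) (T2 : V -> V -> K) (T3 : V -> V -> V -> K) (T4 : V -> K).
Variables (v w u : V) (n1 n2 n3 : K).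

Hypotheses
  (comb2 : forall a x y z, T2 (x *: v + y *: w + z *: u) a =
     x * T2 v a + y * T2 w a + z * T2 u a)
  (comb3 : forall a b x y z, T3 (x *: v + y *: w + z *: u) a b =
     x * T3 v a b + y * T3 w a b + z * T3 u a b)
  (comb4 : forall x y z, T4 (x *: v + y *: w + z *: u) =
     x * T4 v + y * T4 w + z * T4 u)
  (sym2 : forall a b, T2 a b = T2 b a)
  (sym3 : forall a b c, T3 a b c = T3 b a c)
  (eu2 : forall a, T2 v a = n1 * T1 a)
  (eu3 : forall a b, T3 v a b = n2 * T2 a b)
  (eu4 : T4 v = n3 * T3 w w w)
  (n1_neq0 : n1 != 0)
  (hess : forall a, T2 a w = 0) (www : T3 w w w = 0) (Tw : T1 w = 0) (Tu : T1 u = 0)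
  (coord : forall x, T1 x = 0 -> exists a b c : K, x = a *: v + b *: w + c *: u)
  (smooth_v : exists a, T1 a != 0)
  (uu : T2 u u != 0) (uww : T3 u w w != 0)
  (disc : 3 * T3 u w w ^+ 2 != T2 u u * T4 w).

(* On the tangent plane the linearised equations read, for dv = b w + c u and
   dw = c' u modulo v and w, c uww = 0, b uww + c' uu = 0 and b wwww + 3 c' uww = 0. *)
Lemma contact_algebra dv dw : T1 dv = 0 ->
  (forall a, T3 dv a w + T2 dw a = 0) -> T4 dv + 3 * T3 dw w w = 0 ->
  (exists x, dv = x *: v) /\ (exists y, dw = y *: w).
Proof.
move=> /coord[x1 [y1 [z1 ->]]] E1.
(* Testing the linearised Hessian equation on v and applying Euler shows that dw is tangent as
   well. *)
have : T1 dw = 0.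
  have := E1 v; rewrite sym3 eu3 hess mulr0 add0r sym2 eu2 => /eqP.
  by rewrite mulf_eq0 (negPf n1_neq0) => /eqP.
move=> /coord[x2 [y2 [z2 Edw]]]; rewrite {}Edw in E1 *.
have {}E1 a : y1 * T3 w a w + z1 * T3 u a w + (x2 * (n1 * T1 a) + z2 * T2 u a) = 0.
  by have := E1 a; rewrite comb3 comb2 eu3 eu2 hess (sym2 w) hess !mulr0 add0r addr0.
have z10 : z1 = 0.
  have := E1 w; rewrite www Tw hess !mulr0 add0r !addr0 => /eqP.
  by rewrite mulf_eq0 (negPf uww) orbF => /eqP.
have Eu : y1 * T3 u w w + z2 * T2 u u = 0.
  by have := E1 u; rewrite z10 Tu (sym3 w) mul0r !mulr0 add0r addr0.
rewrite comb4 comb3 z10 eu4 eu3 www hess !mulr0 mul0r !add0r !addr0 => E4.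
(* Two linear equations in y1 and z2 remain; their determinant is, up to sign, the quantity that
   [disc] declares nonzero. *)
have y10 : y1 = 0.
  have : y1 * (3 * T3 u w w ^+ 2 - T2 u u * T4 w) = 0.
    have -> : y1 * (3 * T3 u w w ^+ 2 - T2 u u * T4 w) =
      3 * T3 u w w * (y1 * T3 u w w + z2 * T2 u u) -
      T2 u u * (y1 * T4 w + 3 * (z2 * T3 u w w)) by ring.
    by rewrite Eu E4 !mulr0 subrr.
  by move/eqP; rewrite mulf_eq0 subr_eq0 (negPf disc) orbF => /eqP.
have z20 : z2 = 0.
  by move/eqP: Eu; rewrite y10 mul0r add0r mulf_eq0 (negPf uu) orbF => /eqP.
have x20 : x2 = 0.
  have [a Ta] := smooth_v; have := E1 a; rewrite z10 z20 y10 !mul0r !add0r addr0 => /eqP.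
  by rewrite !mulf_eq0 (negPf n1_neq0) (negPf Ta) !orbF => /eqP.
split; first by exists x1; rewrite y10 !scale0r !addr0.
by exists y2; rewrite x20 z20 !scale0r add0r addr0.
Qed.

End ContactAlgebra.

(** * Nondegeneracy of the zeros of the system *)

Section ContactGeometry.
Variable K : numFieldType.
Local Notation V4 := 'rV[K]_4.
Variables (n : nat) (F : {mpoly K[4]}).
Hypotheses (n2 : (2 <= n)%N) (hF : F \is n.-homog) (smF : smooth_form F).
Implicit Types (a b c u v w : V4) (G : {mpoly K[4]}).

Lemma dder_comb v a b c (x y z : K) G : (dder (x *: a + y *: b + z *: c) G).@[v 0] =
  x * (dder a G).@[v 0] + y * (dder b G).@[v 0] + z * (dder c G).@[v 0].
Proof. by rewrite !dderDl !dderZl !mevalD !mevalZ. Qed.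

Lemma euler2 v a : (dder v (dder a F)).@[v 0] = n.-1%:R * (dder a F).@[v 0].
Proof. by apply: euler; apply: dder_homog. Qed.

Lemma euler3 v a b : (dder v (dder a (dder b F))).@[v 0] =
  n.-2%:R * (dder a (dder b F)).@[v 0].
Proof. by apply: euler; apply: dder_homog; apply: dder_homog. Qed.

Lemma euler4 v a b c : (dder v (dder a (dder b (dder c F)))).@[v 0] =
  n.-1.-2%:R * (dder a (dder b (dder c F))).@[v 0].
Proof. by apply: euler; do 3!apply: dder_homog. Qed.

Lemma pred_n_neq0 : (n.-1%:R : K) != 0.
Proof. by rewrite pnatr_eq0; case: n n2 => [|[]]. Qed.

Lemma hessian_row v w : (forall j, (dder w F^`M(j)).@[v 0] = 0) <->
  (forall a, (dder a (dder w F)).@[v 0] = 0).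
Proof.
split=> [H a|H j].
  by rewrite dder_meval big1 // => j _; rewrite -dder_mderiv H mulr0.
by have := H (delta_mx 0 j); rewrite dder_delta dder_mderiv.
Qed.

Lemma smooth_dder v : v != 0 -> F.@[v 0] = 0 -> exists a, (dder a F).@[v 0] != 0.
Proof.
move=> v0 Fv; have [i Fi] := smF v0 Fv; exists (delta_mx 0 i).
by rewrite dder_delta.
Qed.

(** By Euler the Hessian maps v to (n - 1) times the gradient, which is nonzero, so v is not a
    multiple of a kernel vector. *)
Lemma hessian_kernel_free v w : v != 0 -> w != 0 -> F.@[v 0] = 0 ->
  (forall a, (dder a (dder w F)).@[v 0] = 0) -> free [:: v; w].
Proof.
move=> v0 w0 Fv hess; rewrite free_cons seq1_free w0 andbT span_seq1.
apply/vlineP => -[c Ev]; have [a Fa] := smooth_dder v0 Fv.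
have E : dder v F = c *: dder w F by rewrite {1}Ev dderZl.
have := euler2 v a; rewrite dder_comm E dderZ mevalZ hess mulr0 => /esym/eqP.
by rewrite mulf_eq0 (negPf pred_n_neq0) (negPf Fa).
Qed.

(** Pairing the kernel vector with v gives (n - 1) times its derivative, by Euler. *)
Lemma hessian_kernel_tangent v w : (forall a, (dder a (dder w F)).@[v 0] = 0) ->
  (dder w F).@[v 0] = 0.
Proof.
move=> /(_ v); rewrite euler2 => /eqP.
by rewrite mulf_eq0 (negPf pred_n_neq0) => /eqP.
Qed.

Lemma tacnode_zero_frame v w : v != 0 -> w != 0 -> F.@[v 0] = 0 ->
  (forall a, (dder a (dder w F)).@[v 0] = 0) ->
  exists u, [/\ free [:: v; w; u], (dder u F).@[v 0] = 0,
    basis_of (lker (linfun (mulmxr (gradient F v) : V4 -> 'rV[K]_1))) [:: v; w; u] &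
    forall x, (dder x F).@[v 0] = 0 -> exists a b c : K, x = a *: v + b *: w + c *: u].
Proof.
move=> v0 w0 Fv hess.
have g0 : gradient F v != 0 by apply/gradient_neq0/smF.
have [|||u [uT fu bT]] := @complete_tangent K (gradient F v) v w g0.
- by rewrite tangentE (euler v hF) Fv mulr0.
- by rewrite tangentE hessian_kernel_tangent.
- exact: hessian_kernel_free.
exists u; split=> //; first by move: uT; rewrite tangentE => /eqP.
by move=> x Fx; apply: basis3P bT _; rewrite tangentE Fx.
Qed.

Hypothesis gcF : generic_contact F.

Lemma contact_tangent v w dv dw : v != 0 -> w != 0 -> F.@[v 0] = 0 ->
  (forall a, (dder a (dder w F)).@[v 0] = 0) ->
  (dder w (dder w (dder w F))).@[v 0] = 0 ->
  (dder dv F).@[v 0] = 0 ->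
  (forall a, (dder a (dder w (dder dv F))).@[v 0] + (dder a (dder dw F)).@[v 0] = 0) ->
  (dder w (dder w (dder w (dder dv F)))).@[v 0] +
    3 * (dder w (dder w (dder dw F))).@[v 0] = 0 ->
  (exists x, dv = x *: v) /\ (exists y, dw = y *: w).
Proof.
move=> v0 w0 Fv hess Fwww E0 E1 E3.
have Fw := hessian_kernel_tangent hess.
have [u [fu Fu _ coord]] := tacnode_zero_frame v0 w0 Fv hess.
have [e0 c0 disc] := gcF fu Fv Fw Fu (hess w) (hess u) Fwww.
apply: (@contact_algebra K V4 (fun a => (dder a F).@[v 0])
  (fun a b => (dder a (dder b F)).@[v 0])
  (fun a b c => (dder a (dder b (dder c F))).@[v 0])
  (fun a => (dder a (dder w (dder w (dder w F)))).@[v 0]) v w u n.-1%:R n.-2%:R n.-1.-2%:R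
  _ _ _ _ _ (euler2 v) (euler3 v) (euler4 v w w w) pred_n_neq0 hess Fwww Fw Fu coord
  (smooth_dder v0 Fv) e0 c0 disc dv dw E0).
- by move=> a x y z; exact: dder_comb.
- by move=> a b x y z; exact: dder_comb.
- by move=> x y z; exact: dder_comb.
- by move=> a b; rewrite dder_comm.
- by move=> a b c; rewrite dder_comm.
- by move=> a; rewrite -[RHS](E1 a) /= (dder_comm w dv) (dder_comm a dv) (dder_comm a dw).
- by rewrite -[RHS]E3 /= !(dder_comm w dv) !(dder_comm w dw).
Qed.

Lemma tacnode_nondegenerate x : bizero (tacnode_system F) x ->
  nondegenerate (tacnode_deriv F) x.
Proof.
case=> v0 w0 /tacnode_system_eq0[Fv /hessian_row hess Fwww] h.
case/tacnode_deriv_eq0; rewrite /iterated_derivative_deriv /= mul0r addr0 => E0 E1 E3.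
apply: contact_tangent => // a.
rewrite [in X in X + _]dder_meval [in X in _ + X]dder_meval -big_split big1 //= => j _.
by rewrite -mulrDr -!dder_mderiv -[X in _ + X]mul1r E1 mulr0.
Qed.

End ContactGeometry.

(** * Order of vanishing and truncation of power series *)

Section VanishingOrder.
Variables (K : comNzRingType) (n : nat).
Implicit Types (p q : {mpoly K[n]}).

(** Membership in the N-th power of the maximal ideal at the origin. *)
Definition vanishes N p := forall m, (mdeg m < N)%N -> p@_m = 0.

Lemma vanishesW M N p : (M <= N)%N -> vanishes N p -> vanishes M p.
Proof. by move=> MN vp m /leq_trans/(_ MN); apply: vp. Qed.

Lemma vanishesD N p q : vanishes N p -> vanishes N q -> vanishes N (p + q).
Proof. by move=> vp vq m mN; rewrite mcoeffD vp ?vq ?addr0. Qed.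

Lemma vanishesN N p : vanishes N p -> vanishes N (- p).
Proof. by move=> vp m mN; rewrite mcoeffN vp ?oppr0. Qed.

Lemma vanishesB N p q : vanishes N p -> vanishes N q -> vanishes N (p - q).
Proof. by move=> vp vq; apply: vanishesD => //; apply: vanishesN. Qed.

Lemma vanishesB_trans N p q r : vanishes N (p - q) -> vanishes N (q - r) ->
  vanishes N (p - r).
Proof. by move=> vpq vqr; rewrite -[p](subrK q) -addrA; apply: vanishesD. Qed.

Lemma vanishesZ N c p : vanishes N p -> vanishes N (c *: p).
Proof. by move=> vp m mN; rewrite mcoeffZ vp ?mulr0. Qed.

Lemma vanishesMn N p k : vanishes N p -> vanishes N (p *+ k).
Proof. by move=> vp m mN; rewrite mcoeffMn vp ?mul0rn. Qed.

Lemma vanishesM M N p q : vanishes M p -> vanishes N q -> vanishes (M + N) (p * q).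
Proof.
move=> vp vq m mMN; rewrite mcoeffM big1 // => h /eqP Em.
have [h1|h1] := ltnP (mdeg h.1) M; first by rewrite vp ?mul0r.
have := congr1 (@mdeg n) Em; rewrite mdegD => Ed.
have lt_h : (mdeg h.1 + mdeg h.2 < M + N)%N by rewrite -Ed.
rewrite vq ?mulr0 //.
by rewrite -(ltn_add2l M); apply: leq_ltn_trans lt_h; rewrite leq_add2r.
Qed.

Lemma vanishes_sum N (I : Type) (r : seq I) (P : pred I) (F : I -> {mpoly K[n]}) :
  (forall i, P i -> vanishes N (F i)) -> vanishes N (\sum_(i <- r | P i) F i).
Proof.
move=> vF; apply: (big_ind (vanishes N)) => //; first by move=> m _; rewrite mcoeff0.
exact: vanishesD.
Qed.

Lemma vanishesX N m : (N <= mdeg m)%N -> vanishes N ('X_[m] : {mpoly K[n]}).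
Proof.
move=> Nm m' m'N; rewrite mcoeffX; case: eqP => // E.
by move: m'N; rewrite -E ltnNge Nm.
Qed.

Lemma vanishes_dder N a p : vanishes N.+1 p -> vanishes N (dder a p).
Proof.
move=> vp; rewrite dder.unlock; apply: vanishes_sum => i _; apply: vanishesZ => m mN.
by rewrite mcoeff_mderiv vp ?mul0rn // mdegD mdeg1 addn1.
Qed.

Lemma meval0_mcoeff p : p.@[fun=> 0] = p@_0%MM.
Proof.
elim/mpoly_ring_ind: p => [c|i|p q Ep Eq|p q Ep Eq].
- by rewrite mevalC mcoeffC eqxx mulr1.
- by rewrite mevalXU mcoeffX mnm1_eq0.
- by rewrite mevalD mcoeffD Ep Eq.
- by rewrite mevalM rmorphM Ep Eq.
Qed.

Lemma vanishes_meval0 N p : vanishes N.+1 p -> p.@[fun=> 0] = 0.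
Proof. by move=> vp; rewrite meval0_mcoeff vp ?mdeg0. Qed.

End VanishingOrder.

Section SeriesTruncation.
Variables (K : fieldType) (k : nat).
Implicit Types (a b : series K k) (p q : {mpoly K[k]}).

(** Series are handled through polynomials with the same jet, for which derivatives and ring
    identities are available. *)
Definition agree N a p := forall m, (mdeg m <= N)%N -> a m = p@_m.

Lemma agree_mul N a b p q : agree N a p -> agree N b q -> agree N (smul a b) (p * q).
Proof.
move=> ap bq m mN; rewrite mcoeffM; apply: eq_bigr => h /eqP Em.
have := congr1 (@mdeg k) Em; rewrite mdegD => Ed.
have le_h : (mdeg h.1 + mdeg h.2 <= N)%N by rewrite -Ed.
by rewrite ap ?bq //; apply: leq_trans le_h; rewrite ?leq_addl ?leq_addr.
Qed.

Lemma agree_sub N a b p q : agree N a p -> agree N b q -> agree N (ssub a b) (p - q).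
Proof. by move=> ap bq m mN; rewrite /ssub mcoeffB ap ?bq. Qed.

Lemma agree_trunc N a : exists p, agree N a p.
Proof.
by exists (\sum_(m : 'X_{1..k < N.+1}) (a m *: 'X_[m])) => m mN; rewrite mcoeff_mpoly.
Qed.

Lemma agree_congr N a p q : agree N a p -> vanishes N.+1 (p - q) -> agree N a q.
Proof.
by move=> ap vpq m mN; rewrite ap //; apply/eqP; rewrite -subr_eq0 -mcoeffB vpq.
Qed.

(** Coefficients of degree at most i + 1 do not change after step i, so the limit series can be read
    off diagonally. *)
Lemma agree_limit (P : nat -> {mpoly K[k]}) : (forall i, vanishes i.+2 (P i.+1 - P i)) ->
  forall N, agree N (fun m => (P (mdeg m))@_m) (P N).
Proof.
move=> step N m mN; have far d : vanishes (mdeg m).+2 (P (mdeg m + d)%N - P (mdeg m)).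
  elim: d => [|d IH]; first by rewrite addn0 subrr => m' _; rewrite mcoeff0.
  rewrite addnS; apply: (vanishesB_trans _ IH).
  by apply: vanishesW (step _); rewrite !ltnS leq_addr.
have := far (N - mdeg m)%N m; rewrite subnKC // mcoeffB => /(_ _)/eqP.
by rewrite subr_eq0 => E; apply/esym/eqP/E; rewrite ltnW.
Qed.

End SeriesTruncation.

(** * Derivatives of a curve with a tacnode *)

Section TacnodeDerivatives.
Variable K : fieldType.
Implicit Types (f p q : {mpoly K[2]}) (a c k : 'rV[K]_2).

Local Notation at0 p := (p.@[fun=> 0]).

Lemma linear_form_direction (y0 y1 : K) : (y0 != 0) || (y1 != 0) ->
  exists2 k : 'rV[K]_2, k != 0 & k 0 0 * y0 + k 0 1 * y1 = 0.
Proof.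
move=> y_neq0; exists (\row_j (if j == 0 then - y1 else y0)).
  apply: contraTneq y_neq0 => /rowP H; have := H 0; have := H 1; rewrite !mxE /=.
  by move=> -> /eqP; rewrite oppr_eq0 => ->; rewrite eqxx.
by rewrite !mxE /= mulNr mulrC addNr.
Qed.

Lemma square_derivatives p k : at0 p = 0 -> at0 (dder k p) = 0 ->
  [/\ forall c, at0 (dder c (p * p)) = 0,
      forall c, at0 (dder c (dder k (p * p))) = 0 &
      at0 (dder k (dder k (dder k (p * p)))) = 0].
Proof.
move=> p0 pk.
by split=> [c|c|]; rewrite !(dderM, dderD) !(mevalM, mevalD) p0 ?pk !(mul0r, mulr0, addr0).
Qed.

Lemma unit_mul_derivatives u g k : at0 g = 0 ->
  (forall c, at0 (dder c g) = 0) -> (forall c, at0 (dder c (dder k g)) = 0) ->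
  at0 (dder k (dder k (dder k g))) = 0 ->
  (forall c, at0 (dder c (dder k (u * g))) = 0) /\
  at0 (dder k (dder k (dder k (u * g)))) = 0.
Proof.
move=> g0 g1 g2 g3.
by split=> [c|]; rewrite !(dderM, dderD) !(mevalM, mevalD) ?g3 ?g2 ?g1 ?g0 !(mul0r, mulr0, addr0).
Qed.

Lemma dder_at0 a p : at0 (dder a p) = a 0 0 * p@_U_(0) + a 0 1 * p@_U_(1).
Proof.
rewrite dder_meval !big_ord_recl big_ord0 addr0 !meval0_mcoeff !mcoeff_mderiv.
rewrite !mnm0E !add0m !mulr1n.
have -> : lift ord0 ord0 = 1 :> 'I_2 by apply: val_inj.
by have -> : ord0 = 0 :> 'I_2 by apply: val_inj.
Qed.

(** The direction k is the kernel of the linear part of Y. The required derivatives of Y^2 vanish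
    there, those of X^4 vanish by order, and multiplication by a unit brings in only derivatives
    that vanish too. *)
Lemma tacnode_direction f : tacnode_at0 f -> exists2 k : 'rV[K]_2, k != 0 &
  (forall c, at0 (dder c (dder k f)) = 0) /\ at0 (dder k (dder k (dder k f))) = 0.
Proof.
case=> X [Y [u [[X0 Y0 J] u0 Ef]]].
(* The claim involves derivatives of order at most three, so jets of degree 3 suffice. *)
have [p pX] := agree_trunc 3 X; have [q qY] := agree_trunc 3 Y; have [r ru] := agree_trunc 3 u.
have U1 (i : 'I_2) : (mdeg U_(i)%MM <= 3)%N by rewrite mdeg1.
have [|k k0 ky] := @linear_form_direction (Y U_(0%R)%MM) (Y U_(1%R)%MM).
  apply: contraNT J; rewrite negb_or !negbK => /andP[/eqP -> /eqP ->].
  by rewrite !mulr0 subrr.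
exists k => //.
have q0 : at0 q = 0 by rewrite meval0_mcoeff -qY ?mdeg0.
have qk : at0 (dder k q) = 0 by rewrite dder_at0 -!qY.
have vp : vanishes 1 p.
  by move=> m; rewrite ltnS leqn0 mdeg_eq0 => /eqP ->; rewrite -pX ?mdeg0.
have [s1 s2 s3] := square_derivatives q0 qk.
pose x4 := p * p * (p * p); pose g := q * q - x4.
have v4 : vanishes 4 x4 := vanishesM (vanishesM vp vp) (vanishesM vp vp).
have g0 : at0 g = 0 by rewrite mevalB mevalM q0 mul0r (vanishes_meval0 v4) subr0.
have dB c h h' : dder c (h - h') = dder c h - dder c h' :> {mpoly K[2]}.
  by rewrite dderD -scaleN1r dderZ scaleN1r.
have g1 c : at0 (dder c g) = 0.
  by rewrite dB mevalB s1 (vanishes_meval0 (vanishes_dder c v4)) subr0.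
have g2 c : at0 (dder c (dder k g)) = 0.
  rewrite !dB mevalB s2.
  by rewrite (vanishes_meval0 (vanishes_dder c (vanishes_dder k v4))) subr0.
have g3 : at0 (dder k (dder k (dder k g))) = 0.
  rewrite !dB mevalB s3.
  by rewrite (vanishes_meval0 (vanishes_dder k (vanishes_dder k (vanishes_dder k v4)))) subr0.
have [h1 h2] := unit_mul_derivatives r g0 g1 g2 g3.
have vf : vanishes 4 (f - r * g).
  move=> m m4; rewrite mcoeffB Ef; apply/eqP; rewrite subr_eq0; apply/eqP.
  by apply: (agree_mul ru (agree_sub (agree_mul qY qY)
    (agree_mul (agree_mul pX pX) (agree_mul pX pX)))).
split=> [c|].
  have := vanishes_meval0 (vanishes_dder c (vanishes_dder k vf)).
  by rewrite !dB mevalB h1 subr0.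
have := vanishes_meval0 (vanishes_dder k (vanishes_dder k (vanishes_dder k vf))).
by rewrite !dB mevalB h2 subr0.
Qed.

End TacnodeDerivatives.

(** * Formal normal form of a tacnode *)

Section CorrectionIdentities.
Variable R : comPzRingType.
Implicit Types f X Y D E M L : R.

(** In these identities M and L play the leading terms of Y and X: a correction D changes the error
    by -2 M D or 4 L^3 D, up to the listed remainder of higher order. *)
Lemma correct_Y_identity f X4 Y D M :
  f - ((Y + D) * (Y + D) - X4) =
  (f - (Y * Y - X4) - (M * D) *+ 2) - (((Y - M) * D) *+ 2 + D * D).
Proof. ring. Qed.

Lemma correct_X_identity f Y2 X D L :
  f - (Y2 - (X + D) * (X + D) * ((X + D) * (X + D))) =
  ((X - L) * (X * X + X * L + L * L) * D) *+ 4 + (X * X * (D * D)) *+ 6 +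
    (X * (D * (D * D))) *+ 4 + D * D * (D * D) +
  (f - (Y2 - X * X * (X * X)) + (L * L * L * D) *+ 4).
Proof. ring. Qed.

Lemma square_expansion (E G A B x y : R) :
  (E * y + G * x ^+ 2 + A * (x * y) + B * y ^+ 2) *
  (E * y + G * x ^+ 2 + A * (x * y) + B * y ^+ 2) =
  E * E * (x ^+ 0 * y ^+ 2) + (E * G * (x ^+ 2 * y ^+ 1)) *+ 2 +
  (E * A * (x ^+ 1 * y ^+ 2)) *+ 2 + (E * B * (x ^+ 0 * y ^+ 3)) *+ 2 +
  G * G * (x ^+ 4 * y ^+ 0) + (G * A * (x ^+ 3 * y ^+ 1)) *+ 2 +
  (A * A * (x ^+ 2 * y ^+ 2) + (G * B * (x ^+ 2 * y ^+ 2)) *+ 2) +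
  (A * B * (x ^+ 1 * y ^+ 3)) *+ 2 + B * B * (x ^+ 0 * y ^+ 4).
Proof. ring. Qed.

Lemma cancel_first (a b c d : R) : a + b + c + d - a = b + (c + d).
Proof. ring. Qed.

End CorrectionIdentities.

(* Abstract, since rewriting with the additivity of coefficients in a concrete polynomial
   ring is too slow. *)
Lemma additive_square_expansion (V W : zmodType) (phi : {additive V -> W})
    (f t1 t2 t3 t4 t5 t6 t7 t8 t9 t10 t11 : V) :
  phi (f - (t1 + t2 *+ 2 + t3 *+ 2 + t4 *+ 2 + t5 + t6 *+ 2 + (t7 + t8 *+ 2) + t9 *+ 2 +
    t10 - t11)) =
  phi f - (phi t1 + phi t2 *+ 2 + phi t3 *+ 2 + phi t4 *+ 2 + phi t5 + phi t6 *+ 2 +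
    (phi t7 + phi t8 *+ 2) + phi t9 *+ 2 + phi t10 - phi t11).
Proof. by rewrite !(raddfB, raddfD, raddfMn). Qed.

Section TacnodeNormalForm.
Variable K : numClosedFieldType.
Implicit Types (f p q : {mpoly K[2]}).

Definition mon i j : 'X_{1..2} := (U_(0%R) *+ i + U_(1%R) *+ j)%MM.
Local Notation x := ('X_0 : {mpoly K[2]}).
Local Notation y := ('X_1 : {mpoly K[2]}).

Lemma mon0 i j : mon i j 0 = i.
Proof. by rewrite mnmDE !mulmnE !mnm1E /= mul1n mul0n addn0. Qed.

Lemma mon1 i j : mon i j 1 = j.
Proof. by rewrite mnmDE !mulmnE !mnm1E /= mul1n mul0n add0n. Qed.

Lemma monE (m : 'X_{1..2}) : m = mon (m 0) (m 1).
Proof.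
by apply/mnmP => -[[|[|//]] lt_i]; [have -> : Ordinal lt_i = 0|have -> : Ordinal lt_i = 1];
  rewrite ?mon0 ?mon1 //; apply: val_inj.
Qed.

Lemma eq_mon i j i' j' : (mon i j == mon i' j') = (i == i') && (j == j').
Proof.
apply/eqP/andP => [E|[/eqP -> /eqP ->] //].
have := mon1 i j; have := mon0 i j; rewrite E mon0 mon1 => -> ->; by rewrite !eqxx.
Qed.

Lemma mdeg_mon i j : mdeg (mon i j) = (i + j)%N.
Proof. by rewrite mdegD !mdegMn !mdeg1 !mul1n. Qed.

Lemma monX i j : 'X_[mon i j] = x ^+ i * y ^+ j.
Proof. by rewrite mpolyXD !mpolyXn. Qed.

Lemma mcoeff_CmonX c i j k l :
  (c%:MP * (x ^+ i * y ^+ j))@_(mon k l) = c * ((i == k) && (j == l))%:R.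
Proof. by rewrite mcoeffCM -monX mcoeffX eq_mon. Qed.

Lemma mcoeff_monX i j k l : (x ^+ i * y ^+ j)@_(mon k l) = ((i == k) && (j == l))%:R.
Proof. by rewrite -monX mcoeffX eq_mon. Qed.

Lemma vanishes_mon N p :
  (forall i j, (i + j < N)%N -> p@_(mon i j) = 0) -> vanishes N p.
Proof. by move=> H m; rewrite (monE m) mdeg_mon; exact: H. Qed.

Lemma vanishes_monX i j : vanishes (i + j) (x ^+ i * y ^+ j).
Proof. by rewrite -monX; apply: vanishesX; rewrite mdeg_mon. Qed.

Variables (f : {mpoly K[2]}) (ep la : K).
Hypotheses (ep0 : ep != 0) (la0 : la != 0).

(* Stage N of the construction of f = Y^2 - X^4: the equality holds in degrees < N and
   for the monomial x^N. *)
Definition stage N (XY : {mpoly K[2]} * {mpoly K[2]}) : Prop :=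
  let E := f - (XY.2 * XY.2 - XY.1 * XY.1 * (XY.1 * XY.1)) in
  [/\ vanishes 2 (XY.1 - la *: x), vanishes 2 (XY.2 - ep *: y),
      vanishes N E & E@_(mon N 0) = 0].

Lemma stage_succ N XY : (4 <= N)%N -> stage N XY ->
  exists XY', stage N.+1 XY' /\
    vanishes (N - 2) (XY'.1 - XY.1) /\ vanishes (N - 2) (XY'.2 - XY.2).
Proof.
case: XY => X Y N4 [/= vX vY vE E0].
set E := f - _ in vE E0.
pose dY := \sum_(j < N) (E@_(mon (N.-1 - j) j.+1) / (2 * ep)) *: (x ^+ (N.-1 - j) * y ^+ j).
have vdY : vanishes N.-1 dY.
  apply: vanishes_sum => j _; apply: vanishesZ.
  have := @vanishes_monX (N.-1 - j) j; rewrite subnK //.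
  by rewrite -ltnS prednK // (leq_trans _ N4).
have e20 : 2 * ep != 0 by rewrite mulf_neq0 ?pnatr_eq0.
have vE1 : vanishes N.+1 (E - ((ep *: y) * dY) *+ 2).
  have ydY : ((ep *: y) * dY) *+ 2 =
      \sum_(j < N) E@_(mon (N.-1 - j) j.+1) *: 'X_[mon (N.-1 - j) j.+1].
    rewrite mulr_sumr -sumrMnl; apply: eq_bigr => j _.
    rewrite -scalerAl -scalerAr scalerA -scaler_nat scalerA mulrA [_ * (_ / _)]mulrC divfK //.
    by rewrite monX exprS mulrCA.
  apply: vanishes_mon => k l; rewrite ltnS leq_eqVlt => /orP[/eqP klN|lt_kl]; last first.
    rewrite mcoeffB vE ?mdeg_mon // ydY raddf_sum big1 ?subrr // => j _ /=.
    rewrite mcoeffZ mcoeffX eq_mon; case: eqP => //= Ek; last by rewrite mulr0.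
    case: eqP => El; last by rewrite mulr0.
    by move: lt_kl; rewrite -Ek -El; have := ltn_ord j; lia.
  rewrite mcoeffB ydY raddf_sum /=; case: l klN => [|l] klN.
    rewrite addn0 in klN; rewrite klN E0 big1 ?subrr // => j _.
    by rewrite mcoeffZ mcoeffX eq_mon andbF mulr0.
  have lN : (l < N)%N by rewrite -klN addnS ltnS leq_addl.
  rewrite (bigD1 (Ordinal lN)) //= big1 => [|j jl]; last first.
    rewrite -val_eqE /= in jl.
    by rewrite mcoeffZ mcoeffX eq_mon eqSS (negPf jl) andbF mulr0.
  rewrite addr0 mcoeffZ mcoeffX; have -> : (N.-1 - l)%N = k by lia.
  by rewrite eqxx mulr1 subrr.
pose Y' := Y + dY.
pose A := f - (Y' * Y' - X * X * (X * X)).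
have vA : vanishes N.+1 A.
  rewrite /A /Y' (correct_Y_identity _ _ _ _ (ep *: y)).
  apply: vanishesB => //; apply: vanishesD.
    apply: vanishesMn; apply: (@vanishesW _ _ _ (2 + N.-1)); first by lia.
    exact: vanishesM.
  by apply: (@vanishesW _ _ _ (N.-1 + N.-1)); [lia|exact: vanishesM].
pose mu := - (A@_(mon N.+1 0)) / (4 * la ^+ 3).
pose dX := mu *: (x ^+ (N - 2) * y ^+ 0).
have vdX : vanishes (N - 2) dX.
  by apply: vanishesZ; have := @vanishes_monX (N - 2) 0; rewrite addn0.
pose X' := X + dX.
pose L := la *: x.
have vx : vanishes 1 x by have := @vanishes_monX 1 0; rewrite expr0 mulr1 expr1.
have vL : vanishes 1 L by exact: vanishesZ.
have vX1 : vanishes 1 X.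
  rewrite -(subrK L X); apply: vanishesD => //; exact: vanishesW vX.
exists (X', Y'); rewrite /stage /=.
pose B := ((X - L) * (X * X + X * L + L * L) * dX) *+ 4 + (X * X * (dX * dX)) *+ 6 +
  (X * (dX * (dX * dX))) *+ 4 + dX * dX * (dX * dX).
have EE' : f - (Y' * Y' - X' * X' * (X' * X')) = B + (A + (L * L * L * dX) *+ 4).
  exact: correct_X_identity.
(* The quadratic term in dX has order 2 (N - 2) + 2, which is at least N + 2 because N >= 4. *)
have vB : vanishes N.+2 B.
  apply: vanishesD; first apply: vanishesD; first apply: vanishesD.
  - apply: vanishesMn; apply: (@vanishesW _ _ _ (2 + 2 + (N - 2))); first by lia.
    apply: vanishesM => //; apply: vanishesM => //.
    by apply: vanishesD; first apply: vanishesD; exact: (@vanishesM _ _ 1 1).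
  - apply: vanishesMn; apply: (@vanishesW _ _ _ (1 + 1 + ((N - 2) + (N - 2)))); first by lia.
    exact: vanishesM (vanishesM vX1 vX1) (vanishesM vdX vdX).
  - apply: vanishesMn; apply: (@vanishesW _ _ _ (1 + ((N - 2) + ((N - 2) + (N - 2))))).
      by lia.
    exact: vanishesM vX1 (vanishesM vdX (vanishesM vdX vdX)).
  - apply: (@vanishesW _ _ _ ((N - 2) + (N - 2) + ((N - 2) + (N - 2)))); first by lia.
    exact: vanishesM (vanishesM vdX vdX) (vanishesM vdX vdX).
have EL : (L * L * L * dX) *+ 4 = (4 * la ^+ 3 * mu) *: (x ^+ N.+1 * y ^+ 0).
  have -> : N.+1 = (3 + (N - 2))%N by lia.
  have -> : L * L * L = la ^+ 3 *: x ^+ 3 by rewrite -exprZn !exprS expr0 mulr1 mulrA.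
  by rewrite /dX exprD expr0 !mulr1 -scalerAl -scalerAr scalerA -scaler_nat scalerA mulrA.
have la34 : 4 * la ^+ 3 != 0 by rewrite mulf_neq0 ?pnatr_eq0 ?expf_neq0.
have vLd : vanishes N.+1 ((L * L * L * dX) *+ 4).
  by rewrite EL; apply: vanishesZ; have := @vanishes_monX N.+1 0; rewrite addn0.
split; last first.
  rewrite /X' /Y' ![_ + _ - _]addrAC !subrr !add0r; split=> //.
  by apply: vanishesW vdY; lia.
split.
- by rewrite /X' addrAC; apply: vanishesD => //; apply: vanishesW vdX; lia.
- by rewrite /Y' addrAC; apply: vanishesD => //; apply: vanishesW vdY; lia.
- rewrite EE'; apply: vanishesD; first exact: vanishesW vB.
  exact: vanishesD.
- rewrite EE' mcoeffD vB ?mdeg_mon ?addn0 // add0r mcoeffD EL mcoeffZ mcoeff_monX !eqxx mulr1.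
  by rewrite /mu [_ * (_ / _)]mulrC divfK // subrr.
Qed.

(** The hypotheses are the comparison of coefficients of f with those of Y^2 - X^4 in degrees up to
    3 and at x^4. *)
Lemma stage_init (al be ga : K) :
  f@_(mon 0 0) = 0 -> f@_(mon 1 0) = 0 -> f@_(mon 0 1) = 0 -> f@_(mon 2 0) = 0 ->
  f@_(mon 1 1) = 0 -> f@_(mon 3 0) = 0 -> f@_(mon 0 2) = ep * ep ->
  f@_(mon 2 1) = (ep * ga) *+ 2 -> f@_(mon 1 2) = (ep * al) *+ 2 ->
  f@_(mon 0 3) = (ep * be) *+ 2 -> f@_(mon 4 0) = ga * ga - la ^+ 4 ->
  stage 4 (la *: x, ep%:MP * y + ga%:MP * x ^+ 2 + al%:MP * (x * y) + be%:MP * y ^+ 2).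
Proof.
move=> f00 f10 f01 f20 f11 f30 f02 f21 f12 f03 f40; rewrite /stage /=.
have x4 : la *: x * (la *: x) * (la *: x * (la *: x)) = (la ^+ 4)%:MP * (x ^+ 4 * y ^+ 0).
  by rewrite mul_mpolyC expr0 mulr1 -exprZn -!expr2 -exprM.
have coefE i j : (f - ((ep%:MP * y + ga%:MP * x ^+ 2 + al%:MP * (x * y) + be%:MP * y ^+ 2) *
   (ep%:MP * y + ga%:MP * x ^+ 2 + al%:MP * (x * y) + be%:MP * y ^+ 2) -
   la *: x * (la *: x) * (la *: x * (la *: x))))@_(mon i j) =
   f@_(mon i j) - (ep * ep * ((0 == i) && (2 == j))%:R +
     (ep * ga * ((2 == i) && (1 == j))%:R) *+ 2 + (ep * al * ((1 == i) && (2 == j))%:R) *+ 2 +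
     (ep * be * ((0 == i) && (3 == j))%:R) *+ 2 + ga * ga * ((4 == i) && (0 == j))%:R +
     (ga * al * ((3 == i) && (1 == j))%:R) *+ 2 +
     (al * al * ((2 == i) && (2 == j))%:R + (ga * be * ((2 == i) && (2 == j))%:R) *+ 2) +
     (al * be * ((1 == i) && (3 == j))%:R) *+ 2 + be * be * ((0 == i) && (4 == j))%:R -
     la ^+ 4 * ((4 == i) && (0 == j))%:R).
  rewrite x4 square_expansion -!mpolyCM.
  rewrite (additive_square_expansion (mcoeff (mon i j))) /=.
  by do !congr (_ + _); rewrite ?mcoeff_CmonX.
split.
- by move=> m _; rewrite subrr mcoeff0.
- rewrite -mul_mpolyC cancel_first.
  apply: vanishesD; last apply: vanishesD; rewrite mul_mpolyC; apply: vanishesZ.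
  + by have := @vanishes_monX 2 0; rewrite expr0 mulr1.
  + by have := @vanishes_monX 1 1; rewrite !expr1.
  + by have := @vanishes_monX 0 2; rewrite expr0 mul1r.
- apply: vanishes_mon => i j; rewrite coefE.
  case: i => [|[|[|[|i]]]]; case: j => [|[|[|[|j]]]] // _;
  rewrite /= ?(f00, f10, f01, f20, f11, f30, f02, f21, f12, f03)
    !(mulr0, mul0rn, mulr1, addr0, add0r, subr0, subrr, oppr0) //.
- by rewrite coefE f40 /= !(mulr0, mul0rn, mulr1, addr0, add0r, subr0, subrr, oppr0).
Qed.

Lemma stage_limit XY0 : stage 4 XY0 -> exists X Y : series K 2,
  [/\ local_coordinates X Y & forall m, f@_m = (ssub (smul Y Y) (smul (smul X X) (smul X X))) m].
Proof.
move=> st0; have /choice[next Hn] (a : nat * ({mpoly K[2]} * {mpoly K[2]})) :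
    exists b, (4 <= a.1)%N -> stage a.1 a.2 -> stage a.1.+1 b /\
      vanishes (a.1 - 2) (b.1 - a.2.1) /\ vanishes (a.1 - 2) (b.2 - a.2.2).
  case: a => N XY /=; have [N4|_] := boolP (4 <= N)%N; last by exists XY.
  have [sXY|ns] := pselect (stage N XY); last by exists XY.
  by have [b Hb] := stage_succ N4 sXY; exists b.
(* Stages start at 4, so step i is stage 4 + i and its correction has order 4 + i - 2 = i + 2, as
   [agree_limit] asks. *)
pose XY := fix XY i := if i is i'.+1 then next (4 + i', XY i')%N else XY0.
have sXY i : stage (4 + i) (XY i).
  by elim: i => [|i IH] //=; have [//|] := Hn (4 + i, XY i)%N _ IH.
have step i : vanishes i.+2 ((XY i.+1).1 - (XY i).1) /\
    vanishes i.+2 ((XY i.+1).2 - (XY i).2).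
  have [|_] := Hn (4 + i, XY i)%N _ (sXY i); first exact: leq_addr.
  by rewrite /= (_ : 4 + i - 2 = i.+2)%N //; lia.
have agX := agree_limit (fun i => (step i).1); have agY := agree_limit (fun i => (step i).2).
set X := (fun m : 'X_{1..2} => (XY (mdeg m)).1@_m) in agX.
set Y := (fun m : 'X_{1..2} => (XY (mdeg m)).2@_m) in agY.
exists X, Y; split.
  have [vx vy _ _] := sXY 1%N.
  have cX := agree_congr (agX 1%N) vx; have cY := agree_congr (agY 1%N) vy.
  split; rewrite ?cX ?cY ?mdeg0 ?mdeg1 // !mcoeffZ ?mcoeffXU ?mcoeffX ?mnm1_eq0 ?mulr0 //.
  by rewrite /= ?mulr1 ?mulr0 ?mul0r ?subr0 mulf_neq0.
move=> m; have [_ _ vE _] := sXY (mdeg m).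
have aE := agree_sub (agree_mul (agY (mdeg m)) (agY (mdeg m)))
  (agree_mul (agree_mul (agX (mdeg m)) (agX (mdeg m))) (agree_mul (agX (mdeg m)) (agX (mdeg m)))).
rewrite (aE m) //; apply/eqP; rewrite -subr_eq0 -mcoeffB; apply/eqP; apply: vE.
by lia.
Qed.

End TacnodeNormalForm.

Section TacnodeCriterion.
Variable K : numClosedFieldType.

(** With weights 1 for x and 2 for y the leading part is f02 y^2 + f21 x^2 y + f40 x^4; two distinct
    factors y - c x^2 mean an A_3 singularity. *)
Lemma tacnode_criterion (f : {mpoly K[2]}) :
  f@_(mon 0 0) = 0 -> f@_(mon 1 0) = 0 -> f@_(mon 0 1) = 0 -> f@_(mon 2 0) = 0 ->
  f@_(mon 1 1) = 0 -> f@_(mon 3 0) = 0 -> f@_(mon 0 2) != 0 ->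
  f@_(mon 2 1) ^+ 2 != 4 * f@_(mon 0 2) * f@_(mon 4 0) -> tacnode_at0 f.
Proof.
move=> f00 f10 f01 f20 f11 f30 f02 disc.
pose ep := sqrtC f@_(mon 0 2); have ep2 : ep * ep = f@_(mon 0 2) by rewrite -expr2 sqrtCK.
have ep0 : ep != 0 by apply: contra_neq f02 => E; rewrite -ep2 E mulr0.
have e20 : 2 * ep != 0 by rewrite mulf_neq0 ?pnatr_eq0.
have half c : c = (ep * (c / (2 * ep))) *+ 2.
  by rewrite -mulr_natl mulrA [_ * (_ / _)]mulrC divfK.
pose ga := f@_(mon 2 1) / (2 * ep).
(* Since 4 ep^2 la^4 = f21^2 - 4 f02 f40, the discriminant condition makes la nonzero. *)
pose la := 4.-root (ga * ga - f@_(mon 4 0)).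
have la4 : la ^+ 4 = ga * ga - f@_(mon 4 0) by rewrite rootCK.
have la0 : la != 0.
  apply: contraNneq disc => E; move/eqP: la4; rewrite E expr0n eq_sym subr_eq0 => /eqP <-.
  rewrite -ep2 /ga; apply/eqP; field; exact: ep0.
have := @stage_limit K f ep la ep0 la0 _
  (@stage_init K f ep la (f@_(mon 1 2) / (2 * ep)) (f@_(mon 0 3) / (2 * ep)) ga
   f00 f10 f01 f20 f11 f30 (esym ep2) (half _) (half _) (half _) _).
case=> [|X [Y [XY Ef]]]; first by rewrite la4 subKr.
exists X, Y, (fun m => (m == 0%MM)%:R); split=> //; first by rewrite eqxx oner_neq0.
move=> m; rewrite Ef; set g := ssub _ _.
have [p pg] := agree_trunc (mdeg m) g.
have one : agree (mdeg m) (fun m => (m == 0%MM)%:R : K) (1 : {mpoly K[2]}).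
  by move=> m' _; rewrite mcoeff1.
by rewrite (agree_mul one pg) // mul1r pg.
Qed.

End TacnodeCriterion.

(** * Taylor coefficients of plane sections *)

Section PlaneSections.
Variable K : fieldType.
Implicit Types (F G : {mpoly K[4]}) (v a b : 'rV[K]_4) (k : 'rV[K]_2).

Lemma mderiv_plane_section F v a b (j : 'I_2) :
  (plane_section F v a b)^`M(j) = plane_section (dder (if j == 0 then a else b) F) v a b.
Proof.
rewrite /plane_section mderiv_comp dder.unlock raddf_sum /=; apply: eq_bigr => i _.
rewrite comp_mpolyZ tnth_mktuple !mderivD mderivC add0r !mderivZ !mderivXU.
rewrite -[RHS]mul_mpolyC [RHS]mulrC; congr (_ * _).
by case: j => [[|[|//]] lt_j]; rewrite -alg_mpolyC /= ?scaler0 ?addr0 ?add0r.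
Qed.

Lemma dder_plane_section F v a b k :
  dder k (plane_section F v a b) = plane_section (dder (k 0 0 *: a + k 0 1 *: b) F) v a b.
Proof.
rewrite [in LHS]dder.unlock !big_ord_recl big_ord0 addr0 !mderiv_plane_section /=.
rewrite dderDl !dderZl /plane_section comp_mpolyD !comp_mpolyZ.
by have -> : lift ord0 ord0 = 1 :> 'I_2 by apply: val_inj.
Qed.

Lemma plane_section_at0 F v a b : (plane_section F v a b).@[fun=> 0] = F.@[v 0].
Proof.
rewrite comp_mpoly_meval; apply: meval_eq => i.
by rewrite tnth_mktuple !mevalD !mevalZ !mevalXU mevalC !mulr0 !addr0.
Qed.

Lemma mcoeff_mon_x (f : {mpoly K[2]}) i j :
  f@_(mon i.+1 j) *+ i.+1 = f^`M(0)@_(mon i j).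
Proof.
rewrite mcoeff_mderiv mon0; congr (f@_(_) *+ _); apply/mnmP => l.
by rewrite !(mnmDE, mulmnE, mnm1E); case: l => [[|[|//]] ?] /=; lia.
Qed.

Lemma mcoeff_mon_y (f : {mpoly K[2]}) i j :
  f@_(mon i j.+1) *+ j.+1 = f^`M(1)@_(mon i j).
Proof.
rewrite mcoeff_mderiv mon1; congr (f@_(_) *+ _); apply/mnmP => l.
by rewrite !(mnmDE, mulmnE, mnm1E); case: l => [[|[|//]] ?] /=; lia.
Qed.

Lemma mcoeff_mon00 (f : {mpoly K[2]}) : f@_(mon 0 0) = f.@[fun=> 0].
Proof. by rewrite meval0_mcoeff /mon !mulm0n addm0. Qed.

End PlaneSections.

Section PlaneSectionCoefficients.
Variable K : fieldType.
Implicit Types (F : {mpoly K[4]}) (v w u : 'rV[K]_4).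

Lemma section_coef00 F v w u : (plane_section F v w u)@_(mon 0 0) = F.@[v 0].
Proof. by rewrite mcoeff_mon00 plane_section_at0. Qed.

Lemma section_coef10 F v w u : (plane_section F v w u)@_(mon 1 0) = (dder w F).@[v 0].
Proof. by rewrite -[LHS]mulr1n mcoeff_mon_x mderiv_plane_section mcoeff_mon00 plane_section_at0. Qed.

Lemma section_coef01 F v w u : (plane_section F v w u)@_(mon 0 1) = (dder u F).@[v 0].
Proof. by rewrite -[LHS]mulr1n mcoeff_mon_y mderiv_plane_section mcoeff_mon00 plane_section_at0. Qed.

Lemma section_coef20 F v w u : (plane_section F v w u)@_(mon 2 0) *+ 2 = (dder w (dder w F)).@[v 0].
Proof. by rewrite mcoeff_mon_x mderiv_plane_section section_coef10. Qed.

Lemma section_coef11 F v w u : (plane_section F v w u)@_(mon 1 1) = (dder u (dder w F)).@[v 0].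
Proof. by rewrite -[LHS]mulr1n mcoeff_mon_x mderiv_plane_section section_coef01. Qed.

Lemma section_coef02 F v w u : (plane_section F v w u)@_(mon 0 2) *+ 2 = (dder u (dder u F)).@[v 0].
Proof. by rewrite mcoeff_mon_y mderiv_plane_section section_coef01. Qed.

Lemma section_coef30 F v w u : (plane_section F v w u)@_(mon 3 0) *+ 3 *+ 2 =
  (dder w (dder w (dder w F))).@[v 0].
Proof. by rewrite mcoeff_mon_x mderiv_plane_section section_coef20. Qed.

Lemma section_coef21 F v w u : (plane_section F v w u)@_(mon 2 1) *+ 2 =
  (dder u (dder w (dder w F))).@[v 0].
Proof. by rewrite mcoeff_mon_x mderiv_plane_section section_coef11. Qed.

Lemma section_coef40 F v w u :
  (plane_section F v w u)@_(mon 4 0) *+ 4 *+ 3 *+ 2 =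
  (dder w (dder w (dder w (dder w F)))).@[v 0].
Proof. by rewrite mcoeff_mon_x mderiv_plane_section section_coef30. Qed.

End PlaneSectionCoefficients.

(** * Tacnodal points and kernel vectors of the Hessian *)

Section TacnodalPoints.
Variable K : numClosedFieldType.
Local Notation V4 := 'rV[K]_4.
Variables (n : nat) (F : {mpoly K[4]}).
Hypotheses (n2 : (2 <= n)%N) (hF : F \is n.-homog) (smF : smooth_form F).

Local Notation T v := (lker (linfun (mulmxr (gradient F v) : V4 -> 'rV[K]_1))).

Definition tacnode_vector (v w : V4) := [/\ v != 0, w != 0, F.@[v 0] = 0,
  forall a, (dder a (dder w F)).@[v 0] = 0 & (dder w (dder w (dder w F))).@[v 0] = 0].

(* The kernel of the Hessian matrix is spanned by a vector congruent modulo v to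
   the tangent direction k. *)
Lemma tacnode_kernel_vector (v a b : V4) : v != 0 -> F.@[v 0] = 0 ->
  basis_of (T v) [:: v; a; b] -> tacnode_at0 (plane_section F v a b) ->
  exists w, tacnode_vector v w.
Proof.
move=> v0 Fv bT /tacnode_direction[k k0 [k2 k3]].
pose w : V4 := k 0 0 *: a + k 0 1 *: b.
have D2 (c : 'rV[K]_2) : (dder (c 0 0 *: a + c 0 1 *: b) (dder w F)).@[v 0] = 0.
  by have := k2 c; rewrite !dder_plane_section plane_section_at0.
have D3 : (dder w (dder w (dder w F))).@[v 0] = 0.
  by have := k3; rewrite !dder_plane_section plane_section_at0.
have fT := basis_free bT.
have wT : (dder w F).@[v 0] = 0.
  apply/eqP; rewrite -tangentE -(span_basis bT) /w.
  by rewrite memvD // memvZ // memv_span // !inE eqxx ?orbT.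
have Da : (dder a (dder w F)).@[v 0] = 0.
  by have := D2 (delta_mx 0 0); rewrite !mxE /= scale1r scale0r addr0.
have Db : (dder b (dder w F)).@[v 0] = 0.
  by have := D2 (delta_mx 0 1); rewrite !mxE /= scale1r scale0r add0r.
have DT (x : V4) : (dder x F).@[v 0] = 0 -> (dder x (dder w F)).@[v 0] = 0.
  move/eqP; rewrite -tangentE => /(basis3P bT)[x0 [x1 [x2 ->]]].
  by rewrite dder_comb (euler2 hF) wT Da Db !mulr0 !addr0.
have [z Dz] := smooth_dder smF v0 Fv.
have n1 := pred_n_neq0 K n2.
(* The Hessian image of w vanishes on the tangent plane, hence is a multiple of the gradient, and so
   is that of v by Euler. Subtracting la v from w makes them cancel. *)
pose la := (dder z (dder w F)).@[v 0] / (n.-1%:R * (dder z F).@[v 0]).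
have Dx (x : V4) : (dder x (dder w F)).@[v 0] = la * (n.-1%:R * (dder x F).@[v 0]).
  pose t := (dder x F).@[v 0] / (dder z F).@[v 0].
  have xE (G : {mpoly K[4]}) : (dder (x - t *: z) G).@[v 0] =
      (dder x G).@[v 0] - t * (dder z G).@[v 0].
    by rewrite -scaleNr dderDl dderZl mevalD mevalZ mulNr.
  have := DT (x - t *: z); rewrite !xE divfK // subrr => /(_ erefl)/eqP.
  rewrite subr_eq0 => /eqP ->.
  have fld (p q r s : K) : r != 0 -> s != 0 -> p / s * q = q / (r * s) * (r * p).
    by move=> r0 s0; field; rewrite ?r0 ?s0.
  exact: fld.
pose w' : V4 := w - la *: v.
have w'E (G : {mpoly K[4]}) : (dder w' G).@[v 0] = (dder w G).@[v 0] - la * (dder v G).@[v 0].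
  by rewrite /w' -scaleNr dderDl dderZl mevalD mevalZ mulNr.
have hess (x : V4) : (dder x (dder w' F)).@[v 0] = 0.
  by rewrite dder_comm w'E (dder_comm v) -(dder_comm x w) Dx dder_comm (euler2 hF) subrr.
(* Otherwise la v - k_0 a - k_1 b = 0 would be a relation in a basis, forcing k = 0. *)
have w'0 : w' != 0.
  apply: contraTneq fT => E.
  have wla : w = la *: v by apply/eqP; rewrite -subr_eq0; apply/eqP.
  apply/negP => /freeP H.
  have := H (fun i => if i == 0 then la else if i == 1 then - k 0 0 else - k 0 1).
  rewrite !big_ord_recl big_ord0 /= => /(_ _) HH.
  move: k0; apply/negP/negPn/eqP/rowP => j; rewrite mxE.
  have S0 : la *: v + (- k 0 0 *: a + (- k 0 1 *: b + 0)) = 0.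
    by rewrite -wla /w !scaleNr addr0 -opprD subrr.
  case: j => [[|[|//]] lt_j].
    have := HH S0 1; rewrite /= => /eqP; rewrite oppr_eq0 => /eqP <-.
    by congr (k _ _); apply: val_inj.
  have := HH S0 (Ordinal (isT : 2 < 3)%N); rewrite /= => /eqP; rewrite oppr_eq0 => /eqP <-.
  by congr (k _ _); apply: val_inj.
exists w'; split=> //.
(* Euler turns the third derivatives with a factor v into second derivatives, all of which
   vanish. *)
rewrite w'E (euler3 hF) hess !mulr0 subr0 (dder_comm w w') w'E (euler3 hF) hess.
rewrite !mulr0 subr0 (dder_comm w w' F) (dder_comm w w') w'E (euler3 hF) (DT w wT) D3.
by rewrite !mulr0 subr0.
Qed.

Hypothesis gcF : generic_contact F.

Lemma tacnode_vector_section (v w : V4) : tacnode_vector v w -> exists u,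
  basis_of (T v) [:: v; w; u] /\ tacnode_at0 (plane_section F v w u).
Proof.
case=> v0 w0 Fv hess Fwww; have Fw := hessian_kernel_tangent n2 hF hess.
have [u [fu Fu bT _]] := tacnode_zero_frame n2 hF smF v0 w0 Fv hess.
have [e0 c0 disc] := gcF fu Fv Fw Fu (hess w) (hess u) Fwww.
exists u; split=> //; apply: tacnode_criterion.
- by rewrite section_coef00.
- by rewrite section_coef10.
- by rewrite section_coef01.
- apply/eqP; have := section_coef20 F v w u; rewrite hess => /eqP.
  by rewrite mulrn_eq0.
- by rewrite section_coef11 hess.
- apply/eqP; have := section_coef30 F v w u; rewrite Fwww => /eqP.
  by rewrite -mulrnA mulrn_eq0.
- by move: e0; rewrite -(section_coef02 F v w u) mulrn_eq0.
(* The derivatives are 2 c, 2 e and 24 d, so c^2 = 4 e d becomes 3 uww^2 = uu wwww; this is the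
   origin of the factor 3 in [generic_contact]. *)
- apply: contra_neq disc => E.
  rewrite -(section_coef02 F v w u) -(section_coef21 F v w u) -(section_coef40 F v w u).
  set c := _@_(mon 2 1) in E *; set e := _@_(mon 0 2) in E *; set d := _@_(mon 4 0) in E *.
  have -> : 3 * (c *+ 2) ^+ 2 = 12 * c ^+ 2 by ring.
  by rewrite E; ring.
Qed.

(** For w' = x v + y w + z u, testing the Hessian on u gives z uu = 0, and then x times the gradient
    vanishes. Hence each tacnodal point carries a single zero of the system. *)
Lemma tacnode_vector_unique (v w w' : V4) : tacnode_vector v w -> tacnode_vector v w' ->
  parallel w w'.
Proof.
case=> v0 w0 Fv hess Fwww [_ _ _ hess' _].
have Fw := hessian_kernel_tangent n2 hF hess.
have [u [fu Fu _ coord]] := tacnode_zero_frame n2 hF smF v0 w0 Fv hess.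
have [e0 _ _] := gcF fu Fv Fw Fu (hess w) (hess u) Fwww.
have [x [y [z Ew']]] := coord _ (hessian_kernel_tangent n2 hF hess').
have E (a : V4) : x * (n.-1%:R * (dder a F).@[v 0]) + z * (dder u (dder a F)).@[v 0] = 0.
  have := hess' a; rewrite dder_comm Ew' dder_comb (euler2 hF) (dder_comm w a) hess mulr0.
  by rewrite addr0.
have z0 : z = 0.
  by have /eqP := E u; rewrite Fu !mulr0 add0r mulf_eq0 (negPf e0) orbF => /eqP.
have [a Da] := smooth_dder smF v0 Fv.
have x0 : x = 0.
  have /eqP := E a; rewrite z0 mul0r addr0 !mulf_eq0 (negPf Da).
  by rewrite (negPf (pred_n_neq0 K n2)) !orbF => /eqP.
by rewrite Ew' x0 z0 !scale0r add0r addr0; apply: scale_parallel.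
Qed.

Lemma tacnode_bizero (v w : V4) : tacnode_vector v w <-> bizero (tacnode_system F) (row_mx v w).
Proof.
split=> [[v0 w0 Fv hess Fwww]|[]]; last first.
  rewrite row_mxKl row_mxKr => v0 w0 /tacnode_system_eq0.
  by rewrite row_mxKl row_mxKr => -[Fv /hessian_row hess Fwww].
split; rewrite ?row_mxKl ?row_mxKr //; apply/tacnode_system_eq0.
by rewrite row_mxKl row_mxKr; split=> //; apply/hessian_row.
Qed.

End TacnodalPoints.

(** * Algebraic dependence of polynomials in few variables *)

Section AlgebraicDependence.
Variable K : fieldType.

Definition deg_le M d (p : {mpoly K[M]}) := forall m, (d < mdeg m)%N -> p@_m = 0.

Lemma deg_leM M c d (p q : {mpoly K[M]}) : deg_le c p -> deg_le d q -> deg_le (c + d) (p * q).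
Proof.
move=> vp vq m mcd; rewrite mcoeffM big1 // => h /eqP Em.
have := congr1 (@mdeg M) Em; rewrite mdegD => Ed.
have lt_h : (c + d < mdeg h.1 + mdeg h.2)%N by rewrite -Ed.
have [h1|h1] := ltnP c (mdeg h.1); first by rewrite vp ?mul0r.
by rewrite vq ?mulr0 // -(ltn_add2l c); apply: leq_trans lt_h _; rewrite leq_add2r.
Qed.

Lemma deg_leW M c d (p : {mpoly K[M]}) : (c <= d)%N -> deg_le c p -> deg_le d p.
Proof. by move=> cd vp m dm; apply: vp; apply: leq_ltn_trans dm. Qed.

Lemma deg_le1 M : deg_le 0 (1 : {mpoly K[M]}).
Proof.
move=> m m0; rewrite mcoeff1; case: eqP => // E.
by move: m0; rewrite E mdeg0.
Qed.

Lemma deg_leX M d k (p : {mpoly K[M]}) : deg_le d p -> deg_le (k * d) (p ^+ k).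
Proof.
move=> vp; elim: k => [|k IH]; first by rewrite expr0; apply: deg_le1.
by rewrite exprS mulSn; apply: deg_leM.
Qed.

Lemma deg_le_prod M (N : nat) d (F : 'I_N -> {mpoly K[M]}) :
  (forall i, deg_le d (F i)) -> deg_le (N * d) (\prod_i F i).
Proof.
move=> vF; elim: N F vF => [|N IH] F vF; first by rewrite big_ord0; apply: deg_le1.
by rewrite big_ord_recl mulSn; apply: deg_leM => //; apply: IH.
Qed.

Lemma card_bmultinom M B : (#|{: 'X_{1..M < B.+1}}| <= B.+1 ^ M)%N.
Proof.
pose f (m : 'X_{1..M < B.+1}) : {ffun 'I_M -> 'I_B.+1} := [ffun j => inord (m j)].
have f_inj : injective f.
  move=> m1 m2 E; apply/val_inj/mnmP => j; move/ffunP/(_ j): E; rewrite !ffunE.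
  have lt_m (m : 'X_{1..M < B.+1}) : (m j < B.+1)%N.
    by apply: leq_ltn_trans (bmdeg m); rewrite mdegE (bigD1 j) //= leq_addr.
  by move/(congr1 (@nat_of_ord _)); rewrite !inordK.
by rewrite (leq_trans (leq_card f f_inj)) // card_ffun !card_ord.
Qed.

(* Pigeonhole: the monomials in the p_i with exponents < d outnumber the monomials of
   degree at most N * d * delta in M < N variables once d is large. *)
Lemma algebraic_dependence M N (p : 'I_N -> {mpoly K[M]}) : (M < N)%N ->
  exists2 D : {mpoly K[N]}, D != 0 & forall x, D.@[fun i => (p i).@[x]] = 0.
Proof.
move=> MN; pose delta := (\sum_i msize (p i))%N.
have vp i : deg_le delta (p i).
  move=> m mD; apply/memN_msupp_eq0/msize_mdeg_ge; apply: leq_trans (ltnW mD).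
  by rewrite /delta (bigD1 i) //= leq_addr.
(* The choice gives (N d delta + 1)^M <= (C d)^M = C^M d^M < d^(M+1) <= d^N. *)
pose C := (N * delta).+1; pose d := (C ^ M).+1; pose B := (N * (d * delta)).+1.
pose rows := {ffun 'I_N -> 'I_d}; pose cols := 'X_{1..M < B}.
pose P (a : rows) : {mpoly K[M]} := \prod_i p i ^+ a i.
have vP a : deg_le (N * (d * delta)) (P a).
  apply: deg_le_prod => i; apply: (@deg_leW _ (a i * delta)); last exact: deg_leX.
  by rewrite leq_mul2r (ltnW (ltn_ord (a i))) orbT.
have card_lt : (#|{: cols}| < #|{: rows}|)%N.
  rewrite card_ffun !card_ord; apply: leq_ltn_trans (card_bmultinom _ _) _.
  have d0 : (0 < d)%N by [].
  apply: (@leq_ltn_trans ((C * d) ^ M)).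
    case: (M) => [|k]; first by rewrite !expn0.
    by rewrite leq_exp2r // /B /C; nia.
  apply: (@leq_trans (d ^ M.+1)); last by rewrite leq_pexp2l.
  by rewrite expnMn expnS ltn_pmul2r ?expn_gt0 ?d0 // ltnS.
pose A : 'M[K]_(#|{: rows}|, #|{: cols}|) :=
  \matrix_(a, m) (P (enum_val a))@_(enum_val m : cols).
have : kermx A != 0.
  rewrite kermx_eq0 /row_free; apply/negP => /eqP E.
  by have := rank_leq_col A; rewrite E leqNgt card_lt.
case/rowV0Pn=> c /sub_kermxP cA c0.
pose mon (a : rows) : 'X_{1..N} := [multinom (a i : nat) | i < N].
have mon_inj : injective mon.
  move=> a b /mnmP E; apply/ffunP => i; apply: val_inj; have := E i; by rewrite !mnmE.
exists (\sum_(a : rows) c 0 (enum_rank a) *: 'X_[mon a]).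
  case/rV0Pn: c0 => a ca; apply: contraNneq ca => E.
  have := congr1 (mcoeff (mon (enum_val a))) E; rewrite mcoeff0 raddf_sum (bigD1 (enum_val a)) //=.
  rewrite big1 ?addr0 => [|b ba].
    by rewrite mcoeffZ mcoeffX eqxx mulr1 enum_valK => ->.
  by rewrite mcoeffZ mcoeffX (inj_eq mon_inj) (negPf ba) mulr0.
move=> x; have S0 : \sum_(a : rows) c 0 (enum_rank a) *: P a = 0.
  apply/mpolyP => m; rewrite mcoeff0 raddf_sum /=.
  have [mB|mB] := ltnP (mdeg m) B; last first.
    by rewrite big1 // => a _; rewrite mcoeffZ vP ?mulr0.
  have := congr1 (fun X : 'rV[K]_ #|{: cols}| => X 0 (enum_rank (BMultinom mB))) cA.
  rewrite /= !mxE => E; rewrite -[RHS]E (reindex (@enum_val rows predT)) /=; last first.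
    by apply: onW_bij; apply: enum_val_bij.
  by apply: eq_bigr => a _; rewrite mcoeffZ enum_valK mxE enum_rankK.
rewrite raddf_sum /=; have := congr1 (meval x) S0; rewrite raddf_sum meval0 /= => {2}<-.
apply: eq_bigr => a _; rewrite !mevalZ; congr (_ * _); rewrite mevalX /P rmorph_prod /=.
by apply: eq_bigr => i _; rewrite rmorphXn /= mnmE.
Qed.

Lemma polyfun_mpoly (I : finType) (f : (I -> K) -> K) :
  polyfun (fun i y => y i) f ->
  exists p : {mpoly K[#|I|]}, forall y, f y = p.@[fun j => y (enum_val j)].
Proof.
elim=> [c|j|f1 f2 _ [p1 E1] _ [p2 E2]|f1 f2 _ [p1 E1] _ [p2 E2]].
- by exists c%:MP => y; rewrite mevalC.
- by exists 'X_(enum_rank j) => y; rewrite mevalXU enum_rankK.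
- by exists (p1 + p2) => y; rewrite mevalD E1 E2.
- by exists (p1 * p2) => y; rewrite mevalM E1 E2.
Qed.

Lemma polynomial_family_dependence (I : finType) N (phi : 'I_N -> (I -> K) -> K) :
  (#|I| < N)%N -> (forall i, polyfun (fun i y => y i) (phi i)) ->
  exists2 D : {mpoly K[N]}, D != 0 & forall y, D.@[fun i => phi i y] = 0.
Proof.
move=> IN pphi; have /boolp.choice[p Hp] i := polyfun_mpoly (pphi i).
have [D D0 HD] := algebraic_dependence p IN; exists D => // y.
by rewrite -[RHS](HD (fun j => y (enum_val j))); apply: meval_eq => i; rewrite Hp.
Qed.

End AlgebraicDependence.

Section NonvanishingPoints.
Variables (K : numFieldType) (N : nat).
Implicit Types D : {mpoly K[N]}.

Lemma mderiv_deg_le D d i : deg_le d.+1 D -> deg_le d D^`M(i).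
Proof. by move=> vD m dm; rewrite mcoeff_mderiv vD ?mul0rn // mdegD mdeg1 addn1 ltnS. Qed.

(** The partial derivatives vanish everywhere too, as seen on coordinate lines; by induction on the
    degree they are 0, so D is constant in characteristic 0. *)
Lemma vanishing_mpoly_eq0 D : (forall x : 'rV[K]_N, D.@[x 0] = 0) -> D = 0.
Proof.
have [d] : exists d, deg_le d D.
  by exists (msize D) => m /ltnW mD; apply/memN_msupp_eq0/msize_mdeg_ge.
have D0E (E : {mpoly K[N]}) : (forall x : 'rV[K]_N, E.@[x 0] = 0) -> E@_0%MM = 0.
  by move=> E0; rewrite -meval0_mcoeff -[RHS](E0 0); apply: meval_eq => i; rewrite mxE.
elim: d D => [|d IH] D le_d D0.
  apply/mpolyP => m; rewrite mcoeff0; have [->|m0] := eqVneq m 0%MM; first exact: D0E.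
  by apply: le_d; rewrite lt0n mdeg_eq0.
have dD0 i : D^`M(i) = 0.
  apply: IH => [|x]; first exact: mderiv_deg_le.
  have [p [Ep _ p1]] := pmap_line x (delta_mx 0 i) (pmap_meval D).
  have p0 : p = 0 by apply: poly_vanishing_eq0 => k; rewrite -Ep D0.
  by move: p1; rewrite p0 coef0 dder_delta.
apply/mpolyP => m; rewrite mcoeff0; have [->|m0] := eqVneq m 0%MM; first exact: D0E.
have [i mi] : exists i, m i != 0%N.
  by apply/existsP; apply: contraNT m0; rewrite negb_exists => /forallP H; apply/eqP/mnmP => i;
    rewrite mnm0E; apply/eqP; have := H i; rewrite negbK.
have Em : m = (m - U_(i) + U_(i))%MM.
  by rewrite submK //; apply/mnm_lepP => j; rewrite mnm1E; case: eqP => // <-; rewrite lt0n.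
have := congr1 (mcoeff (m - U_(i))%MM) (dD0 i).
rewrite mcoeff_mderiv mcoeff0 -Em => /eqP; rewrite mulrn_eq0 => /orP[/eqP|/eqP //].
by [].
Qed.

End NonvanishingPoints.

Section HomogeneousParts.
Variables (K : numFieldType) (N : nat).
Implicit Types D : {mpoly K[N]}.

(** On the multiples of a point of the cone B, D is a polynomial in the scalar whose coefficients
    are the values of its homogeneous parts; so every part vanishes on B. *)
Lemma homogeneous_part D (B : 'rV[K]_N -> Prop) : D != 0 ->
  (forall x c, c != 0 -> B x -> B (c *: x)) -> (forall x, B x -> D.@[x 0] = 0) ->
  exists d E, [/\ E != 0, E \is d.-homog & forall x, B x -> E.@[x 0] = 0].
Proof.
move=> D0 scB BD; pose E (d : 'I_(msize D)) := pihomog mdeg d D.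
have ED : D = \sum_d E d by exact: pihomog_partitionE.
have [d Ed] : exists d, E d != 0.
  apply/existsP; apply: contraNT D0; rewrite negb_exists => /forallP H.
  by rewrite ED big1 // => d _; apply/eqP; have := H d; rewrite negbK.
exists d, (E d); split=> //; first exact: pihomogP.
move=> x Bx; pose p := \poly_(k < msize D) (pihomog mdeg k D).@[x 0].
have p0 : p = 0.
  apply: poly_vanishing_eq0 => k; have k0 : k.+1%:R != 0 :> K by rewrite pnatr_eq0.
  rewrite -(BD _ (scB x _ k0 Bx)) [in RHS]ED raddf_sum /= horner_poly.
  apply: eq_bigr => j _; rewrite (homog_eval_scale _ _ (pihomogP _ _ _)) mulrC //.
by have := congr1 (fun q : {poly K} => q`_d) p0; rewrite coef_poly ltn_ord coef0.
Qed.

End HomogeneousParts.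

Section LinearSubstitution.
Variables (K : numFieldType).
Local Notation V4 := 'rV[K]_4.
Implicit Types (F G : {mpoly K[4]}) (x v w u : V4) (g h : 'M[K]_4).

Definition linear_subst g : 4.-tuple {mpoly K[4]} := [tuple \sum_a g a j *: 'X_a | j < 4].

Lemma meval_linear_subst F g x : (F \mPo linear_subst g).@[x 0] = F.@[(x *m g) 0].
Proof.
rewrite comp_mpoly_meval; apply: meval_eq => j; rewrite !tnth_mktuple raddf_sum mxE /=.
by apply: eq_bigr => a _; rewrite mevalZ mevalXU mulrC.
Qed.

Lemma mpoly_eval_ext F G : (forall x, F.@[x 0] = G.@[x 0]) -> F = G.
Proof.
by move=> H; apply/eqP; rewrite -subr_eq0; apply/eqP/vanishing_mpoly_eq0 => x; rewrite mevalB H subrr.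
Qed.

Lemma linear_subst_homog d F g : F \is d.-homog -> F \mPo linear_subst g \is d.-homog.
Proof.
move=> hF; rewrite comp_mpolyEX; rewrite big_seq rpred_sum // => m mF.
apply: dhomogZ; rewrite comp_mpolyX -(dhomog_mf hF mF) /= mdegE.
elim/big_rec2: _ => [|j p e _ hp]; first exact: dhomog1.
apply: dhomogM => //; rewrite -[X in X.-homog]mul1n; apply: dhomogMn.
rewrite tnth_mktuple; apply: rpred_sum => a _; apply: dhomogZ.
by rewrite dhomogX /= mdeg1.
Qed.

Lemma mderiv_linear_subst F g i :
  (F \mPo linear_subst g)^`M(i) = (dder (row i g) F) \mPo linear_subst g.
Proof.
rewrite mderiv_comp dder.unlock raddf_sum /=; apply: eq_bigr => j _.
rewrite comp_mpolyZ tnth_mktuple (raddf_sum (mderiv i)) /= (bigD1 i) //= big1 => [|a ai].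
  by rewrite mderivZ mderivXU eqxx addr0 -scalerAr mulr1 mxE.
by rewrite mderivZ mderivXU (negPf ai) scaler0.
Qed.

End LinearSubstitution.

(** * Negligible families of forms *)

Section NegligibleFamilies.
Variables (K : numFieldType) (n : nat).
Implicit Types (F G : {mpoly K[4]}).

Definition form_monomial := {m : 'X_{1..4 < n.+1} | mdeg m == n}.

Definition form_coef F (i : 'I_#|{: form_monomial}|) : K := F@_(val (enum_val i)).

(** Containment in a proper closed subset of the space of coefficients; one equation is enough, as
    products serve for unions. *)
Definition negligible (B : {mpoly K[4]} -> Prop) :=
  exists2 D : {mpoly K[#|{: form_monomial}|]}, D != 0 &
    forall F, F \is n.-homog -> B F -> D.@[form_coef F] = 0.

Lemma negligible_sub (B C : {mpoly K[4]} -> Prop) :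
  (forall F, F \is n.-homog -> B F -> C F) -> negligible C -> negligible B.
Proof. by move=> BC [D D0 HD]; exists D => // F hF /(BC F hF); apply: HD. Qed.

Lemma negligible0 : negligible (fun=> False).
Proof. by exists 1; rewrite ?oner_eq0. Qed.

Lemma negligibleU B C : negligible B -> negligible C ->
  negligible (fun F => B F \/ C F).
Proof.
move=> [D D0 HD] [E E0 HE]; exists (D * E); first by rewrite mulf_neq0.
move=> F hF BCF; rewrite mevalM.
by case: BCF => [/(HD F hF)|/(HE F hF)] ->; rewrite ?mul0r ?mulr0.
Qed.

Lemma negligible_union (I : finType) (B : I -> {mpoly K[4]} -> Prop) :
  (forall i, negligible (B i)) -> negligible (fun F => exists i, B i F).
Proof.
move=> nB; suff H (s : seq I) : negligible (fun F => exists2 i, i \in s & B i F).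
  by apply: negligible_sub (H (enum I)) => F _ [i Bi]; exists i => //; rewrite mem_enum.
elim: s => [|i s IH]; first by apply: negligible_sub negligible0 => F _ [].
apply: negligible_sub (negligibleU (nB i) IH) => F _ [j]; rewrite inE => /orP[/eqP->|js] Bj.
  by left.
by right; exists j.
Qed.

Lemma form_expansion F : F \is n.-homog ->
  F = \sum_(i : form_monomial) F@_(val i) *: 'X_[val i].
Proof.
move=> hF; apply/mpolyP => m; rewrite raddf_sum /=.
under eq_bigr do rewrite mcoeffZ mcoeffX.
have [mn|mn] := eqVneq (mdeg m) n; last first.
  rewrite (dhomog_nemf_coeff hF) // big1 // => i _; case: eqP; rewrite ?mulr0 // => E.
  by move: mn; rewrite -E (eqP (valP i)) eqxx.
have lt_m : (mdeg m < n.+1)%N by rewrite mn.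
have mnb : mdeg (BMultinom lt_m) == n by rewrite /= mn.
rewrite (bigD1 (Sub (BMultinom lt_m) mnb : form_monomial)) //= eqxx mulr1 big1 ?addr0 // => i ni.
case: (_ =P m) => [E|_]; last by rewrite mulr0.
by case/negP: ni; apply/eqP; do 2!apply: val_inj.
Qed.

Section CoefficientPolynomials.
Variables (J : finType).
Local Notation pf := (polyfun (fun (j : J) (y : J -> K) => y j)).
Implicit Types (p q : (J -> K) -> {mpoly K[4]}).

Definition coef_polyfun p := forall m, pf (fun y => (p y)@_m).

Lemma coef_polyfunM p q : coef_polyfun p -> coef_polyfun q ->
  coef_polyfun (fun y => p y * q y).
Proof.
move=> Hp Hq m; pose r y := \sum_(h : 'X_{1..4 < (mdeg m).+1, (mdeg m).+1} | m == (h.1 + h.2)%MM)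
  (p y)@_(h.1 : 'X_{1..4}) * (q y)@_(h.2 : 'X_{1..4}).
apply: (@polyfun_ext _ _ _ _ r); last by move=> y; rewrite mcoeffM.
by apply: polyfun_sum => h _; apply: PolyMul.
Qed.

Lemma coef_polyfunX p k : coef_polyfun p -> coef_polyfun (fun y => p y ^+ k).
Proof.
move=> Hp; elim: k => [|k IH] m.
  by apply: (polyfun_ext (PolyCst _ (1 : {mpoly K[4]})@_m)) => y; rewrite expr0.
apply: (@polyfun_ext _ _ _ _ (fun y => (p y * p y ^+ k)@_m)); first exact: coef_polyfunM.
by move=> y; rewrite exprS.
Qed.

Lemma coef_polyfun_linear_subst (g : (J -> K) -> 'M[K]_4) (m : 'X_{1..4}) :
  (forall i j, pf (fun y => g y i j)) ->
  coef_polyfun (fun y => 'X_[m] \mPo linear_subst (g y)).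
Proof.
move=> Hg; have Hl j : coef_polyfun (fun y => tnth (linear_subst (g y)) j).
  move=> k; apply: (@polyfun_ext _ _ _ _ (fun y => \sum_a ('X_a : {mpoly K[4]})@_k * g y a j)).
    by apply: polyfun_sum => a _; apply: polyfun_scale.
  move=> y; rewrite tnth_mktuple raddf_sum /=; apply: eq_bigr => a _.
  by rewrite mcoeffZ mulrC.
have HM (r : seq 'I_4) : coef_polyfun (fun y => \prod_(j <- r) tnth (linear_subst (g y)) j ^+ m j).
  elim: r => [|j r IH] k.
    by apply: (polyfun_ext (PolyCst _ (1 : {mpoly K[4]})@_k)) => y; rewrite big_nil.
  apply: (@polyfun_ext _ _ _ _ (fun y => (tnth (linear_subst (g y)) j ^+ m j *
    \prod_(j <- r) tnth (linear_subst (g y)) j ^+ m j)@_k)).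
    by apply: coef_polyfunM => //; apply: coef_polyfunX.
  by move=> y; rewrite big_cons.
by move=> k; apply: polyfun_ext (HM _ k) _ => y; rewrite comp_mpolyX.
Qed.

End CoefficientPolynomials.

(* The forms F' (x g(y)), where the coefficients of F' on the monomials of T are functions of
   y : K^J and the others are free, depend on fewer parameters than there are coefficients. *)
Lemma family_negligible (J : finType) (T : seq 'X_{1..4}) (c : 'X_{1..4} -> (J -> K) -> K)
    (g : (J -> K) -> 'M[K]_4) :
  uniq T -> {in T, forall m, mdeg m = n} -> (#|J| < size T)%N ->
  (forall m, polyfun (fun j y => y j) (c m)) ->
  (forall i j, polyfun (fun j y => y j) (fun y => g y i j)) ->
  negligible (fun F => exists y F', [/\ F' \is n.-homog, F = F' \mPo linear_subst (g y) &
    {in T, forall m, F'@_m = c m y}]).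
Proof.
move=> uT dT JT pc pg.
pose inT : pred form_monomial := fun i => (val (val i) : 'X_{1..4}) \in T.
have cT : #|inT| = size T.
  pose f (i : form_monomial) : 'X_{1..4} := val (val i).
  rewrite cardE -(size_map f); apply/perm_size/uniq_perm => //.
    by rewrite map_inj_uniq ?enum_uniq // => i j /val_inj/val_inj.
  move=> m; apply/mapP/idP => [[i iT ->] | mT]; first by rewrite mem_enum in iT.
  have lt_m : (mdeg m < n.+1)%N by rewrite dT.
  have mnb : mdeg (BMultinom lt_m) == n by rewrite /= dT.
  by exists (Sub (BMultinom lt_m) mnb); rewrite ?mem_enum.
(* The parameters are y and the free coefficients of F', those at monomials outside T. *)
pose Q : finType := (J + {i : form_monomial | ~~ inT i})%type.
pose a (i : form_monomial) (z : Q -> K) : K :=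
  if (insub i : option {i : form_monomial | ~~ inT i}) is Some k
  then z (inr k) else c (val (val i)) (z \o inl).
pose phi (k : 'I_#|{: form_monomial}|) (z : Q -> K) : K :=
  \sum_(i : form_monomial) a i z *
     ('X_[val (val i)] \mPo linear_subst (g (z \o inl)))@_(val (val (enum_val k))).
have inlP (f : (J -> K) -> K) : polyfun (fun j y => y j) f ->
    polyfun (fun (q : Q) z => z q) (fun z => f (z \o inl)).
  move=> pf; apply: (polyfun_comp (h := fun z : Q -> K => z \o inl) pf) => j.
  exact: (PolyVar _ (inl j : Q)).
have [|k|D D0 HD] := @polynomial_family_dependence K Q #|{: form_monomial}| phi.
- by rewrite card_sum card_sig -(cardC inT) cT ltn_add2r.
- apply: polyfun_sum => i _; apply: PolyMul; last first.
    exact: (inlP _ (coef_polyfun_linear_subst (val (val i)) pg (val (val (enum_val k))))).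
  rewrite /a; case: insub => [k'|]; last exact: (inlP _ (pc _)).
  exact: (PolyVar _ (inr k' : Q)).
exists D => // F hF; case=> y [F' [hF' EF HT]].
pose z (q : Q) : K := match q with inl j => y j | inr k => F'@_(val (val (val k))) end.
rewrite -(HD z); apply: meval_eq => k; rewrite /form_coef /phi.
rewrite EF [in LHS](form_expansion hF').
rewrite (raddf_sum (comp_mpoly (linear_subst (g y)))) raddf_sum /=.
apply: eq_bigr => i _; rewrite comp_mpolyZ mcoeffZ; congr (_ * _).
rewrite /a; case: insubP => [k' _ <-//|]; rewrite negbK => iT.
exact: HT.
Qed.

End NegligibleFamilies.

(** * Singular forms are negligible *)

Section SingularForms.
Variable K : numFieldType.
Implicit Types (F G : {mpoly K[4]}).

Lemma homog_eval_delta d i G : G \is d.-homog ->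
  G.@[(delta_mx 0 i : 'rV_4) 0] = G@_(U_(i) *+ d)%MM.
Proof.
elim: d G => [|d IH] G hG.
  have := homog_eval_scale 0 (delta_mx 0 i) hG; rewrite expr0 mul1r => <-.
  by rewrite mulm0n -meval0_mcoeff; apply: meval_eq => j; rewrite scale0r mxE.
have d0 : d.+1%:R != 0 :> K by rewrite pnatr_eq0.
apply: (mulfI d0); rewrite -(euler (delta_mx 0 i) hG) dder_delta.
rewrite IH; last exact: mderiv_homog hG.
rewrite mcoeff_mderiv -mulmSr mulr_natl; congr (_ *+ _.+1).
by rewrite mulmnE mnm1E eqxx mul1n.
Qed.

Lemma linear_substK g h F : h *m g = 1%:M -> F = (F \mPo linear_subst g) \mPo linear_subst h.
Proof.
by move=> hg; apply: mpoly_eval_ext => x; rewrite !meval_linear_subst -mulmxA hg mulmx1.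
Qed.

Section PointChart.
Variables (n : nat) (i0 : 'I_4).
Hypothesis n1 : (1 <= n)%N.

Definition point_monomial (j : 'I_4) : 'X_{1..4} := (U_(i0) *+ n.-1 + U_(j))%MM.

Definition chart_index := {j : 'I_4 | j != i0}.

Definition chart_row (y : chart_index -> K) : 'rV[K]_4 :=
  \row_j (if (insub j : option chart_index) is Some k then y k else 0).

Lemma chart_row_base y : chart_row y *m delta_mx i0 0 = 0 :> 'M_1.
Proof. by rewrite -colE; apply/matrixP => i j; rewrite !mxE insubF ?eqxx. Qed.

(** A singular point at e_i0 kills the four coefficients at x_i0^(n-1) x_j, whereas the points of a
    chart have three parameters. *)
Lemma singular_at_chart_negligible : negligible n (fun F => exists2 v : 'rV[K]_4,
  v 0 i0 != 0 & forall i, F^`M(i).@[v 0] = 0).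
Proof.
pose T := [seq point_monomial j | j <- enum 'I_4].
(* The inverse of the matrix g below, which moves e_i0 to v; [chart_row] vanishes at i0, so the
   correction squares to 0 and h is polynomial in y. *)
pose h y : 'M[K]_4 := 1%:M - delta_mx i0 0 *m chart_row y.
have uT : uniq T.
  by rewrite map_inj_uniq ?enum_uniq // => i j /addmI/mnmP/(_ i); rewrite !mnm1E eqxx; case: eqP.
have dT : {in T, forall m, mdeg m = n}.
  by move=> _ /mapP[j _ ->]; rewrite mdegD mdegMn !mdeg1 mul1n addn1 prednK.
have JT : (#|{: chart_index}| < size T)%N.
  rewrite size_map size_enum_ord card_sig.
  have := cardC (pred1 i0); rewrite card1 card_ord add1n => /eq_leq; apply: leq_trans.
  by rewrite ltnS subset_leq_card //; apply/fintype.subsetP.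
have pg i j : polyfun (fun (k : chart_index) y => y k) (fun y => h y i j).
  have P : polyfun (fun (k : chart_index) y => y k) (fun y => (1%:M : 'M[K]_4) i j -
     (delta_mx i0 0 : 'M[K]_(4, 1)) i 0 * chart_row y 0 j).
    apply: polyfun_sub; first exact: PolyCst.
    apply: polyfun_scale; rewrite /chart_row; case E : (insub j : option chart_index) => [k|].
      by apply: polyfun_ext (PolyVar _ k) _ => y; rewrite mxE E.
    by apply: polyfun_ext (PolyCst _ 0) _ => y; rewrite mxE E.
  by apply: (polyfun_ext P) => y; rewrite /h !mxE big_ord1 !mxE.
apply: negligible_sub (family_negligible uT dT JT (fun m => PolyCst _ 0) pg) => F hF [v vi0 dF].
pose v1 := (v 0 i0)^-1 *: v.
have v1i0 : v1 0 i0 = 1 by rewrite mxE mulVf.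
have dF1 i : F^`M(i).@[v1 0] = 0.
  by rewrite (homog_eval_scale _ _ (mderiv_homog i hF)) dF mulr0.
clearbody v1; pose y (k : chart_index) := v1 0 (val k).
have Ey : chart_row y = v1 - delta_mx 0 i0.
  apply/rowP => j; rewrite !mxE eqxx; case: insubP => [k kj Ek|].
    by rewrite (negPf kj) subr0 -Ek.
  by rewrite negbK => /eqP ->; rewrite eqxx v1i0 subrr.
pose g : 'M[K]_4 := 1%:M + delta_mx i0 0 *m chart_row y.
have hg : h y *m g = 1%:M.
  rewrite /h /g mulmxDr mulmxBl !mul1mx mulmx1 mulmxBl mul1mx -mulmxA (mulmxA (chart_row y)).
  by rewrite chart_row_base mul0mx mulmx0 subr0 subrK.
have gi0 : delta_mx 0 i0 *m g = v1.
  rewrite mulmxDr mulmx1 mulmxA mul_delta_mx Ey.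
  by rewrite (_ : delta_mx 0 0 = 1%:M) ?mul1mx ?subrKC //; apply/matrixP => i j; rewrite !ord1 !mxE.
exists y, (F \mPo linear_subst g); split.
- exact: linear_subst_homog.
- exact: linear_substK.
move=> _ /mapP[j _ ->].
have hG := mderiv_homog j (linear_subst_homog g hF).
have := homog_eval_delta i0 hG; rewrite mderiv_linear_subst meval_linear_subst gi0.
rewrite dder_meval big1 => [|i _]; last by rewrite dF1 mulr0.
rewrite -mderiv_linear_subst mcoeff_mderiv => /esym/eqP.
by rewrite mulrn_eq0 => /orP[//|/eqP].
Qed.

End PointChart.

Lemma singular_negligible n : (1 <= n)%N ->
  negligible n (fun F => exists2 v : 'rV[K]_4, v != 0 & forall i, F^`M(i).@[v 0] = 0).
Proof.
move=> n1; apply: negligible_sub (negligible_union (fun i0 => singular_at_chart_negligible i0 n1)).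
by move=> F hF [v /rV0Pn[i vi] dF]; exists i, v.
Qed.

End SingularForms.

(** * Jets of a form along a flag *)

Section ContactJets.
Variable K : numFieldType.
Local Notation V4 := 'rV[K]_4.
Implicit Types (F G H : {mpoly K[4]}) (v w u : V4) (g : 'M[K]_4) (p : nat * nat).

(* The coordinates 3, 2, 1 correspond to the vectors v, w, u. *)
Definition contact_monomial n p : 'X_{1..4} :=
  (U_(1%R) *+ p.1 + U_(2%R) *+ p.2 + U_(3%R) *+ (n - (p.1 + p.2)))%MM.

Definition contact_jet F v w u p : K :=
  (iter p.2 (dder w) (iter p.1 (dder u) F)).@[v 0].

Lemma contact_monomial1 n p : contact_monomial n p 1%R = p.1.
Proof. by rewrite /contact_monomial !(mnmDE, mulmnE, mnm1E) /= mul1n !mul0n !addn0. Qed.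

Lemma contact_monomial2 n p : contact_monomial n p 2%R = p.2.
Proof. by rewrite /contact_monomial !(mnmDE, mulmnE, mnm1E) /= mul1n !mul0n !addn0 add0n. Qed.

Lemma mdeg_contact_monomial n p : (p.1 + p.2 <= n)%N -> mdeg (contact_monomial n p) = n.
Proof. by move=> pn; rewrite !mdegD !mdegMn !mdeg1 !mul1n subnKC. Qed.

Lemma mcoeff_mderiv1 n G p : G^`M(1%R)@_(contact_monomial n p) =
  G@_(contact_monomial n p + U_(1%R))%MM *+ p.1.+1.
Proof. by rewrite mcoeff_mderiv contact_monomial1. Qed.

Lemma mcoeff_mderiv2 n G p : G^`M(2%R)@_(contact_monomial n p) =
  G@_(contact_monomial n p + U_(2%R))%MM *+ p.2.+1.
Proof. by rewrite mcoeff_mderiv contact_monomial2. Qed.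

Lemma contact_monomialS1 n i j :
  (contact_monomial n.-1 (i, j) + U_(1%R))%MM = contact_monomial n (i.+1, j).
Proof.
rewrite /contact_monomial /= mulmSr [LHS]Monoid.mulmAC [X in (X + _)%MM = _]Monoid.mulmAC.
by rewrite (_ : n.-1 - (i + j) = n - (i.+1 + j))%N //; lia.
Qed.

Lemma contact_monomialS2 n i j :
  (contact_monomial n.-1 (i, j) + U_(2%R))%MM = contact_monomial n (i, j.+1).
Proof.
rewrite /contact_monomial /= mulmSr addmA [LHS]Monoid.mulmAC.
by rewrite (_ : n.-1 - (i + j) = n - (i + j.+1))%N //; lia.
Qed.

Lemma contact_coef n G p : G \is n.-homog ->
  (iter p.2 (mderiv 2%R) (iter p.1 (mderiv 1%R) G)).@[(delta_mx 0 3%R : V4) 0] =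
  G@_(contact_monomial n p) *+ (p.1`! * p.2`!).
Proof.
case: p => i j /=; elim: i n G => [|i IHi] n G hG.
  elim: j n G hG => [|j IHj] n G hG.
    by rewrite /= (homog_eval_delta _ hG) /contact_monomial /= !mulm0n !add0m subn0.
  rewrite iterSr (IHj n.-1); last exact: mderiv_homog.
  by rewrite mcoeff_mderiv2 contact_monomialS2 -mulrnA factS !fact0 !mul1n.
rewrite iterSr (IHi n.-1); last exact: mderiv_homog.
by rewrite mcoeff_mderiv1 contact_monomialS1 -mulrnA factS mulnA.
Qed.

Lemma iter_mderiv_linear_subst F g i k :
  iter k (mderiv i) (F \mPo linear_subst g) = iter k (dder (row i g)) F \mPo linear_subst g.
Proof. by elim: k => //= k ->; rewrite mderiv_linear_subst. Qed.

Lemma contact_jet_coef n F g p : F \is n.-homog ->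
  contact_jet F (row 3%R g) (row 2%R g) (row 1%R g) p =
  (F \mPo linear_subst g)@_(contact_monomial n p) *+ (p.1`! * p.2`!).
Proof.
move=> hF; rewrite -contact_coef; last exact: linear_subst_homog.
by rewrite !iter_mderiv_linear_subst meval_linear_subst -rowE.
Qed.

Lemma contact_jet_scale n F v w u a p : F \is n.-homog ->
  contact_jet F (a *: v) w u p = a ^+ (n - p.1 - p.2) * contact_jet F v w u p.
Proof. by move=> hF; apply: homog_eval_scale; do 2!apply: iter_dder_homog. Qed.

Lemma dder_iterD k a G H : iter k (dder a) (G + H) = iter k (dder a) G + iter k (dder a) H.
Proof. by elim: k => //= k ->; rewrite dderD. Qed.

Lemma dder_iterZ k a (c : K) G : iter k (dder a) (c *: G) = c *: iter k (dder a) G.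
Proof. by elim: k => //= k ->; rewrite dderZ. Qed.

(** Every derivative along v reduces by Euler to a lower derivative along w, which vanishes by
    hypothesis. *)
Lemma iter_dder_shift v w (b c : K) k d H : H \is d.-homog ->
  (forall j, (j < k)%N -> (iter j (dder w) H).@[v 0] = 0) ->
  (iter k (dder (b *: w + c *: v)) H).@[v 0] = b ^+ k * (iter k (dder w) H).@[v 0].
Proof.
elim: k d H => [|k IH] d H hH Z; first by rewrite mul1r.
have ev j : (j < k.+1)%N -> (iter j (dder w) (dder v H)).@[v 0] = 0.
  move=> jk; rewrite iter_dder_comm (euler _ (iter_dder_homog j w hH)).
  by rewrite Z ?mulr0.
rewrite !iterSr dderDl !dderZl dder_iterD !dder_iterZ mevalD !mevalZ.
rewrite (IH d.-1 (dder w H)); last 2 first.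
- exact: dder_homog.
- by move=> j jk; rewrite -iterSr Z.
rewrite (IH d.-1 (dder v H)); last 2 first.
- exact: dder_homog.
- by move=> j jk; rewrite ev // ltnS ltnW.
by rewrite ev // !mulr0 addr0 mulrA -exprS.
Qed.

(** Orders in u and in w of the six derivatives whose vanishing [generic_contact] assumes. *)
Definition contact_base : seq (nat * nat) := [:: (0, 0); (0, 1); (1, 0); (0, 2); (1, 1); (0, 3)]%N.

(** The contact conditions depend on the flag only, and the next jets uu, uww, wwww are merely
    rescaled; this permits the frame produced by the LU decomposition. *)
Lemma contact_jet_frame n F v w u (a b c d e f : K) : F \is n.-homog ->
  {in contact_base, forall p, contact_jet F v w u p = 0} ->
  let j := contact_jet F (a *: v) (b *: w + c *: v) (d *: u + e *: w + f *: v) in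
  [/\ {in contact_base, forall p, j p = 0},
      j (2, 0)%N = a ^+ (n - 2) * d ^+ 2 * contact_jet F v w u (2, 0)%N,
      j (1, 2)%N = a ^+ (n - 3) * (d * b ^+ 2) * contact_jet F v w u (1, 2)%N &
      j (0, 4)%N = a ^+ (n - 4) * b ^+ 4 * contact_jet F v w u (0, 4)%N].
Proof.
move=> hF Z; set w' := _ + c *: v; set u' := _ + f *: v.
have Z0 k : (k < 4)%N -> (iter k (dder w) F).@[v 0] = 0.
  by case: k => [|[|[|[|//]]]] _; [exact: (Z (0, 0)%N)|exact: (Z (0, 1)%N)|exact: (Z (0, 2)%N)|
    exact: (Z (0, 3)%N)].
have Z1 k : (k < 2)%N -> (iter k (dder w) (dder u F)).@[v 0] = 0.
  by case: k => [|[|//]] _; [exact: (Z (1, 0)%N)|exact: (Z (1, 1)%N)].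
have Zv k : (k < 4)%N -> (iter k (dder w) (dder v F)).@[v 0] = 0.
  move=> k4; rewrite iter_dder_comm (euler _ (iter_dder_homog k w hF)).
  by rewrite Z0 ?mulr0.
have J0 k : (k < 5)%N -> contact_jet F v w' u' (0, k)%N = b ^+ k * contact_jet F v w u (0, k)%N.
  by move=> k5; apply: (iter_dder_shift _ _ hF) => j /= jk; apply: Z0; lia.
have J1 k : (k < 3)%N -> contact_jet F v w' u' (1, k)%N = d * b ^+ k * contact_jet F v w u (1, k)%N.
  move=> k3; rewrite /contact_jet /= 2!dderDl !dderZl 2!dder_iterD !dder_iterZ 2!mevalD !mevalZ.
  rewrite (iter_dder_shift _ _ (dder_homog u hF)); last first.
    by move=> j jk; apply: Z1; lia.
  rewrite (iter_dder_shift _ _ (dder_homog w hF)); last first.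
    by move=> j jk; rewrite -iterSr; apply: Z0; lia.
  rewrite (iter_dder_shift _ _ (dder_homog v hF)); last first.
    by move=> j jk; apply: Zv; lia.
  have -> : (iter k (dder w) (dder w F)).@[v 0] = 0 by rewrite -iterSr; apply: Z0.
  by rewrite Zv ?ltnS ?(ltnW k3) // !mulr0 !addr0 mulrA.
have J2 : contact_jet F v w' u' (2, 0)%N = d ^+ 2 * contact_jet F v w u (2, 0)%N.
  have uw : (dder u (dder w F)).@[v 0] = 0 by rewrite dder_comm; exact: (Z (1, 1)%N).
  have wu : (dder w (dder u F)).@[v 0] = 0 by exact: (Z (1, 1)%N).
  have ww : (dder w (dder w F)).@[v 0] = 0 by exact: (Z (0, 2)%N).
  have vx (x : V4) : (dder x F).@[v 0] = 0 -> (dder v (dder x F)).@[v 0] = 0.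
    by move=> x0; rewrite (euler _ (dder_homog x hF)) x0 mulr0.
  have v0 : (dder v F).@[v 0] = 0 by exact: (Zv 0%N).
  have w0 : (dder w F).@[v 0] = 0 by exact: (Z0 1%N).
  have u0 : (dder u F).@[v 0] = 0 by exact: (Z1 0%N).
  have D G : (dder u' G).@[v 0] = d * (dder u G).@[v 0] + e * (dder w G).@[v 0] + f * (dder v G).@[v 0].
    by rewrite !dderDl !dderZl !mevalD !mevalZ.
  rewrite /contact_jet /= D !(dder_comm _ u') !D uw wu ww !(dder_comm _ v) !vx //.
  by ring.
rewrite /=; split=> [p|||].
- rewrite !inE (contact_jet_scale _ _ _ _ _ hF) => pB.
  suff -> : contact_jet F v w' u' p = 0 by rewrite mulr0.
  case/or4P: pB => [/eqP->|/eqP->|/eqP->|/or3P[]/eqP->]; rewrite ?J0 ?J1 // Z ?mulr0 //.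
- by rewrite (contact_jet_scale _ _ _ _ _ hF) J2 /= subn0 mulrA.
- by rewrite (contact_jet_scale _ _ _ _ _ hF) J1 //= mulrA -subnDA.
- by rewrite (contact_jet_scale _ _ _ _ _ hF) J0 //= mulrA subn0.
Qed.
End ContactJets.

(** * Families of forms parametrised by flags *)

Section ContactFamilies.
Variables (K : numFieldType) (n : nat).
Local Notation V4 := 'rV[K]_4.
Implicit Types (F G : {mpoly K[4]}) (v w u : V4) (g : 'M[K]_4) (p : nat * nat).

Definition lower_index := {p : 'I_4 * 'I_4 | (p.2 < p.1)%N}.

Definition lower_mx (y : lower_index -> K) : 'M[K]_4 := \matrix_(i, j)
  (if (insub (i, j) : option lower_index) is Some k then y k else (i == j)%:R).

(** Six is the dimension of the variety of complete flags of K^4 and also the length of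
    [contact_base]. *)
Lemma card_lower_index : #|{: lower_index}| = 6.
Proof.
rewrite card_sig -sum1_card.
transitivity (\sum_(i < 4) \sum_(j < 4 | (j < i)%N) 1)%N; first by rewrite pair_big_dep.
under eq_bigr do rewrite big_mkcond /= !big_ord_recl big_ord0 /=.
by rewrite !big_ord_recl big_ord0.
Qed.

Lemma lower_upper_decomposition m (A : 'M[K]_m.+1) :
  exists (s : {perm 'I_m.+1}) (L U : 'M[K]_m.+1),
  [/\ perm_mx s *m A = L *m U, forall i j : 'I_m.+1, (i <= j)%N -> L i j = (i == j)%:R &
    forall i j : 'I_m.+1, (j < i)%N -> U i j = 0].
Proof.
have := cormen_lup_perm A; have := @cormen_lup_lower _ _ A; have := @cormen_lup_upper _ _ A.
have := cormen_lup_correct A; move: (cormen_lup A) => -[[P L] U].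
by move=> E Uu Ll /is_perm_mxP[s Ps]; exists s, L, U; rewrite -Ps.
Qed.

(* The upper triangular factor of the inverse of g only changes the flag
   spanned by the last rows of g by a change of adapted basis. *)
Lemma contact_frame g : g \in unitmx -> exists (s : {perm 'I_4}) y (U : 'M[K]_4),
  row_perm s (lower_mx y) *m (U *m g) = 1%:M /\
  forall i j : 'I_4, (j < i)%N -> U i j = 0.
Proof.
move=> ug; have [s [L [U [E Ll Uu]]]] := lower_upper_decomposition (invmx g).
exists s^-1%g, (fun k => L (val k).1 (val k).2), U; split=> //.
have -> : lower_mx (fun k => L (val k).1 (val k).2) = L.
  apply/matrixP => i j; rewrite !mxE; case: insubP => [k _ -> //|].
  by rewrite -leqNgt /= => ij; rewrite Ll.
rewrite row_permE -mulmxA (mulmxA L) -E -mulmxA mulVmx // mulmx1.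
by rewrite -perm_mxM mulVg perm_mx1.
Qed.

Section Family.
Variables (J : finType) (X : seq (nat * nat)) (c : nat * nat -> (J -> K) -> K).
Local Notation monomials := (contact_base ++ X).
Hypotheses (uX : uniq monomials) (dX : all (fun p => (p.1 + p.2 <= n)%N) monomials).
Hypotheses (JX : (#|J| < size X)%N) (pc : forall p, polyfun (fun j y => y j) (c p)).

Definition contact_family F := exists s z g (y : J -> K),
  [/\ F \is n.-homog, row_perm s (lower_mx z) *m g = 1%:M &
    {in monomials, forall p, contact_jet F (row 3%R g) (row 2%R g) (row 1%R g) p = c p y}].

(** Flag parameters and base conditions balance, so it only matters that X has more conditions than
    J has parameters. *)
Lemma contact_family_negligible : negligible n contact_family.
Proof.
pose T := [seq contact_monomial n p | p <- monomials].
pose I : finType := (lower_index + J)%type.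
(* A jet is a Taylor coefficient times factorials, which are divided out here. *)
pose C (m : 'X_{1..4}) (y : I -> K) : K :=
  ((m 1%R)`! * (m 2%R)`!)%:R^-1 * c (m 1%R : nat, m 2%R : nat) (y \o inr).
pose h (s : {perm 'I_4}) (y : I -> K) : 'M[K]_4 := row_perm s (lower_mx (y \o inl)).
have uT : uniq T.
  rewrite map_inj_uniq // => p q E; apply/eqP; rewrite -pair_eqE /=.
  by rewrite -(contact_monomial1 n p) -(contact_monomial2 n p) E contact_monomial1
    contact_monomial2 !eqxx.
have dT : {in T, forall m, mdeg m = n}.
  by move=> _ /mapP[p /(allP dX) pn ->]; apply: mdeg_contact_monomial.
have IT : (#|{: I}| < size T)%N.
  by rewrite card_sum card_lower_index size_map size_cat ltn_add2l.
have pC m : polyfun (fun i (y : I -> K) => y i) (C m).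
  apply: polyfun_scale; apply: (polyfun_comp (h := fun y : I -> K => y \o inr) (pc _)) => j.
  exact: (PolyVar _ (inr j : I)).
have ph s i j : polyfun (fun i (y : I -> K) => y i) (fun y => h s y i j).
  case E : (insub (s i, j) : option lower_index) => [k|].
    by apply: (polyfun_ext (PolyVar _ (inl k : I))) => y; rewrite !mxE E.
  by apply: (polyfun_ext (PolyCst _ (s i == j)%:R)) => y; rewrite !mxE E.
apply: negligible_sub (negligible_union (fun s => family_negligible uT dT IT pC (ph s))).
move=> F _ [s [z [g [y [hF hg jF]]]]]; exists s.
exists (fun i => match i with inl k => z k | inr k => y k end), (F \mPo linear_subst g); split; first exact: linear_subst_homog.
  exact: linear_substK.
move=> _ /mapP[p pM ->]; rewrite /C contact_monomial1 contact_monomial2.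
have fact_neq0 : (p.1`! * p.2`!)%:R != 0 :> K by rewrite pnatr_eq0 -lt0n muln_gt0 !fact_gt0.
apply: (mulfI fact_neq0); rewrite mulVKf // mulr_natl -(contact_jet_coef _ _ hF) jF //.
by rewrite -surjective_pairing.
Qed.

End Family.
End ContactFamilies.

(** * Degenerate contact is negligible *)

Section ContactLoci.
Variables (K : numFieldType) (n : nat).
Hypothesis n3 : (3 <= n)%N.
Local Notation V4 := 'rV[K]_4.
Implicit Types (F G : {mpoly K[4]}) (v w u : V4) (g : 'M[K]_4) (p : nat * nat).

Lemma dder_homog0 a G : G \is 0.-homog -> dder a G = 0.
Proof.
move=> hG; rewrite dder.unlock big1 // => i _; apply/mpolyP => m.
rewrite mcoeffZ mcoeff_mderiv (dhomog_nemf_coeff hG) ?mul0rn ?mulr0 ?mcoeff0 //=.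
by rewrite mdegD mdeg1 addn1.
Qed.

Lemma free_frame v w u : free [:: v; w; u] ->
  exists2 g, g \in unitmx & [/\ row 3%R g = v, row 2%R g = w & row 1%R g = u].
Proof.
move=> fr; have [z _ zn] : exists2 z : V4, z \in fullv & z \notin <<[:: v; w; u]>>%VS.
  apply/subvPn/negP => /dimvS; rewrite dimvf /dim /= mul1n.
  by rewrite leqNgt (leq_ltn_trans (dim_span _)).
pose X := [tuple z; u; w; v].
have frX : free X.
  have P : perm_eq [:: u; w; v] [:: v; w; u] by rewrite -perm_rev.
  by rewrite /= free_cons (eq_span (perm_mem P)) zn (perm_free P).
pose g : 'M[K]_4 := \matrix_(i, j) X`_i 0 j.
have gX (i : 'I_4) : row i g = X`_i by apply/rowP => j; rewrite !mxE.
exists g; last by rewrite !gX.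
rewrite -row_free_unit -kermx_eq0; apply/eqP/row_matrixP => i; rewrite row0.
have := mulmx_ker g; set k := kermx g => /(congr1 (row i)); rewrite row0 row_mul.
rewrite mulmx_sum_row; under eq_bigr do rewrite gX.
by move/(elimT freeP frX) => k0; apply/rowP => j; rewrite k0 mxE.
Qed.

Lemma adapted_frame v w u : free [:: v; w; u] -> exists s z g (a b c d e f : K),
  [/\ row_perm s (lower_mx z) *m g = 1%:M, row 3%R g = a *: v,
      row 2%R g = b *: w + c *: v & row 1%R g = d *: u + e *: w + f *: v].
Proof.
case/free_frame=> g ug [gv gw gu]; have [s [z [U [E Uu]]]] := contact_frame ug.
have rU (i : 'I_4) : row i (U *m g) = \sum_j U i j *: row j g.
  by rewrite row_mul mulmx_sum_row; apply: eq_bigr => j _; rewrite mxE.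
have S4 (f : 'I_4 -> V4) : \sum_j f j = f 0 + f 1%R + f 2%R + f 3%R.
  rewrite !big_ord_recl big_ord0 addr0 !addrA; congr (_ + f _ + f _ + f _); exact: val_inj.
exists s, z, (U *m g), (U 3%R 3%R), (U 2%R 2%R), (U 2%R 3%R), (U 1%R 1%R), (U 1%R 2%R), (U 1%R 3%R).
by split; rewrite // rU S4 gv gw gu ?(Uu 3%R 0) ?(Uu 3%R 1%R) ?(Uu 3%R 2%R) ?(Uu 2%R 0)
  ?(Uu 2%R 1%R) ?(Uu 1%R 0) // !scale0r !add0r.
Qed.

Definition contact_type (X : seq (nat * nat)) F := contact_family n
  (J := 'I_0) X (fun _ _ => 0) F.

(* Parametrises the locus 3 uww^2 = uu wwww, uu != 0 by y_0 = uu and y_1 = uww / uu. *)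
Definition degenerate_quartic p (y : 'I_2 -> K) : K :=
  if p == (2, 0)%N then y 0 else if p == (1, 2)%N then y 0 * y 1
  else if p == (0, 4)%N then 3 * (y 0 * y 1 ^+ 2) else 0.

Lemma contact_base_degree : all (fun p => p.1 + p.2 <= n)%N contact_base.
Proof. by rewrite /=; lia. Qed.

Lemma contact_type_negligible p : (p.1 + p.2 <= n)%N -> p \notin contact_base ->
  negligible n (contact_type [:: p]).
Proof.
move=> pn pB; apply: contact_family_negligible => [|||q]; last exact: PolyCst.
- by rewrite cats1 rcons_uniq pB.
- by rewrite all_cat contact_base_degree /= pn.
- by rewrite card_ord.
Qed.

Lemma degenerate_quartic_negligible : (4 <= n)%N ->
  negligible n (contact_family n [:: (2, 0); (1, 2); (0, 4)]%N degenerate_quartic).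
Proof.
move=> n4; apply: contact_family_negligible => [|||q].
- by [].
- by rewrite all_cat contact_base_degree /= !addn0 !add0n n4 n3 ltnW.
- by rewrite card_ord.
pose y0 := PolyVar (fun (i : 'I_2) (y : 'I_2 -> K) => y i) 0.
pose y1 := PolyVar (fun (i : 'I_2) (y : 'I_2 -> K) => y i) 1.
rewrite /degenerate_quartic; have [_|_] := eqVneq q (2, 0)%N; first exact: y0.
have [_|_] := eqVneq q (1, 2)%N; first exact: PolyMul y0 y1.
have [_|_] := eqVneq q (0, 4)%N; last exact: PolyCst.
exact: polyfun_scale (PolyMul y0 (polyfun_exp _ y1)).
Qed.

Lemma contact_negligible : negligible n (fun F => ~ generic_contact F).
Proof.
pose B1 := contact_type [:: (2, 0)%N]; pose B2 := contact_type [:: (1, 2)%N].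
pose B3 F := (4 <= n)%N /\ contact_family n [:: (2, 0); (1, 2); (0, 4)]%N degenerate_quartic F.
have nB3 : negligible n B3.
  have [n4|n4] := boolP (4 <= n)%N.
    by apply: negligible_sub (degenerate_quartic_negligible n4) => F _ [].
  by apply: negligible_sub (negligible0 _ _) => F _ [] /idPn.
have nB1 : negligible n B1 by apply: contact_type_negligible; rewrite //= ltnW.
have nB2 : negligible n B2 by apply: contact_type_negligible.
apply: negligible_sub (negligibleU nB1 (negligibleU nB2 nB3)) => F hF ng.
apply: contrapT => nB; apply: ng => v w u fr v0 w0 u0 ww uw www.
have [s [z [g [a [b [c [d [e [f [hg gv gw gu]]]]]]]]]] := adapted_frame fr.
have Z : {in contact_base, forall p, contact_jet F v w u p = 0}.
  move=> p; rewrite !inE => /or4P[/eqP->|/eqP->|/eqP->|/or3P[]/eqP->] //.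
  by rewrite /contact_jet /= dder_comm.
have [] := contact_jet_frame a b c d e f hF Z; rewrite -gv -gw -gu => Z' E' C' D'.
have inB X (J : finType) (cf : nat * nat -> (J -> K) -> K) (y : J -> K) :
    {in contact_base ++ X, forall p, contact_jet F (row 3%R g) (row 2%R g) (row 1%R g) p = cf p y} ->
  contact_family n X cf F by move=> H; exists s, z, g, y.
have inT p : contact_jet F (row 3%R g) (row 2%R g) (row 1%R g) p = 0 -> contact_type [:: p] F.
  move=> jp; apply: inB (fun=> 0) _ => q.
  by rewrite mem_cat mem_seq1 => /orP[/Z'//|/eqP->].
have uuE : (dder u (dder u F)).@[v 0] = contact_jet F v w u (2, 0)%N by [].
have uwwE : (dder u (dder w (dder w F))).@[v 0] = contact_jet F v w u (1, 2)%N.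
  by rewrite /contact_jet /= (dder_comm w u) (dder_comm w u).
have wwwwE : (dder w (dder w (dder w (dder w F)))).@[v 0] = contact_jet F v w u (0, 4)%N by [].
rewrite uuE uwwE wwwwE; split; apply/eqP => H; apply: nB.
- by left; apply: inT; rewrite E' H mulr0.
- by right; left; apply: inT; rewrite C' H mulr0.
have [n4|n4] := ltnP 3 n; last first.
  (* For cubics the fourth derivative vanishes, so the degenerate relation reduces to uww = 0. *)
  right; left; apply: inT; rewrite C'; apply/eqP; rewrite mulf_eq0; apply/orP; right.
  have D0 : contact_jet F v w u (0, 4)%N = 0.
    have n3E : n = 3%N by apply/eqP; rewrite eqn_leq n4.
    rewrite /contact_jet iterS /= dder_homog0 ?meval0 //.
    by have := iter_dder_homog 3 w hF; rewrite n3E.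
  by move/eqP: H; rewrite D0 mulr0 mulf_eq0 pnatr_eq0 sqrf_eq0.
have := E'; set e' := contact_jet _ _ _ _ (2, 0)%N => e'E.
have [e0|e0] := eqVneq e' 0; first by left; apply: inT.
(* With uu nonzero in the new frame, the parameters of [degenerate_quartic] are y_0 = uu and y_1 =
   uww / uu. *)
right; right; split=> //; pose c' := contact_jet F (row 3%R g) (row 2%R g) (row 1%R g) (1, 2)%N.
apply: inB (fun i : 'I_2 => if i == 0 then e' else c' / e') _ => q.
rewrite mem_cat => /orP[qB|].
  rewrite Z' //; move: qB; rewrite !inE => /or4P[/eqP->|/eqP->|/eqP->|/or3P[]/eqP->] //.
rewrite !inE => /or3P[]/eqP-> //; rewrite /degenerate_quartic /=.
  by rewrite -/c' mulrC divfK.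
apply: (mulfI e0).
have -> : e' * (3 * (e' * (c' / e') ^+ 2)) = 3 * c' ^+ 2 by field.
rewrite D' e'E /c' C'.
(* The relation 3 uww^2 = uu wwww survives the change of frame because both sides acquire the same
   factor. *)
have aE : a ^+ (n - 2) * a ^+ (n - 4) = (a ^+ (n - 3)) ^+ 2.
  by rewrite -exprD -exprM; congr (_ ^+ _); lia.
set x := a ^+ (n - 2) in aE *; set y := a ^+ (n - 4) in aE *; set t := a ^+ (n - 3) in aE *.
rewrite (_ : x * _ * _ * _ = (x * y) * d ^+ 2 * b ^+ 4 * (contact_jet F v w u (2, 0)%N *
  contact_jet F v w u (0, 4)%N)); last by ring.
by rewrite aE -H; ring.
Qed.

End ContactLoci.

(** * Points of projective space and their representatives *)

Section ProjectivePoints.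
Variables (K : fieldType) (V : vectType K).
Implicit Types (q : projective V) (v : V).

Lemma vpick_neq0 q : vpick (val q) != 0.
Proof. by rewrite vpick0 -dimv_eq0 (eqP (valP q)). Qed.

Lemma projective_line q : val q = <[vpick (val q)]>%VS.
Proof.
apply/esym/eqP; rewrite eqEdim (eqP (valP q)) dim_vline vpick_neq0 leqnn andbT.
by rewrite -memvE memv_pick.
Qed.

Lemma projective_point v : v != 0 -> exists q, exists2 c, c != 0 & vpick (val q) = c *: v.
Proof.
move=> v0; have L1 : \dim <[v]>%VS == 1%N by rewrite dim_vline v0.
exists (Sub <[v]>%VS L1); have /vlineP[c E] := memv_pick <[v]>%VS; exists c => //.
by apply: contra_neq v0 => c0; have := vpick_neq0 (Sub <[v]>%VS L1); rewrite /= E c0 scale0r eqxx.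
Qed.

Lemma projective_eq q q' c : vpick (val q) = c *: vpick (val q') -> q = q'.
Proof.
move=> E; apply/val_inj/eqP; rewrite eqEdim (eqP (valP q)) (eqP (valP q')) leqnn andbT.
by rewrite projective_line -memvE E memvZ // memv_pick.
Qed.

End ProjectivePoints.

(** * The number of tacnodal points *)

Section TacnodeCount.
Variables (K : numClosedFieldType) (n : nat) (S : surface K n).
Local Notation V4 := 'rV[K]_4.
Local Notation F := (equation S).
Hypotheses (n2 : (2 <= n)%N) (smF : smooth_form F).

Let hF : F \is n.-homog := dhomog_is_dhomog _.

(** The Hessian of a quadric is constant, so a kernel vector w is itself a singular point. *)
Lemma no_tacnode_quadric q : n = 2%N -> ~ tacnodal S q.
Proof.
move=> n2E [Fv [a [b [bT tac]]]].
have [w [v0 w0 _ hess _]] := tacnode_kernel_vector n2 hF smF (vpick_neq0 q) Fv bT tac.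
have h0 x : dder x (dder w F) \is 0.-homog.
  by have := dder_homog x (dder_homog w hF); rewrite (_ : n.-1.-1 = 0%N) // n2E.
have hw x : (dder x F).@[w 0] = 0.
  have := homog_eval_scale 0 w (h0 x); rewrite expr0 mul1r scale0r => E.
  have := homog_eval_scale 0 (vpick (val q)) (h0 x); rewrite expr0 mul1r scale0r hess E.
  by rewrite dder_comm (euler _ (dder_homog x hF)) (_ : n.-1 = 1%N) ?mul1r // n2E.
have Fw : F.@[w 0] = 0.
  have := euler w hF; rewrite hw => /esym/eqP; rewrite mulf_eq0 pnatr_eq0.
  by rewrite -leqn0 leqNgt (ltnW n2) => /eqP.
by have [ i] := smF w0 Fw; rewrite -dder_delta hw eqxx.
Qed.

Lemma tacnode_vectorZ c v w : c != 0 -> tacnode_vector F v w -> tacnode_vector F (c *: v) w.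
Proof.
move=> c0 /tacnode_bizero /(bizero_scale (tacnode_bihomog hF) c0 (oner_neq0 K)) tw.
by apply/tacnode_bizero; rewrite row_mxKl row_mxKr scale1r in tw.
Qed.

Hypotheses (gcF : generic_contact F) (ul : bounded_ultralimits K).

Lemma tacnodal_iff q : tacnodal S q <-> exists w, tacnode_vector F (vpick (val q)) w.
Proof.
split=> [[Fv [a [b [bT tac]]]]|[w tw]].
  exact: (tacnode_kernel_vector n2 hF smF (vpick_neq0 q) Fv bT tac).
have [u [bT tac]] := tacnode_vector_section n2 hF smF gcF tw.
by split; [case: tw | exists w, u].
Qed.

Local Notation N := #|selections (vdegree n) wdegree|.

Lemma tacnode_system_zeros : has_zeros (tacnode_system F) N.
Proof.
have [dS [pS ndS]] := start_nondegenerate K (vdegree n) wdegree.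
apply: (bezout_invariance ul pS (tacnode_pmap F) (start_bihomog _ _) (tacnode_bihomog hF) ndS
  (tacnode_nondegenerate n2 hF smF gcF)).
exact: start_has_zeros.
Qed.

Lemma tacnode_system_zeros_le m : has_zeros (tacnode_system F) m -> (m <= N)%N.
Proof.
have [dS [pS ndS]] := start_nondegenerate K (vdegree n) wdegree.
move/(bezout_invariance ul (tacnode_pmap F) pS (tacnode_bihomog hF) (start_bihomog _ _)
  (tacnode_nondegenerate n2 hF smF gcF) ndS).
exact: start_zeros_le.
Qed.

(** The zeros project to distinct tacnodal points because w is determined by v up to a scalar. *)
Lemma tacnodal_points : exists s : seq (projective V4),
  [/\ uniq s, (forall q, q \in s <-> tacnodal S q) & size s = N].
Proof.
have [z [Zz Dz]] := tacnode_system_zeros.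
have /boolp.choice[pt Hpt] (a : 'I_N) : exists q : projective V4,
    exists2 c, c != 0 & vpick (val q) = c *: lsubmx (z a).
  by apply: projective_point; case: (Zz a).
have tz a : tacnode_vector F (lsubmx (z a)) (rsubmx (z a)).
  by apply/tacnode_bizero; rewrite hsubmxK.
have pt_eq (q : projective V4) a (c : K) (w : V4) : c != 0 -> vpick (val q) = c *: vpick (val (pt a)) ->
    tacnode_vector F (vpick (val q)) w -> same_point (row_mx (vpick (val q)) w) (z a).
  have [d d0 ->] := Hpt a; rewrite scalerA => c0 Eq tw.
  split; rewrite ?row_mxKl ?row_mxKr; first by rewrite Eq; apply/parallelC/scale_parallel.
  apply: (tacnode_vector_unique n2 hF smF gcF tw); rewrite Eq.
  by apply: tacnode_vectorZ; rewrite // mulf_neq0.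
have pt_inj : injective pt.
  move=> a b E; apply/eqP/negPn/negP => ab; apply: (Dz a b ab).
  have [c c0 Ec] := Hpt a.
  have tw := tacnode_vectorZ c0 (tz a); rewrite -Ec in tw.
  have Eb : vpick (val (pt a)) = 1 *: vpick (val (pt b)) by rewrite E scale1r.
  have [] := pt_eq (pt a) b 1 (rsubmx (z a)) (oner_neq0 _) Eb tw; rewrite row_mxKl row_mxKr Ec => P1 P2.
  by split=> //; apply: parallelZl P1.
exists [seq pt a | a <- enum 'I_N]; split; last by rewrite size_map size_enum_ord.
  by rewrite map_inj_uniq ?enum_uniq.
move=> q; split=> [/mapP[a _ ->]|tq].
  apply/tacnodal_iff; exists (rsubmx (z a)).
  by have [c c0 ->] := Hpt a; apply: tacnode_vectorZ.
have [//|qn] := boolP (q \in _).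
have [w tw] := (tacnodal_iff q).1 tq.
(* A tacnodal point missing from the list would provide one zero too many. *)
suff /tacnode_system_zeros_le : has_zeros (tacnode_system F) N.+1 by rewrite ltnn.
pose x := row_mx (vpick (val q)) w.
have Dx a : ~ same_point x (z a).
  case; rewrite row_mxKl => + _; have [c c0 Ec] := Hpt a => P.
  have [d Ed] : exists d, vpick (val q) = d *: lsubmx (z a).
    by apply: parallelP; [case: (Zz a) | exact: parallelC].
  case/mapP: qn; exists a; rewrite ?mem_enum //.
  by apply: (@projective_eq _ _ _ _ (d / c)); rewrite Ec scalerA divfK.
exists (fun a => if unlift ord0 a is Some b then z b else x); split=> [a|a b].
  by case: unliftP => [b _|_] //; apply/tacnode_bizero.
case: unliftP => [a' ->|->]; case: unliftP => [b' ->|->]; rewrite ?eqxx //.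
- by rewrite (inj_eq lift_inj) => /Dz.
- by move=> _ /same_point_sym/Dx.
Qed.

End TacnodeCount.

(** Here a, b, c stand for n, n - 2, n - 3, and the constant terms 0, 1, 3 are the degrees in w. *)
Lemma bezout_coefficient (a b c : int) : ((a *: 'X + 0%:P) * ((b *: 'X + 1%:P) * ((b *: 'X + 1%:P) *
  ((b *: 'X + 1%:P) * ((b *: 'X + 1%:P) * (c *: 'X + 3%:P))))) : {poly int})`_3 =
  a * (18 * b ^+ 2 + 4 * b * c).
Proof.
have E3 : 3%:P = 3 :> {poly int} by rewrite rmorph_nat.
rewrite -!mul_polyC polyC0 polyC1 E3.
set p : {poly int} := (X in polyseq X); pose A := a%:P; pose B := b%:P; pose C := c%:P.
(* Sorted by powers of X, so that the coefficient of X^3 can be read off. *)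
have -> : p = (a * (18 * b ^+ 2 + 4 * b * c))%:P * 'X^3 + (3 * a)%:P * 'X +
  (a * (12 * b + c))%:P * 'X^2 +
  (A * (12 * B ^+ 3 + 6 * B ^+ 2 * C) + A * (3 * B ^+ 4 + 4 * B ^+ 3 * C) * 'X +
    A * B ^+ 4 * C * 'X^2) * 'X^4.
  by rewrite !(rmorphM, rmorphD, rmorphXn, rmorph_nat) /= /p /A /B /C; ring.
by rewrite !coefD !coefCM !coefXn coefX coefMXn /=; ring.
Qed.

Lemma card_tacnode_selections n : (3 <= n)%N ->
  #|selections (vdegree n) wdegree|%:Z = 2 * n%:Z * (n%:Z - 2) * (11 * n%:Z - 24).
Proof.
move=> n3; rewrite card_selections !big_ord_recl big_ord0 /vdegree /wdegree /by_equation /=.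
rewrite mulr1 bezout_coefficient !natrB ?(leq_trans _ n3) // (natz n).
by ring.
Qed.

(** * Generic forms contain a Zariski open set *)

Section GenericForms.
Variables (K : numFieldType) (n : nat).
Local Notation V := (dhomog 4 K n).
Implicit Types (c : K) (F : {mpoly K[4]}).

(** Passes from monomial coefficients to the coordinates in which [zariski_closed] is stated. *)
Lemma negligible_hcoord (B : {mpoly K[4]} -> Prop) : negligible n B ->
  exists2 D : {mpoly K[\dim {:V}]}, D != 0 &
    forall f : V, B f -> D.@[hcoord f] = 0.
Proof.
case=> E E0 HE; pose T : #|{: form_monomial n}|.-tuple {mpoly K[\dim {:V}]} :=
  [tuple \sum_(j < \dim {:V})
     (((vbasis {:V})`_j : V) : {mpoly K[4]})@_(val (val (enum_val i))) *: 'X_j |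
    i < #|{: form_monomial n}|].
have ET (f : V) : (E \mPo T).@[hcoord f] = E.@[form_coef f].
  rewrite comp_mpoly_meval; apply: meval_eq => i; rewrite tnth_mktuple raddf_sum /=.
  rewrite /form_coef {2}(coord_vbasis (memvf f)) !raddf_sum /=; apply: eq_bigr => j _.
  by rewrite mevalZ mevalXU mulrC; apply/esym/mcoeffZ.
exists (E \mPo T); last by move=> f Bf; rewrite ET; apply: HE => //; apply: dhomog_is_dhomog.
apply: contraNneq E0 => D0; apply/eqP/vanishing_mpoly_eq0 => c.
(* Every vector of coefficients comes from a form, so the linear change of coordinates is onto and
   the polynomial remains nonzero. *)
pose G : {mpoly K[4]} := \sum_i c 0 i *: 'X_[val (val (enum_val i))].
have hG : G \is n.-homog.
  by apply: rpred_sum => i _; apply: dhomogZ; rewrite dhomogX /= (eqP (valP (enum_val i))).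
have := ET (DHomog hG); rewrite D0 meval0 => ->; apply: meval_eq => i.
rewrite /form_coef raddf_sum (bigD1 i) //= mcoeffZ mcoeffX eqxx mulr1 big1 ?addr0 // => j ji.
rewrite mcoeffZ mcoeffX; case: eqP => [/val_inj/val_inj/enum_val_inj Eji|_]; rewrite ?mulr0 //.
by rewrite Eji eqxx in ji.
Qed.

Definition generic_form (F : {mpoly K[4]}) : Prop :=
  smooth_form F /\ ((3 <= n)%N -> generic_contact F).

Lemma smooth_formZ c F : c != 0 -> smooth_form F -> smooth_form (c *: F).
Proof.
move=> c0 sm v v0 /eqP; rewrite mevalZ mulf_eq0 (negPf c0) => /eqP/(sm v v0)[i ne].
by exists i; rewrite linearZ mevalZ mulf_neq0.
Qed.

Lemma generic_contactZ c F : c != 0 -> generic_contact F -> generic_contact (c *: F).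
Proof.
move=> c0 gc v w u fr; rewrite !dderZ !mevalZ.
have cI x : c * x = 0 -> x = 0 by move/eqP; rewrite mulf_eq0 (negPf c0) => /eqP.
move=> /cI h1 /cI h2 /cI h3 /cI h4 /cI h5 /cI h6.
have [uu uww disc] := gc v w u fr h1 h2 h3 h4 h5 h6; split; rewrite ?mulf_neq0 //.
have E (x y z : K) : 3 * (c * x) ^+ 2 - (c * y) * (c * z) = c ^+ 2 * (3 * x ^+ 2 - y * z) by ring.
by rewrite -subr_eq0 E mulf_neq0 ?expf_neq0 // subr_eq0.
Qed.

Lemma nongeneric_negligible : (2 <= n)%N -> negligible n (fun F => ~ generic_form F).
Proof.
move=> n2; have nC : negligible n (fun F => (3 <= n)%N /\ ~ generic_contact F).
  have [n3|n3] := boolP (3 <= n)%N.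
    by apply: negligible_sub (contact_negligible K n3) => F _ [].
  by apply: negligible_sub (negligible0 _ _) => F _ [].
apply: negligible_sub (negligibleU (singular_negligible K (ltnW n2)) nC) => F hF ng.
apply: contrapT => nB; apply: ng; split=> [v v0 Fv|n3]; last first.
  by apply: contrapT => ngc; apply: nB; right.
apply: contrapT => nex; apply: nB; left; exists v => // i.
by apply/eqP/negPn/negP => ne; apply: nex; exists i.
Qed.

(** The nongeneric forms are stable under nonzero scalars, hence [homogeneous_part] yields the
    homogeneous equation needed on projective space. *)
Lemma generic_form_polynomial : (2 <= n)%N -> exists d (D : {mpoly K[\dim {:V}]}),
  [/\ D != 0, D \is d.-homog & forall f : V, D.@[hcoord f] != 0 -> generic_form f].
Proof.
move=> n2; have [D D0 HD] := negligible_hcoord (nongeneric_negligible n2).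
pose form (x : 'rV[K]_(\dim {:V})) : V := \sum_(i < \dim {:V}) x 0 i *: (vbasis {:V})`_i.
have hform x : hcoord (form x) =1 x 0.
  by move=> i; rewrite /hcoord /form coord_sum_free ?(basis_free (vbasisP _)).
have formh (f : V) : form (\row_i hcoord f i) = f.
  by rewrite [RHS](coord_vbasis (memvf f)); apply: eq_bigr => i _; rewrite mxE.
have formZ c x : form (c *: x) = c *: form x.
  by rewrite scaler_sumr; apply: eq_bigr => i _; rewrite mxE scalerA.
have [|x Bx|d [E [E0 hE BE]]] := @homogeneous_part K _ D (fun x => ~ generic_form (form x)) D0.
- move=> x c c0 nx; rewrite formZ linearZ => -[sm gc]; apply: nx.
  have cE : (form x : {mpoly K[4]}) = c^-1 *: (c *: (form x : {mpoly K[4]})).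
    by rewrite scalerA mulVf // scale1r.
  rewrite cE; split; first by apply: smooth_formZ; rewrite ?invr_neq0.
  by move=> n3; apply: generic_contactZ; rewrite ?invr_neq0 //; apply: gc.
- by rewrite -(HD _ Bx); apply: meval_eq => i; rewrite hform.
exists d, E; split=> // f; apply: contraNP => ng; rewrite -(BE (\row_i hcoord f i)) ?formh //.
by apply/eqP; apply: meval_eq => i; rewrite mxE.
Qed.

End GenericForms.

Lemma mpolyX_eq0 (K : nzRingType) k (m : 'X_{1..k}) : ('X_[m] == 0 :> {mpoly K[k]}) = false.
Proof.
by apply/negbTE/eqP => /(congr1 (mcoeff m))/eqP; rewrite mcoeffX eqxx mcoeff0 oner_eq0.
Qed.

Section NonvanishingPoint.
Variables (K : numFieldType) (V : vectType K).

Lemma projective_nonvanishing d (D : {mpoly K[\dim {:V}]}) : D != 0 -> D \is d.-homog ->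
  (0 < \dim {:V})%N -> exists q : projective V, D.@[hcoord (vpick (val q))] != 0.
Proof.
(* The extra factor X_i0 forces the point found to be nonzero, even if D is constant. *)
move=> D0 hD V0; pose i0 := Ordinal V0; pose E := D * 'X_i0.
have [x Ex] : exists x : 'rV[K]_(\dim {:V}), E.@[x 0] != 0.
  apply: contrapT => nx; suff /eqP : E = 0 by rewrite mulf_eq0 (negPf D0) mpolyX_eq0.
  by apply: vanishing_mpoly_eq0 => x; apply/eqP/negPn/negP => Ex; apply: nx; exists x.
move: Ex; rewrite mevalM mevalXU mulf_eq0 negb_or => /andP[Dx x0].
pose f : V := \sum_(i < \dim {:V}) x 0 i *: (vbasis {:V})`_i.
have fx i : hcoord f i = x 0 i by rewrite /hcoord coord_sum_free ?(basis_free (vbasisP _)).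
have f0 : f != 0.
  by apply: contra_neq x0 => f0; rewrite -fx f0 /hcoord linear0.
have [q [c c0 Eq]] := projective_point f0; exists q.
have <- : D.@[(c *: x) 0] = D.@[hcoord (vpick (val q))].
  by apply: meval_eq => i; rewrite Eq /hcoord linearZ mxE -fx.
by rewrite (homog_eval_scale _ _ hD) mulf_neq0 ?expf_neq0.
Qed.

Lemma dim_forms_gt0 n : (0 < \dim {:dhomog 4 K n})%N.
Proof.
have hX : ('X_[U_(0%R) *+ n] : {mpoly K[4]}) \is n.-homog.
  by rewrite dhomogX /= mdegMn mdeg1 mul1n.
rewrite lt0n dimv_eq0; apply/negP => /eqP E.
have := memvf (DHomog hX); rewrite E memv0 => /eqP/(congr1 val)/eqP.
by rewrite /= mpolyX_eq0.
Qed.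

End NonvanishingPoint.

Theorem mainTheorem3 (R : realType) (n : nat) (hn : (2 <= n)%N) :
  exists U : surface R[i] n -> Prop,
    [/\ zariski_open U,
        (exists S, U S),
        (forall S, U S -> smooth S) &
        forall S, U S ->
          exists s : seq (projective 'rV[R[i]]_4),
            [/\ uniq s,
                (forall q, q \in s <-> tacnodal S q) &
                (size s)%:Z =
                  2 * n%:Z * (n%:Z - 2) * (11 * n%:Z - 24)]].
Proof.
have [d [D [D0 hD HD]]] := generic_form_polynomial R[i] hn.
have gen S : D.@[hcoord (vpick (val S))] != 0 -> generic_form n (equation S) by move/HD.
exists (fun S => D.@[hcoord (vpick (val S))] != 0); split.
- exists (fun G => G = D) => [_ ->|S]; first by exists d.
  by split=> [/negP/negPn/eqP E _ ->|/(_ D erefl) ->] //; rewrite eqxx.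
- exact: projective_nonvanishing D0 hD (dim_forms_gt0 _ n).
- by move=> S /gen[sm _] q Sq; apply/gradient_neq0/sm => //; apply: vpick_neq0.
move=> S /gen[sm gc]; have [n3|n3] := boolP (3 <= n)%N; last first.
  have n2E : n = 2%N by lia.
  (* For n = 2 the formula gives 0, matching the absence of tacnodes on a smooth quadric. *)
  exists [::]; split=> // [q|]; last by rewrite n2E.
  by split=> // /(no_tacnode_quadric hn sm n2E).
have [s [us sE sz]] := tacnodal_points hn sm (gc n3) (@complex_ultralimits R).
by exists s; rewrite sz card_tacnode_selections.
Qed.
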